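(* Let $p$ be a prime and let $G$ be a finite $p$-group with $d(G)=3$, $\Phi(G)\le Z(G)$ and $G'\cong C_p^3$. Then $G$ is a metahamiltonian group if and only if $G$ is (isomorphic to) one of the following non-isomorphic groups (in (1)–(6), $m_3\ge1$, and the relations $[[a_i,a_j],a_k]=1$ for all $i,j,k\in\{1,2,3\}$ are also imposed): (1) $\langle a_1,a_2,a_3 \mid a_1^{p^{m_1+1}}=a_2^{p^{m_2+1}}=a_3^{p^{m_3+1}}=1,\ [a_2,a_3]=a_1^{p^{m_1}},\ [a_1,a_3]=a_2^{\eta p^{m_2}},\ [a_1,a_2]=a_3^{p^{m_3}}\rangle$, where $p$ is odd, $m_1=m_2+1=m_3+1$ and $\eta$ is a fixed square non-residue modulo $p$; (2) $\langle a_1,a_2,a_3 \mid a_1^{p^{m_1+1}}=a_2^{p^{m_2+1}}=a_3^{p^{m_3+1}}=1,\ [a_2,a_3]=a_1^{p^{m_1}},\ [a_1,a_3]=a_2^{lp^{m_2}}a_3^{-p^{m_2}},\ [a_1,a_2]=a_3^{p^{m_3}}\rangle$, where $p$ is odd, $m_1=m_2+1=m_3+1$ and $1+4l\notin(F_p)^2$; (3) $\langle a_1,a_2,a_3 \mid a_1^{2^{m_1+1}}=a_2^{2^{m_2+1}}=a_3^{2^{m_3+1}}=1,\ [a_2,a_3]=a_1^{2^{m_1}},\ [a_3,a_1]=a_2^{2^{m_2}},\ [a_1,a_2]=a_2^{2^{m_2}}a_3^{2^{m_3}}\rangle$, where $m_1=m_2+1=m_3+1$ (here $p=2$); (4) $\langle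 a_1,a_2,a_3 \mid a_1^{p^{m_1+1}}=a_2^{p^{m_2+1}}=a_3^{p^{m_3+1}}=1,\ [a_2,a_3]=a_1^{p^{m_1}},\ [a_1,a_3]=a_2^{\eta p^{m_2}},\ [a_1,a_2]=a_3^{p^{m_3}}\rangle$, where $p$ is odd, $m_1=m_2=m_3+1$ and $\eta$ is a fixed square non-residue modulo $p$; (5) $\langle a_1,a_2,a_3 \mid a_1^{p^{m_1+1}}=a_2^{p^{m_2+1}}=a_3^{p^{m_3+1}}=1,\ [a_2,a_3]=a_1^{p^{m_1}},\ [a_1,a_3]=a_1^{p^{m_1}}a_2^{lp^{m_2}},\ [a_1,a_2]=a_3^{p^{m_3}}\rangle$, where $p$ is odd, $m_1=m_2=m_3+1$ and $1+4l\notin(F_p)^2$; (6) $\langle a_1,a_2,a_3 \mid a_1^{2^{m_1+1}}=a_2^{2^{m_2+1}}=a_3^{2^{m_3+1}}=1,\ [a_2,a_3]=a_1^{2^{m_1}}a_2^{2^{m_2}},\ [a_3,a_1]=a_2^{2^{m_2}},\ [a_1,a_2]=a_3^{2^{m_3}}\rangle$, where $m_1=m_2=m_3+1$ (here $p=2$); (7) $\langle a,b,c \mid a^{4}=b^{4}=c^{4}=1,\ [b,c]=a^2b^2,\ [c,a]=b^2c^2,\ [a,b]=c^2,\ [c^2,a]=[c^2,b]=1\rangle$ (here $p=2$).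
   Context: A metahamiltonian group is a (non-abelian) group all of whose non-normal subgroups are abelian. $d(G)$ is the minimal number of generators of $G$, $\Phi(G)$ the Frattini subgroup, $Z(G)$ the center, $G'$ the derived subgroup, $C_p^3$ the elementary abelian group of order $p^3$. $F_p$ is the field with $p$ elements and $(F_p)^2=\{a^2: a\in F_p\}$; the exponent parameter $l$ is an integer taken modulo $p$ (so $l\in F_p$). Commutators: $[g,h]=g^{-1}h^{-1}gh$. *)

(* Defs.v *)
From mathcomp Require Import all_boot all_algebra all_fingroup all_solvable.

Set Implicit Arguments.
Unset Strict Implicit.
Unset Printing Implicit Defensive.

Import GRing.Theory.

Definition metahamiltonian (gT : finGroupType) (G : {group gT}) : Prop :=
  ~~ abelian G /\
  forall H : {group gT}, H \subset G -> ~~ (H <| G)%g -> abelian H.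

(* (F_p)^2; it contains 0. *)
Definition is_square (p : nat) (x : 'F_p) : bool :=
  [exists a : 'F_p, x == (a ^+ 2)%R].

(* The arguments of the constructors are m1, m2, m3 and, where there is one,
   the exponent parameter l. *)
Inductive label (p : nat) : Type :=
  | L1 of nat & nat & nat
  | L2 of nat & nat & nat & 'F_p
  | L3 of nat & nat & nat
  | L4 of nat & nat & nat
  | L5 of nat & nat & nat & 'F_p
  | L6 of nat & nat & nat
  | L7.

Arguments L1 {p}.
Arguments L3 {p}.
Arguments L4 {p}.
Arguments L6 {p}.
Arguments L7 {p}.

Definition admissible (p : nat) (t : label p) : Prop :=
  match t with
  | L1 m1 m2 m3 => [/\ odd p, 1 <= m3, m1 = m2 + 1 & m2 + 1 = m3 + 1]
  | L2 m1 m2 m3 l =>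
      [/\ odd p, 1 <= m3, m1 = m2 + 1, m2 + 1 = m3 + 1
        & ~~ is_square (1 + 4%:R * l)%R]
  | L3 m1 m2 m3 => [/\ p = 2, 1 <= m3, m1 = m2 + 1 & m2 + 1 = m3 + 1]
  | L4 m1 m2 m3 => [/\ odd p, 1 <= m3, m1 = m2 & m2 = m3 + 1]
  | L5 m1 m2 m3 l =>
      [/\ odd p, 1 <= m3, m1 = m2, m2 = m3 + 1
        & ~~ is_square (1 + 4%:R * l)%R]
  | L6 m1 m2 m3 => [/\ p = 2, 1 <= m3, m1 = m2 & m2 = m3 + 1]
  | L7 => p = 2
  end.

(* Elements of 'F_p in exponents stand for their representatives in [0, p);
   they only ever multiply the exponent of an element of order p.  The relators
   [~ a_i, a_j, a_k] with j <= i follow from those with i < j. *)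
Definition presented_by (p : nat) (eta : 'F_p) (t : label p)
    (gT : finGroupType) (G : {group gT}) : Prop :=
  match t with
  | L1 m1 m2 m3 =>
      (G \isog Grp (a1 : a2 : a3 :
         a1 ^+ (p ^ (m1 + 1))%N, a2 ^+ (p ^ (m2 + 1))%N,
         a3 ^+ (p ^ (m3 + 1))%N,
         [~ a2, a3] = a1 ^+ (p ^ m1)%N,
         [~ a1, a3] = a2 ^+ (eta * p ^ m2)%N,
         [~ a1, a2] = a3 ^+ (p ^ m3)%N,
         [~ a1, a2, a1], [~ a1, a2, a2], [~ a1, a2, a3],
         [~ a1, a3, a1], [~ a1, a3, a2], [~ a1, a3, a3],
         [~ a2, a3, a1], [~ a2, a3, a2], [~ a2, a3, a3]))%g
  | L2 m1 m2 m3 l =>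
      (G \isog Grp (a1 : a2 : a3 :
         a1 ^+ (p ^ (m1 + 1))%N, a2 ^+ (p ^ (m2 + 1))%N,
         a3 ^+ (p ^ (m3 + 1))%N,
         [~ a2, a3] = a1 ^+ (p ^ m1)%N,
         [~ a1, a3] = a2 ^+ (l * p ^ m2)%N * a3 ^- (p ^ m2)%N,
         [~ a1, a2] = a3 ^+ (p ^ m3)%N,
         [~ a1, a2, a1], [~ a1, a2, a2], [~ a1, a2, a3],
         [~ a1, a3, a1], [~ a1, a3, a2], [~ a1, a3, a3],
         [~ a2, a3, a1], [~ a2, a3, a2], [~ a2, a3, a3]))%g
  | L3 m1 m2 m3 =>
      (G \isog Grp (a1 : a2 : a3 :
         a1 ^+ (2 ^ (m1 + 1))%N, a2 ^+ (2 ^ (m2 + 1))%N,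
         a3 ^+ (2 ^ (m3 + 1))%N,
         [~ a2, a3] = a1 ^+ (2 ^ m1)%N,
         [~ a3, a1] = a2 ^+ (2 ^ m2)%N,
         [~ a1, a2] = a2 ^+ (2 ^ m2)%N * a3 ^+ (2 ^ m3)%N,
         [~ a1, a2, a1], [~ a1, a2, a2], [~ a1, a2, a3],
         [~ a1, a3, a1], [~ a1, a3, a2], [~ a1, a3, a3],
         [~ a2, a3, a1], [~ a2, a3, a2], [~ a2, a3, a3]))%g
  | L4 m1 m2 m3 =>
      (G \isog Grp (a1 : a2 : a3 :
         a1 ^+ (p ^ (m1 + 1))%N, a2 ^+ (p ^ (m2 + 1))%N,
         a3 ^+ (p ^ (m3 + 1))%N,
         [~ a2, a3] = a1 ^+ (p ^ m1)%N,
         [~ a1, a3] = a2 ^+ (eta * p ^ m2)%N,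
         [~ a1, a2] = a3 ^+ (p ^ m3)%N,
         [~ a1, a2, a1], [~ a1, a2, a2], [~ a1, a2, a3],
         [~ a1, a3, a1], [~ a1, a3, a2], [~ a1, a3, a3],
         [~ a2, a3, a1], [~ a2, a3, a2], [~ a2, a3, a3]))%g
  | L5 m1 m2 m3 l =>
      (G \isog Grp (a1 : a2 : a3 :
         a1 ^+ (p ^ (m1 + 1))%N, a2 ^+ (p ^ (m2 + 1))%N,
         a3 ^+ (p ^ (m3 + 1))%N,
         [~ a2, a3] = a1 ^+ (p ^ m1)%N,
         [~ a1, a3] = a1 ^+ (p ^ m1)%N * a2 ^+ (l * p ^ m2)%N,
         [~ a1, a2] = a3 ^+ (p ^ m3)%N,
         [~ a1, a2, a1], [~ a1, a2, a2], [~ a1, a2, a3],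
         [~ a1, a3, a1], [~ a1, a3, a2], [~ a1, a3, a3],
         [~ a2, a3, a1], [~ a2, a3, a2], [~ a2, a3, a3]))%g
  | L6 m1 m2 m3 =>
      (G \isog Grp (a1 : a2 : a3 :
         a1 ^+ (2 ^ (m1 + 1))%N, a2 ^+ (2 ^ (m2 + 1))%N,
         a3 ^+ (2 ^ (m3 + 1))%N,
         [~ a2, a3] = a1 ^+ (2 ^ m1)%N * a2 ^+ (2 ^ m2)%N,
         [~ a3, a1] = a2 ^+ (2 ^ m2)%N,
         [~ a1, a2] = a3 ^+ (2 ^ m3)%N,
         [~ a1, a2, a1], [~ a1, a2, a2], [~ a1, a2, a3],
         [~ a1, a3, a1], [~ a1, a3, a2], [~ a1, a3, a3],
         [~ a2, a3, a1], [~ a2, a3, a2], [~ a2, a3, a3]))%g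
  | L7 =>
      (G \isog Grp (a : b : c :
         a ^+ 4, b ^+ 4, c ^+ 4,
         [~ b, c] = a ^+ 2 * b ^+ 2,
         [~ c, a] = b ^+ 2 * c ^+ 2,
         [~ a, b] = c ^+ 2,
         [~ c ^+ 2, a], [~ c ^+ 2, b]))%g
  end.

(* Main.v *)
(* Commutation identifies G' with the exterior square of G / Phi(G) = F_p^3.  If
   [h, k] is non-trivial then [h, G] and [k, G] generate G', so a non-abelian
   subgroup is normal exactly when it contains G', and G is metahamiltonian iff
   G' is contained in <h, k> whenever [h, k] is non-trivial.  Write G / G' as a
   product of cyclic groups of orders p^m1, p^m2, p^m3 with m1 >= m2 >= m3,
   generated by the images of g, x, y.  The powers g^(p^m1), x^(p^m2), y^(p^m3), expressed in the basis
   [x, y], [y, g], [g, x] of G', form a 3 x 3 matrix, and the condition on <h, k>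
   becomes the non-vanishing of a 3 x 3 determinant for each pair of directions.
   Testing it on suitable pairs forces (m1, m2, m3) to be (m + 1, m, m) or
   (m + 1, m + 1, m), with a 2 x 2 block defining an anisotropic binary form,
   which is then normalised; if m1 = m2 = m3, a ternary form over F_p would have
   to be anisotropic, unless p = 2 and m = 1, where squaring is not linear and
   only (7) survives.

   Conversely the normalised relations bound the order of a group satisfying
   them, so that a group of that order satisfying them has the universal
   property of the presentation.  The order of the abelianization distinguishes
   the families and their m_i; the exponents are recovered from a quotient acting
   by affine maps on (Z / p^(s+1))^2, in which the matrix of the form is
   determined up to scalars and conjugacy. *)

Require Import Defs.
From mathcomp Require Import all_boot all_algebra all_fingroup all_solvable.
From mathcomp Require Import ring zify.

Set Implicit Arguments.
Unset Strict Implicit.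
Unset Printing Implicit Defensive.

Import GRing.Theory.

Local Open Scope group_scope.

(** * Commutators in class two *)

(** Under the relations [rel3], the powers of order p of [x] and [y] span the plane [g, <x, y>] of
    G'. Sending [x] and [y] to these powers turns commutation with [g] into an operator T on a plane
    over F_p, with matrix [[al, 1], [ga, de]]. The binary form is det (v, T v): it is anisotropic
    exactly when T has no eigenvector. Changing [x] and [y] conjugates T, rescaling [g] multiplies
    it by a scalar. For odd p this leads to companion matrices: trace 0 leaves the determinant up to
    squares, whence eta; otherwise the trace is scaled to the sign e and the discriminant becomes 1
    + 4 ga. The relation [x, y] = g^(p^r) costs one more scalar, available because an anisotropic
    binary form represents every non-zero value. The prime 2 intervenes through (u v)^n = u^n v^n
    [v, u]^C(n, 2): p divides C(p^m, 2) for m > 0 unless p^m = 2. The groups of the list are never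
    constructed. Presentations are compared through explicit models: a group presented by one label
    maps onto each model of its relations, and such an image also satisfies the relations of any
    other label of that group. *)

Section ClassTwo.

Variables (gT : finGroupType) (G : {group gT}).
Hypothesis cl2 : G^`(1) \subset 'Z(G).

Lemma class2_comm x y z : x \in G -> y \in G -> z \in G -> commute [~ x, y] z.
Proof.
move=> Gx Gy Gz; have /(subsetP cl2)/centerP[_ cxy] := mem_commg Gx Gy.
exact: cxy.
Qed.

Lemma class2_conj x y z :
  x \in G -> y \in G -> z \in G -> [~ x, y] ^ z = [~ x, y].
Proof.
by move=> Gx Gy Gz; apply/conjg_fixP/commgP; apply: class2_comm.
Qed.

Lemma class2_commMl x y z :
  x \in G -> y \in G -> z \in G -> [~ x * y, z] = [~ x, z] * [~ y, z].
Proof. by move=> Gx Gy Gz; rewrite commMgJ class2_conj. Qed.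

Lemma class2_commMr x y z :
  x \in G -> y \in G -> z \in G -> [~ x, y * z] = [~ x, y] * [~ x, z].
Proof.
by move=> Gx Gy Gz; rewrite commgMJ class2_conj // class2_comm ?groupR.
Qed.

Lemma class2_commXl x y n :
  x \in G -> y \in G -> [~ x ^+ n, y] = [~ x, y] ^+ n.
Proof.
by move=> Gx Gy; rewrite commXg //; apply: commute_sym; apply: class2_comm.
Qed.

Lemma class2_commXr x y n :
  x \in G -> y \in G -> [~ x, y ^+ n] = [~ x, y] ^+ n.
Proof.
by move=> Gx Gy; rewrite commgX //; apply: commute_sym; apply: class2_comm.
Qed.

Lemma class2_expM x y n : x \in G -> y \in G ->
  (x * y) ^+ n = x ^+ n * y ^+ n * [~ y, x] ^+ 'C(n, 2).
Proof.
by move=> Gx Gy; apply: expMg_Rmul; apply: commute_sym; apply: class2_comm.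
Qed.

Lemma class2_commVl x y : x \in G -> y \in G -> [~ x^-1, y] = [~ x, y]^-1.
Proof.
move=> Gx Gy; apply: (mulgI [~ x, y]); rewrite mulgV -class2_commMl ?groupV //.
by rewrite mulgV comm1g.
Qed.

End ClassTwo.

(** Modulo its centre, [<<S>>] is generated by pairwise commuting elements, so that quotient is
    abelian. *)
Lemma class2_gen (gT : finGroupType) (S : {set gT}) :
    {in S & &, forall u v w, [~ u, v, w] = 1} ->
  <<S>>^`(1) \subset 'Z(<<S>>).
Proof.
move=> cS; have sS := subset_gen S.
have sSZ : [~: S, S] \subset 'Z(<<S>>).
  rewrite gen_subG; apply/subsetP=> _ /imset2P[u v Su Sv ->].
  rewrite inE groupR ?(subsetP sS) //= cent_gen; apply/centP=> w Sw.
  by apply/commgP; rewrite cS.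
have nZ : <<S>> \subset 'N('Z(<<S>>)) by rewrite normal_norm ?center_normal.
apply: der1_min => //; rewrite -[X in X / _]/(<<S>>) quotient_gen ?abelian_gen.
  by rewrite /abelian quotient_cents2 ?(subset_trans sS).
exact: subset_trans nZ.
Qed.

Section FpExponents.

Variables (p : nat) (gT : finGroupType).
Hypothesis p_pr : prime p.
Implicit Types (z : gT) (a b : 'F_p) (n : nat).

Lemma Fp_expR z n : z ^+ p = 1 -> z ^+ (n%:R : 'F_p)%R = z ^+ n.
Proof. by move=> zp; rewrite val_Fp_nat // expg_mod. Qed.

Lemma Fp_natK a : ((a : nat)%:R)%R = a.
Proof. exact: natr_Zp. Qed.

Lemma Fp_expD z a b : z ^+ p = 1 -> z ^+ (a + b)%R = z ^+ a * z ^+ b.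
Proof.
by move=> zp; rewrite -{1}[a]Fp_natK -{1}[b]Fp_natK -natrD Fp_expR // expgD.
Qed.

Lemma Fp_exp0 z : z ^+ (0 : 'F_p)%R = 1.
Proof. by []. Qed.

Lemma Fp_exp1 z : z ^+ p = 1 -> z ^+ (1 : 'F_p)%R = z.
Proof. by move=> zp; rewrite -[1%R]/(1%:R)%R Fp_expR ?expg1. Qed.

Lemma Fp_expN z a : z ^+ p = 1 -> z ^+ (- a)%R = z ^- a.
Proof.
move=> zp; apply: (mulgI (z ^+ a)).
by rewrite mulgV -Fp_expD // subrr.
Qed.

Lemma Fp_expX z a n : z ^+ p = 1 -> (z ^+ a) ^+ n = z ^+ (n%:R * a)%R.
Proof.
by move=> zp; rewrite -{2}[a]Fp_natK -natrM Fp_expR // -expgM mulnC.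
Qed.

Lemma Fp_nat_eq0 n : ((n%:R : 'F_p) == 0)%R = (p %| n).
Proof. by rewrite -(dvdn_pcharf (pchar_Fp p_pr)). Qed.

(** In p^n (p^n - 1) / 2 the denominator cancels a factor p only for p = 2, and then p^(n-1)
    survives. The excluded case p^n = 2 is the source of (7). *)
Lemma bin2_pX n : 0 < n -> odd p || (1 < n) -> p %| 'C(p ^ n, 2).
Proof.
case: n => // n _ /orP[oddp | n_gt0].
  by rewrite bin2odd ?oddX ?oddp ?orbT // expnS -mulnA dvdn_mulr.
have [oddp | /(prime_oddPn p_pr) p2] := boolP (odd p).
  by rewrite bin2odd ?oddX ?oddp ?orbT // expnS -mulnA dvdn_mulr.
case: n n_gt0 => // n _.
by rewrite bin2 p2 !expnS -mulnA mul2n doubleK -mulnA dvdn_mulr.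
Qed.

End FpExponents.

(** * Coordinates in three-generator groups *)

Lemma gen3_join (gT : finGroupType) (a b c : gT) :
  <<[set a; b; c]>> = <[a]> <*> <[b]> <*> <[c]>.
Proof.
by rewrite joing_idr -[<<[set a; b; c]>>]/([set a; b] <*> [set c])
           -[LHS]joing_idl -[<<[set a; b]>>]/([set a] <*> [set b])
           -[[set a] <*> [set b]]joing_idl -[<<[set a]>> <*> [set b]]joing_idr.
Qed.

Lemma abelian_gen3E (gT : finGroupType) (a b c : gT) :
  abelian <<[set a; b; c]>> -> <<[set a; b; c]>> = <[a]> * <[b]> * <[c]>.
Proof.
rewrite abelian_gen => /centsP cS.
have cab : <[b]> \subset 'C(<[a]>).
  by rewrite cents_cycle //; apply: cS; rewrite !inE eqxx ?orbT.
have cabc : <[c]> \subset 'C(<[a]> * <[b]>).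
  by rewrite centM subsetI !cents_cycle //; apply: cS; rewrite !inE eqxx ?orbT.
by rewrite gen3_join cent_joinEr /= cent_joinEr.
Qed.

Lemma abelian_gen3P (gT : finGroupType) (a b c z : gT) :
    abelian <<[set a; b; c]>> -> z \in <<[set a; b; c]>> ->
  exists i j k, z = a ^+ i * b ^+ j * c ^+ k.
Proof.
move=> cA; rewrite abelian_gen3E //.
case/mulsgP=> _ _ /mulsgP[_ _ /cycleP[i ->] /cycleP[j ->] ->] /cycleP[k ->] ->.
by exists i, j, k.
Qed.

Lemma card_abelian_gen3 (gT : finGroupType) (a b c : gT) i j k :
    abelian <<[set a; b; c]>> ->
    0 < i -> 0 < j -> 0 < k ->
    a ^+ i = 1 -> b ^+ j = 1 -> c ^+ k = 1 ->
  #|<<[set a; b; c]>>| <= i * j * k.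
Proof.
move=> cA i0 j0 k0 ai bj ck; rewrite abelian_gen3E //.
have leM (A B : {set gT}) : #|A * B| <= #|A| * #|B|.
  rewrite -cardsX (leq_trans _ (leq_imset_card (fun u => u.1 * u.2) _)) //.
  apply/subset_leq_card/subsetP=> _ /mulsgP[u v Au Bv ->].
  by apply/imsetP; exists (u, v); rewrite // inE Au.
have le_ord z n : 0 < n -> z ^+ n = 1 -> #|<[z]>| <= n.
  by move=> n0 zn; rewrite dvdn_leq // -/#[z] order_dvdn zn.
apply: (leq_trans (leM _ _)); apply: leq_mul; last exact: le_ord.
apply: (leq_trans (leM _ _)); apply: leq_mul; exact: le_ord.
Qed.

Lemma quotient_gen3 (gT : finGroupType) (H : {group gT}) (a b c : gT) :
    [set a; b; c] \subset 'N(H) ->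
  <<[set a; b; c]>> / H = <<[set coset H a; coset H b; coset H c]>>.
Proof.
by move=> nS; rewrite quotient_gen // /quotient morphimEsub // !imsetU !imset_set1.
Qed.

Section Coordinates.

Variables (gT : finGroupType) (G : {group gT}) (g x y : gT).
Hypothesis defG : <<[set g; x; y]>> = G.
Hypothesis cl2 : G^`(1) \subset 'Z(G).

Local Notation c1 := [~ x, y].
Local Notation c2 := [~ y, g].
Local Notation c3 := [~ g, x].

Lemma gen3_memg : g \in G. Proof. by rewrite -defG mem_gen // !inE eqxx. Qed.
Lemma gen3_memx : x \in G. Proof. by rewrite -defG mem_gen // !inE eqxx orbT. Qed.
Lemma gen3_memy : y \in G. Proof. by rewrite -defG mem_gen // !inE eqxx orbT. Qed.
Let Gg := gen3_memg.
Let Gx := gen3_memx.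
Let Gy := gen3_memy.

Lemma der1_gen3 : G^`(1) = <<[set c1; c2; c3]>>.
Proof.
have sCG : <<[set c1; c2; c3]>> \subset G^`(1).
  rewrite gen_subG; apply/subsetP=> z; rewrite !inE -orbA => /or3P[]/eqP->;
  exact: mem_commg.
apply/eqP; rewrite eqEsubset sCG andbT.
have nC : G \subset 'N(<<[set c1; c2; c3]>>).
  apply: cents_norm; rewrite centsC (subset_trans sCG) //.
  by rewrite (subset_trans cl2) // subsetIr.
apply: der1_min => //; have sSG : [set g; x; y] \subset G.
  by rewrite -defG subset_gen.
have nS := subset_trans sSG nC.
rewrite -{1}defG quotient_gen // abelian_gen /abelian quotient_cents2 // gen_subG.
apply/subsetP=> _ /imset2P[u v Su Sv ->].
have C1 : c1 \in <<[set c1; c2; c3]>> by rewrite mem_gen // !inE eqxx.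
have C2 : c2 \in <<[set c1; c2; c3]>> by rewrite mem_gen // !inE eqxx orbT.
have C3 : c3 \in <<[set c1; c2; c3]>> by rewrite mem_gen // !inE eqxx orbT.
by move: Su Sv; rewrite !inE -!orbA => /or3P[]/eqP-> /or3P[]/eqP->;
  rewrite ?commgg ?group1 // -invg_comm groupV.
Qed.

(* Locked, like [W] below, so that unification never unfolds the products. *)
Definition E3 i j k := locked (g ^+ i * x ^+ j * y ^+ k).
Lemma E3E i j k : E3 i j k = g ^+ i * x ^+ j * y ^+ k.
Proof. by rewrite /E3 -lock. Qed.

Lemma E3_in i j k : E3 i j k \in G.
Proof. by rewrite E3E !groupM // groupX. Qed.

Lemma gen3P h : h \in G -> exists i j k w, w \in G^`(1) /\ h = E3 i j k * w.
Proof.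
move=> Gh; have nG := der_norm 1 G.
have cG : abelian (G / G^`(1)) by apply: sub_der1_abelian.
have sS : [set g; x; y] \subset 'N(G^`(1)).
  by apply: subset_trans nG; rewrite -defG subset_gen.
have defQ := quotient_gen3 sS; rewrite defG in defQ.
have Qh : coset G^`(1) h \in G / G^`(1) by apply: mem_quotient.
rewrite defQ in Qh cG.
have [i [j [k eh]]] := abelian_gen3P cG Qh.
exists i, j, k, ((E3 i j k)^-1 * h); split; last by rewrite mulKVg.
have GE := E3_in i j k.
have N z : z \in G -> z \in 'N(G^`(1)) by move/(subsetP nG).
apply: coset_idr; first by rewrite N ?groupM ?groupV.
rewrite morphM ?morphV ?N ?groupV //= eh E3E.
by rewrite !morphM ?morphX ?N ?groupM ?groupX //= mulVg.
Qed.

Let sDG z : z \in G^`(1) -> z \in G.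
Proof. exact: (subsetP (der_sub 1 G)). Qed.

Lemma der1_commute z h : z \in G^`(1) -> h \in G -> commute z h.
Proof. by move=> /(subsetP cl2)/centerP[_ cz] /cz. Qed.

Lemma E3w_comm i j k w i' j' k' w' : w \in G^`(1) -> w' \in G^`(1) ->
  [~ E3 i j k * w, E3 i' j' k' * w'] = [~ E3 i j k, E3 i' j' k'].
Proof.
move=> Dw Dw'; have [GE GE'] := (E3_in i j k, E3_in i' j' k').
have [Gw Gw'] := (sDG Dw, sDG Dw').
move: (E3 i j k) (E3 i' j' k') GE GE' => e e' GE GE'.
rewrite (class2_commMl cl2) ?groupM // !(class2_commMr cl2) //.
have /commgP/eqP-> := der1_commute Dw GE'.
have /commgP/eqP-> := der1_commute Dw Gw'.
have /commute_sym/commgP/eqP-> := der1_commute Dw' GE.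
by rewrite !mulg1.
Qed.

End Coordinates.

(** The order of the generators matters: in (1)-(6) the first one is the generator whose exponent
    differs from the exponent shared by the other two. *)
Definition frame p (gT : finGroupType) (G : {group gT}) (g x y : gT) :=
  [/\ prime p, <<[set g; x; y]>> = G, G^`(1) \subset 'Z(G), p.-abelem G^`(1)
    & #|G^`(1)| = (p ^ 3)%N].

Section Frame.

Variables (p : nat) (gT : finGroupType) (G : {group gT}) (g x y : gT).
Hypothesis fr : frame p G g x y.

Local Notation c1 := [~ x, y].
Local Notation c2 := [~ y, g].
Local Notation c3 := [~ g, x].

Let p_pr : prime p. Proof. by case: fr. Qed.
Let defG : <<[set g; x; y]>> = G. Proof. by case: fr. Qed.
Let cl2 : G^`(1) \subset 'Z(G). Proof. by case: fr. Qed.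
Let abG' : p.-abelem G^`(1). Proof. by case: fr. Qed.
Let oG' : #|G^`(1)| = (p ^ 3)%N. Proof. by case: fr. Qed.
Let Gg : g \in G := gen3_memg defG.
Let Gx : x \in G := gen3_memx defG.
Let Gy : y \in G := gen3_memy defG.
Local Notation E3 := (E3 g x y).
Let E3_in i j k : E3 i j k \in G := E3_in defG i j k.

Lemma der1_exp z : z \in G^`(1) -> z ^+ p = 1.
Proof. by have /abelemP[// | _ ] := abG'; apply. Qed.

Let Dc1 : c1 \in G^`(1). Proof. exact: mem_commg. Qed.
Let Dc2 : c2 \in G^`(1). Proof. exact: mem_commg. Qed.
Let Dc3 : c3 \in G^`(1). Proof. exact: mem_commg. Qed.
Let c1p := der1_exp Dc1.
Let c2p := der1_exp Dc2.
Let c3p := der1_exp Dc3.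

Let sDG z : z \in G^`(1) -> z \in G.
Proof. exact: (subsetP (der_sub 1 G)). Qed.

Definition W (a b c : 'F_p) :=
  locked (c1 ^+ a * c2 ^+ b * c3 ^+ c).
Arguments W (a b c)%_R.
Lemma WE a b c : W a b c = c1 ^+ a * c2 ^+ b * c3 ^+ c.
Proof. by rewrite /W -lock. Qed.

Lemma W_in a b c : W a b c \in G^`(1).
Proof. by rewrite WE !groupM // groupX. Qed.

Lemma WD a b c a' b' c' :
  W a b c * W a' b' c' = W (a + a')%R (b + b')%R (c + c')%R.
Proof.
have cD u v : u \in G^`(1) -> v \in G^`(1) -> u * v = v * u.
  by move=> Du Dv; apply: (der1_commute cl2) => //; apply: sDG.
rewrite !WE !Fp_expD // -!mulgA; congr (_ * _).
rewrite [c2 ^+ b * _]mulgA [c1 ^+ a' * (c2 ^+ b * _)]mulgA.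
rewrite -[c1 ^+ a' * c2 ^+ b]cD ?groupX // -!mulgA; congr (_ * _).
rewrite [c3 ^+ c * (c1 ^+ a' * _)]mulgA [c3 ^+ c * _]cD ?groupX // -!mulgA; congr (_ * _).
by rewrite mulgA [c3 ^+ c * _]cD ?groupX // -!mulgA.
Qed.

Lemma W0 : W 0 0 0 = 1. Proof. by rewrite !WE !Fp_exp0 !mulg1. Qed.

Lemma WX a b c n : W a b c ^+ n = W (n%:R * a)%R (n%:R * b)%R (n%:R * c)%R.
Proof.
elim: n => [|n IHn]; first by rewrite !mul0r W0.
by rewrite expgS IHn WD !mulrS !mulrDl !mul1r.
Qed.

Lemma WN a b c : (W a b c)^-1 = W (- a)%R (- b)%R (- c)%R.
Proof. by apply: (mulgI (W a b c)); rewrite mulgV WD !subrr W0. Qed.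

Lemma W_c1 : W 1 0 0 = c1.
Proof. by rewrite !WE !Fp_exp0 Fp_exp1 // !mulg1. Qed.
Lemma W_c2 : W 0 1 0 = c2.
Proof. by rewrite !WE !Fp_exp0 Fp_exp1 // mulg1 mul1g. Qed.
Lemma W_c3 : W 0 0 1 = c3.
Proof. by rewrite !WE !Fp_exp0 Fp_exp1 // !mul1g. Qed.

Lemma W_surj z : z \in G^`(1) -> exists a b c, z = W a b c.
Proof.
move=> Dz; have cD : abelian G^`(1) by apply: abelem_abelian abG'.
rewrite (der1_gen3 defG cl2) in Dz cD; have [i [j [k ->]]] := abelian_gen3P cD Dz.
by exists (i%:R)%R, (j%:R)%R, (k%:R)%R; rewrite !WE !Fp_expR.
Qed.

(** Counting: [W] maps the p^3 triples onto the p^3 elements of G'. *)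
Lemma W_inj a b c a' b' c' :
  W a b c = W a' b' c' -> [/\ a = a', b = b' & c = c'].
Proof.
pose f (u : 'F_p * 'F_p * 'F_p) := W u.1.1 u.1.2 u.2.
have imf : f @: [set: 'F_p * 'F_p * 'F_p] = G^`(1).
  apply/setP=> z; apply/imsetP/idP=> [[u _ ->] | Dz]; first exact: W_in.
  by have [a0 [b0 [c0 ->]]] := W_surj Dz; exists (a0, b0, c0).
have/imset_injP injf : #|f @: [set: 'F_p * 'F_p * 'F_p]| == #|[set: 'F_p * 'F_p * 'F_p]|.
  by rewrite imf oG' cardsT !card_prod card_Fp // !expnS expn0 muln1 mulnA.
move=> eW; have := injf (a, b, c) (a', b', c') (in_setT _) (in_setT _) eW.
by case.
Qed.

(** The basic commutators are taken in cyclic order so that bracketing becomes the cross product of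
    exponent vectors. *)
Lemma E3_comm i j k i' j' k' :
  [~ E3 i j k, E3 i' j' k'] =
  W (j%:R * k'%:R - k%:R * j'%:R)%R (k%:R * i'%:R - i%:R * k'%:R)%R
    (i%:R * j'%:R - j%:R * i'%:R)%R.
Proof.
have e1 : [~ y, x] = W (-1)%R 0 0 by rewrite -invg_comm -W_c1 WN oppr0.
have e2 : [~ g, y] = W 0 (-1)%R 0 by rewrite -invg_comm -W_c2 WN oppr0.
have e3 : [~ x, g] = W 0 0 (-1)%R by rewrite -invg_comm -W_c3 WN oppr0.
rewrite !E3E !(class2_commMl cl2) ?(class2_commMr cl2) ?groupM ?groupX //.
rewrite !(class2_commXl cl2) ?groupX // !(class2_commXr cl2) // !commgg !expg1n.
rewrite !mul1g !mulg1 e1 e2 e3 -W_c1 -W_c2 -W_c3 !WX !WD.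
by congr W; ring.
Qed.

Lemma E3_expX i j k n : (E3 i j k) ^+ n =
  E3 (i * n) (j * n) (k * n) *
  W ('C(n, 2)%:R * (- j%:R * k%:R))%R ('C(n, 2)%:R * (i%:R * k%:R))%R
    ('C(n, 2)%:R * (- i%:R * j%:R))%R.
Proof.
rewrite !E3E.
have e1 : [~ y, x] = W (-1)%R 0 0 by rewrite -invg_comm -W_c1 WN oppr0.
have e3 : [~ x, g] = W 0 0 (-1)%R by rewrite -invg_comm -W_c3 WN oppr0.
rewrite (class2_expM cl2) ?groupM ?groupX // (class2_expM cl2) ?groupX //.
rewrite (class2_commMr cl2) ?groupX // -!expgM.
rewrite !(class2_commXl cl2) ?groupX // !(class2_commXr cl2) // .
rewrite e1 e3 -W_c2 !WX !WD WX -!mulgA; congr (_ * (_ * _)).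
rewrite mulgA (der1_commute cl2 (W_in _ _ _)) ?groupX // -mulgA WD.
by congr (_ * W _ _ _); ring.
Qed.

End Frame.
Arguments W {p gT} g x y (a b c)%_R.

(** * The determinant criterion *)

Definition det3 (F : pzRingType) (a1 a2 a3 b1 b2 b3 c1 c2 c3 : F) : F :=
  (a1 * (b2 * c3 - b3 * c2) - a2 * (b1 * c3 - b3 * c1)
   + a3 * (b1 * c2 - b2 * c1))%R.

(** The triple f is read as a linear form on G' that kills the three rows: it witnesses that they
    generate a proper subgroup. *)
Lemma det3_eq0 (F : fieldType) (a1 a2 a3 b1 b2 b3 c1 c2 c3 : F) :
    det3 a1 a2 a3 b1 b2 b3 c1 c2 c3 = 0%R ->
  exists f1 f2 f3 : F, [/\ [|| f1 != 0, f2 != 0 | f3 != 0]%R,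
    a1 * f1 + a2 * f2 + a3 * f3 = 0, b1 * f1 + b2 * f2 + b3 * f3 = 0 &
    c1 * f1 + c2 * f2 + c3 * f3 = 0]%R.
Proof.
(* The transpose is used because [det0P] yields a vector that is killed when multiplied on the
   left. *)
pose r := [:: [:: a1; b1; c1]; [:: a2; b2; c2]; [:: a3; b3; c3]].
pose M : 'M[F]_3 := (\matrix_(i, j) nth 0 (nth [::] r i) j)%R.
have -> : det3 a1 a2 a3 b1 b2 b3 c1 c2 c3 = (\det M)%R.
  rewrite (expand_det_row _ ord0) !big_ord_recl big_ord0 /cofactor.
  do 3!rewrite (expand_det_row _ ord0) !big_ord_recl big_ord0 /cofactor !det_mx11.
  by rewrite !mxE /= /det3; ring.
move/eqP/det0P=> [v v_neq0 vM].
exists (v ord0 0%R), (v ord0 1%R), (v ord0 2%:R%R).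
have e (j : 'I_3) : (v 0 0 * M 0 j + v 0 1 * M 1 j + v 0 2%:R * M 2%:R j = 0)%R.
  have E : (v *m M)%R ord0 j = 0%R by rewrite vM mxE.
  rewrite mxE !big_ord_recl big_ord0 addr0 addrA in E; rewrite -[RHS]E.
  by congr (v _ _ * M _ _ + v _ _ * M _ _ + v _ _ * M _ _)%R; apply: val_inj.
split.
- apply: contraR v_neq0; rewrite !negb_or !negbK => /and3P[/eqP v0 /eqP v1 /eqP v2].
  apply/eqP/rowP=> j; rewrite mxE; case: j => [[|[|[|j]]] //= lj].
  + by rewrite -[RHS]v0; congr (v _ _); apply: val_inj.
  + by rewrite -[RHS]v1; congr (v _ _); apply: val_inj.
  + by rewrite -[RHS]v2; congr (v _ _); apply: val_inj.
- by rewrite -[RHS](e 0%R) !mxE /=; ring.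
- by rewrite -[RHS](e 1%R) !mxE /=; ring.
- by rewrite -[RHS](e 2%:R%R) !mxE /=; ring.
Qed.

Lemma cramer3 (F : fieldType) (a1 a2 a3 b1 b2 b3 c1 c2 c3 u v w : F) :
    det3 a1 a2 a3 b1 b2 b3 c1 c2 c3 != 0%R ->
  exists r s t, [/\ u = r * a1 + s * b1 + t * c1, v = r * a2 + s * b2 + t * c2
    & w = r * a3 + s * b3 + t * c3]%R.
Proof.
rewrite /det3 => d0.
exists ((u * (b2 * c3 - b3 * c2) + v * (b3 * c1 - b1 * c3) + w * (b1 * c2 - b2 * c1)) / det3 a1 a2 a3 b1 b2 b3 c1 c2 c3)%R.
exists ((u * (c2 * a3 - c3 * a2) + v * (c3 * a1 - c1 * a3) + w * (c1 * a2 - c2 * a1)) / det3 a1 a2 a3 b1 b2 b3 c1 c2 c3)%R.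
exists ((u * (a2 * b3 - a3 * b2) + v * (a3 * b1 - a1 * b3) + w * (a1 * b2 - a2 * b1)) / det3 a1 a2 a3 b1 b2 b3 c1 c2 c3)%R.
by split; rewrite /det3; field.
Qed.

(** The commutator is added as a redundant generator so that [gen3P] applies; being central, it
    leaves <[x, y]> as the derived subgroup. *)
Lemma class2_gen2P (gT : finGroupType) (G : {group gT}) (x y z : gT) :
    G^`(1) \subset 'Z(G) -> x \in G -> y \in G -> z \in <<[set x; y]>> ->
  exists i j k, z = x ^+ i * y ^+ j * [~ x, y] ^+ k.
Proof.
move=> cl2 Gx Gy Kz; pose c := [~ x, y].
have Gc : c \in G by apply: groupR.
have cc h : h \in G -> commute c h by move=> Gh; apply: (class2_comm cl2).
pose K := <<[set c; x; y]>>%G.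
have cS (u v w : gT) : u \in [set c; x; y] -> v \in [set c; x; y] ->
    w \in [set c; x; y] -> [~ u, v, w] = 1.
  have sG : [set c; x; y] \subset G.
    by apply/subsetP=> h; rewrite !inE -orbA => /or3P[]/eqP->.
  move=> /(subsetP sG) Gu /(subsetP sG) Gv /(subsetP sG) Gw.
  by apply/eqP/commgP; apply: (class2_comm cl2).
have cl2K : K^`(1) \subset 'Z(K) by apply: class2_gen.
have Kz' : z \in K by apply: subsetP Kz; apply: genS; apply/subsetP=> h; rewrite !inE => /orP[]->; rewrite ?orbT.
have defK : <<[set c; x; y]>> = K by [].
have [i [j [k [w [Dw ->]]]]] := gen3P defK Kz'.
move: Dw; rewrite (der1_gen3 defK cl2K).
have /commgP/eqP-> := commute_sym (cc y Gy).
have /commgP/eqP-> := cc x Gx.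
move=> Dw; have /cycleP[n ->] : w \in <[c]>.
  apply: subsetP Dw; rewrite gen_subG; apply/subsetP=> h.
  by rewrite !inE -orbA => /or3P[]/eqP->; rewrite ?group1 ?cycle_id.
exists j, k, (i + n); rewrite E3E expgD mulgA; congr (_ * _).
rewrite -mulgA; apply: commute_sym; apply: commuteX; apply: commute_sym.
by apply: cc; rewrite groupM ?groupX.
Qed.

Section Frame.

Variables (p : nat) (gT : finGroupType) (G : {group gT}) (g x y : gT).
Hypothesis fr : frame p G g x y.
Let p_pr : prime p. Proof. by case: fr. Qed.
Let defG : <<[set g; x; y]>> = G. Proof. by case: fr. Qed.
Let cl2 : G^`(1) \subset 'Z(G). Proof. by case: fr. Qed.
Local Notation W := (@W p gT g x y).
Local Notation E3 := (E3 g x y).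

Lemma W_scale (H : {group gT}) (s a b c : 'F_p) :
  W a b c \in H -> W (s * a) (s * b) (s * c) \in H.
Proof.
by move=> Ha; rewrite -[s]Fp_natK -(WX fr) groupX.
Qed.

Lemma W_gen (H : {group gT}) a1 a2 a3 b1 b2 b3 c1 c2 c3 :
    W a1 a2 a3 \in H -> W b1 b2 b3 \in H -> W c1 c2 c3 \in H ->
    (det3 a1 a2 a3 b1 b2 b3 c1 c2 c3 != 0)%R -> G^`(1) \subset H.
Proof.
move=> Ha Hb Hc d0.
have comb r s t : W (r * a1 + s * b1 + t * c1) (r * a2 + s * b2 + t * c2)
    (r * a3 + s * b3 + t * c3) \in H.
  by rewrite -!(WD fr) !groupM // W_scale.
apply/subsetP=> z /(W_surj fr)[u [v [w ->]]].
by have [r [s [t [-> -> ->]]]] := cramer3 u v w d0.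
Qed.

(** If the determinant vanished, a non-zero linear form on G' would kill [h1 ^+ a], [h2 ^+ b] and
    [h1, h2]. By the last hypothesis these generate all of <h1, h2> that lies in G', so the form
    would kill G' itself. *)
Lemma pair_det h1 h2 a b u1 u2 u3 v1 v2 v3 w1 w2 w3 :
    h1 \in G -> h2 \in G -> G^`(1) \subset <<[set h1; h2]>> ->
    h1 ^+ a = W u1 u2 u3 -> h2 ^+ b = W v1 v2 v3 -> [~ h1, h2] = W w1 w2 w3 ->
    (forall i j, h1 ^+ i * h2 ^+ j \in G^`(1) -> (a %| i) && (b %| j)) ->
  (det3 u1 u2 u3 v1 v2 v3 w1 w2 w3 != 0)%R.
Proof.
move=> G1 G2 sH e1 e2 e3 ind; apply/eqP=> /det3_eq0[f1 [f2 [f3 [f0 fu fv fw]]]].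
have kill m1 m2 m3 : (m1 * f1 + m2 * f2 + m3 * f3 = 0)%R.
  have Dz := W_in fr m1 m2 m3.
  have [i [j [k ez]]] := class2_gen2P cl2 G1 G2 (subsetP sH _ Dz).
  have Dij : h1 ^+ i * h2 ^+ j \in G^`(1).
    by rewrite -(groupMr _ (groupX k (mem_commg G1 G2))) -ez.
  have /andP[/dvdnP[i' ei] /dvdnP[j' ej]] := ind _ _ Dij.
  move: ez; rewrite ei ej mulnC expgM e1 [(j' * b)%N]mulnC expgM e2 e3 !(WX fr) !(WD fr).
  case/(W_inj fr) => -> -> ->.
  transitivity (i'%:R * (u1 * f1 + u2 * f2 + u3 * f3) + j'%:R * (v1 * f1 + v2 * f2 + v3 * f3)
    + k%:R * (w1 * f1 + w2 * f2 + w3 * f3))%R; first by ring.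
  by rewrite fu fv fw; ring.
case/or3P: f0 => /negP[]; apply/eqP.
- by have := kill 1%R 0%R 0%R; rewrite mul1r !mul0r !addr0.
- by have := kill 0%R 1%R 0%R; rewrite mul1r !mul0r addr0 add0r.
- by have := kill 0%R 0%R 1%R; rewrite mul1r !mul0r !add0r.
Qed.

Lemma W_eq1 a b c : (W a b c == 1) = [&& a == 0, b == 0 & c == 0]%R.
Proof.
apply/eqP/and3P=> [| [/eqP-> /eqP-> /eqP->]]; last exact: (W0 p g x y).
by rewrite -(W0 p g x y) => /(W_inj fr)[-> -> ->].
Qed.

Lemma frame_nonabelian : ~~ abelian G.
Proof.
apply/negP => /derG1P G1; have := (cardG_gt0 G); case: fr => p_p _ _ _.
rewrite G1 cards1 => /eqP; rewrite eq_sym -[1%N]/(1 ^ 3)%N eqn_exp2r //.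
by move/eqP=> p1; rewrite p1 in p_p.
Qed.

Lemma metahamiltonian_gen2 h1 h2 : metahamiltonian G -> h1 \in G -> h2 \in G ->
  [~ h1, h2] != 1 -> G^`(1) \subset <<[set h1; h2]>>.
Proof.
move=> [_ mG] G1 G2 c12; pose H := <<[set h1; h2]>>%G.
have H1 : h1 \in H by rewrite mem_gen // !inE eqxx.
have H2 : h2 \in H by rewrite mem_gen // !inE eqxx orbT.
have sHG : H \subset G.
  by rewrite gen_subG; apply/subsetP=> z; rewrite !inE => /orP[]/eqP->.
have nH : H <| G.
  apply: contraR c12 => nnH; have /centsP cH := mG H sHG nnH.
  by apply/commgP; apply: cH.
have HR h z : h \in H -> z \in G -> [~ h, z] \in H.
  by move=> Hh Gz; rewrite groupM ?groupV ?memJ_norm // (subsetP (normal_norm nH)).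
have [i [j [k [w [Dw e1]]]]] := gen3P defG G1.
have [i' [j' [k' [w' [Dw' e2]]]]] := gen3P defG G2.
have R1 a b c : [~ h1, E3 a b c] \in H by rewrite HR ?(E3_in defG).
have R2 a b c : [~ h2, E3 a b c] \in H by rewrite HR ?(E3_in defG).
have R1' := R1; rewrite e1 in R1; rewrite e2 in R2.
rewrite e1 e2 (E3w_comm defG cl2) // (E3_comm fr) W_eq1 in c12.
have {}R1 a b c : [~ E3 i j k, E3 a b c] \in H.
  by have := R1 a b c; rewrite -[E3 a b c]mulg1 (E3w_comm defG cl2) ?group1 // mulg1.
have {}R2 a b c : [~ E3 i' j' k', E3 a b c] \in H.
  by have := R2 a b c; rewrite -[E3 a b c]mulg1 (E3w_comm defG cl2) ?group1 // mulg1.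
have [[T1 T2] T3] := (R1 1%N 0%N 0%N, R1 0%N 1%N 0%N, R1 0%N 0%N 1%N).
have [[S1 S2] S3] := (R2 1%N 0%N 0%N, R2 0%N 1%N 0%N, R2 0%N 0%N 1%N).
rewrite !(E3_comm fr) in T1 T2 T3 S1 S2 S3.
move: c12 T1 T2 T3 S1 S2 S3; rewrite -[0%:R%R]/(0 : 'F_p)%R -[1%:R%R]/(1 : 'F_p)%R !mulr1 !mulr0.
set u1 : 'F_p := (i%:R)%R; set u2 : 'F_p := (j%:R)%R; set u3 : 'F_p := (k%:R)%R.
set v1 : 'F_p := (i'%:R)%R; set v2 : 'F_p := (j'%:R)%R; set v3 : 'F_p := (k'%:R)%R.
move=> c12 T1 T2 T3 S1 S2 S3.
pose n1 := (u2 * v3 - u3 * v2)%R; pose n2 := (u3 * v1 - u1 * v3)%R.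
pose n3 := (u1 * v2 - u2 * v1)%R.
move: c12; rewrite -/n1 -/n2 -/n3 !negb_and => /or3P[] n0.
(* With u and v the exponent vectors of [h1] and [h2], the normal subgroup contains all u x e_i and
   v x e_i. Two of the first kind and one of the second have as determinant, up to sign, an entry of
   u times a component of u x v; since that component is non-zero, a suitable entry of u is non-zero
   too. *)
- have [u20 | u20] := eqVneq u2 0%R; last first.
    by apply: (W_gen T1 S1 T3); rewrite (_ : det3 _ _ _ _ _ _ _ _ _ = u2 * n1)%R ?mulf_neq0 ?oppr_eq0 // /det3 /n1; ring.
  have u30 : (u3 != 0)%R by apply: contraNneq n0 => u30; rewrite /n1 u20 u30 !mul0r subrr.
  by apply: (W_gen T1 S1 T2); rewrite (_ : det3 _ _ _ _ _ _ _ _ _ = (- u3) * n1)%R ?mulf_neq0 ?oppr_eq0 // /det3 /n1; ring.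
- have [u30 | u30] := eqVneq u3 0%R; last first.
    by apply: (W_gen T2 S2 T1); rewrite (_ : det3 _ _ _ _ _ _ _ _ _ = u3 * n2)%R ?mulf_neq0 ?oppr_eq0 // /det3 /n2; ring.
  have u10 : (u1 != 0)%R by apply: contraNneq n0 => u10; rewrite /n2 u10 u30 !mul0r subrr.
  by apply: (W_gen T2 S2 T3); rewrite (_ : det3 _ _ _ _ _ _ _ _ _ = (- u1) * n2)%R ?mulf_neq0 ?oppr_eq0 // /det3 /n2; ring.
- have [u10 | u10] := eqVneq u1 0%R; last first.
    by apply: (W_gen T3 S3 T2); rewrite (_ : det3 _ _ _ _ _ _ _ _ _ = u1 * n3)%R ?mulf_neq0 ?oppr_eq0 // /det3 /n3; ring.
  have u20 : (u2 != 0)%R by apply: contraNneq n0 => u20; rewrite /n3 u10 u20 !mul0r subrr.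
  by apply: (W_gen T3 S3 T1); rewrite (_ : det3 _ _ _ _ _ _ _ _ _ = (- u2) * n3)%R ?mulf_neq0 ?oppr_eq0 // /det3 /n3; ring.
Qed.

Lemma gen2_metahamiltonian :
    (forall h1 h2, h1 \in G -> h2 \in G -> [~ h1, h2] != 1 ->
       G^`(1) \subset <<[set h1; h2]>>) ->
  metahamiltonian G.
Proof.
move=> gen2; split=> [|H sHG]; first exact: frame_nonabelian.
apply: contraR => nabH.
have [h1 [h2 [H1 H2 c12]]] : exists h1 h2, [/\ h1 \in H, h2 \in H & [~ h1, h2] != 1].
  move: nabH; rewrite /abelian => /subsetPn[h1 H1 /centP nc].
  have [/existsP[h2 /andP[H2 c12]] | none] := boolP [exists h2, (h2 \in H) && ([~ h1, h2] != 1)].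
    by exists h1, h2.
  case: nc => h2 H2; apply/commgP; apply: contraR none => c12.
  by apply/existsP; exists h2; rewrite H2.
apply: sub_der1_normal => //.
apply: subset_trans (gen2 _ _ (subsetP sHG _ H1) (subsetP sHG _ H2) c12) _.
by rewrite gen_subG; apply/subsetP=> z; rewrite !inE => /orP[]/eqP->.
Qed.

End Frame.

Lemma E3_mul (gT : finGroupType) (G : {group gT}) (g x y : gT) i j k i' j' k' :
    <<[set g; x; y]>> = G ->
  exists2 w, w \in G^`(1) &
    E3 g x y i j k * E3 g x y i' j' k' = E3 g x y (i + i') (j + j') (k + k') * w.
Proof.
move=> defG; set e := E3 g x y; have nG := der_norm 1 G.
have cG : abelian (G / G^`(1)) by apply: sub_der1_abelian.
have N z : z \in G -> z \in 'N(G^`(1)) by move/(subsetP nG).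
have [Gg Gx Gy] := And3 (gen3_memg defG) (gen3_memx defG) (gen3_memy defG).
have Ge a b c : e a b c \in G by apply: E3_in.
have sw (u v w : coset_of G^`(1)) :
    u \in G / G^`(1) -> v \in G / G^`(1) -> u * (v * w) = v * (u * w).
  by move=> Qu Qv; rewrite mulgA ((centsP cG) u Qu v Qv) -mulgA.
have Qg n : coset G^`(1) g ^+ n \in G / G^`(1) by rewrite groupX ?mem_quotient.
have Qx n : coset G^`(1) x ^+ n \in G / G^`(1) by rewrite groupX ?mem_quotient.
have Qy n : coset G^`(1) y ^+ n \in G / G^`(1) by rewrite groupX ?mem_quotient.
have eE a b c : coset G^`(1) (e a b c) =
    coset G^`(1) g ^+ a * coset G^`(1) x ^+ b * coset G^`(1) y ^+ c.
  by rewrite /e E3E !morphM ?morphX ?N ?groupM ?groupX.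
exists ((e (i + i') (j + j') (k + k'))^-1 * (e i j k * e i' j' k')); last first.
  by rewrite mulKVg.
apply: coset_idr; first by rewrite N ?groupM ?groupV.
rewrite !morphM ?morphV ?N ?groupM ?groupV //= !eE.
apply/eqP; rewrite -eq_invg_mul invgK; apply/eqP.
rewrite !expgD -!mulgA; congr (_ * _).
rewrite [coset _ y ^+ k * (coset _ g ^+ i' * _)]sw // [LHS]sw //; congr (_ * (_ * _)).
exact: sw.
Qed.

Section Data.

Variables (p : nat) (gT : finGroupType) (G : {group gT}) (g x y : gT).
Variables (m1 m2 m3 : nat) (n11 n12 n13 n21 n22 n23 n31 n32 n33 : 'F_p).

Hypothesis fr : frame p G g x y.
Hypothesis eg : g ^+ (p ^ m1) = W g x y n11 n12 n13.
Hypothesis ex : x ^+ (p ^ m2) = W g x y n21 n22 n23.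
Hypothesis ey : y ^+ (p ^ m3) = W g x y n31 n32 n33.

Let p_pr : prime p. Proof. by case: fr. Qed.
Let defG : <<[set g; x; y]>> = G. Proof. by case: fr. Qed.
Let cl2 : G^`(1) \subset 'Z(G). Proof. by case: fr. Qed.
Local Notation W := (@W p gT g x y).
Local Notation E3 := (E3 g x y).

Lemma E3_pow i j k a t1 t2 t3 :
    (i * a = p ^ m1 * t1)%N -> (j * a = p ^ m2 * t2)%N -> (k * a = p ^ m3 * t3)%N ->
  E3 i j k ^+ a =
  W (t1%:R * n11 + t2%:R * n21 + t3%:R * n31 + 'C(a, 2)%:R * (- j%:R * k%:R))
    (t1%:R * n12 + t2%:R * n22 + t3%:R * n32 + 'C(a, 2)%:R * (i%:R * k%:R))
    (t1%:R * n13 + t2%:R * n23 + t3%:R * n33 + 'C(a, 2)%:R * (- i%:R * j%:R)).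
Proof.
move=> e1 e2 e3; rewrite (E3_expX fr) e1 e2 e3 E3E !expgM eg ex ey !(WX fr) !(WD fr).
by [].
Qed.

Hypothesis ind : forall i j k, E3 i j k \in G^`(1) ->
  [&& p ^ m1 %| i, p ^ m2 %| j & p ^ m3 %| k].
Hypothesis mG : metahamiltonian G.

(** The constraints on the power map come from choices of u and v here. The hypotheses on a, b, s
    and t say that, modulo G', the two elements generate a direct product of cyclic groups of orders
    a and b; the rows are the a-th power, the b-th power and the commutator. *)
Lemma metahamiltonian_det u1 u2 u3 v1 v2 v3 a b t1 t2 t3 s1 s2 s3 :
    (u1 * a)%N = (p ^ m1 * t1)%N -> (u2 * a = p ^ m2 * t2)%N -> (u3 * a = p ^ m3 * t3)%N ->
    (v1 * b = p ^ m1 * s1)%N -> (v2 * b = p ^ m2 * s2)%N -> (v3 * b = p ^ m3 * s3)%N ->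
    (forall i j : nat, p ^ m1 %| u1 * i + v1 * j -> p ^ m2 %| u2 * i + v2 * j ->
       p ^ m3 %| u3 * i + v3 * j -> (a %| i) && (b %| j))%N ->
    [|| u2%:R * v3%:R - u3%:R * v2%:R != 0 :> 'F_p,
        u3%:R * v1%:R - u1%:R * v3%:R != 0 :> 'F_p |
        u1%:R * v2%:R - u2%:R * v1%:R != 0 :> 'F_p]%R ->
  (det3
    (t1%:R * n11 + t2%:R * n21 + t3%:R * n31 + 'C(a, 2)%:R * (- u2%:R * u3%:R))
    (t1%:R * n12 + t2%:R * n22 + t3%:R * n32 + 'C(a, 2)%:R * (u1%:R * u3%:R))
    (t1%:R * n13 + t2%:R * n23 + t3%:R * n33 + 'C(a, 2)%:R * (- u1%:R * u2%:R))
    (s1%:R * n11 + s2%:R * n21 + s3%:R * n31 + 'C(b, 2)%:R * (- v2%:R * v3%:R))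
    (s1%:R * n12 + s2%:R * n22 + s3%:R * n32 + 'C(b, 2)%:R * (v1%:R * v3%:R))
    (s1%:R * n13 + s2%:R * n23 + s3%:R * n33 + 'C(b, 2)%:R * (- v1%:R * v2%:R))
    (u2%:R * v3%:R - u3%:R * v2%:R) (u3%:R * v1%:R - u1%:R * v3%:R)
    (u1%:R * v2%:R - u2%:R * v1%:R) != 0 :> 'F_p)%R.
Proof.
move=> e1 e2 e3 f1 f2 f3 dv nz.
have [Gu Gv] := (E3_in defG u1 u2 u3, E3_in defG v1 v2 v3).
apply: (pair_det fr Gu Gv _ (E3_pow e1 e2 e3) (E3_pow f1 f2 f3) (E3_comm fr _ _ _ _ _ _)).
  apply: (metahamiltonian_gen2 fr mG) => //.
  by rewrite (E3_comm fr) (W_eq1 fr) !negb_and.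
move=> i j; rewrite !(E3_expX fr); set w := W _ _ _; set w' := W _ _ _.
have [Dw Dw'] : w \in G^`(1) /\ w' \in G^`(1) by rewrite !(W_in fr).
set e := E3 _ _ _; set e' := E3 _ _ _.
have [w0 Dw0 ee] := E3_mul (u1 * i) (u2 * i) (u3 * i) (v1 * j) (v2 * j) (v3 * j) defG.
have Ge' : e' \in G by apply: (E3_in defG).
have -> : e * w * (e' * w') = e * e' * (w * w').
  by rewrite -!mulgA [w * (e' * _)]mulgA (der1_commute cl2 Dw Ge') -!mulgA.
rewrite (groupMr _ (groupM Dw Dw')) ee groupMr // => /ind/and3P[]; exact: dv.
Qed.

End Data.

(** * Shape of the power map *)

Lemma Fp_line_eq0 p (a b : 'F_p) :
  prime p -> (forall j : nat, a + j%:R * b != 0)%R -> b = 0%R.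
Proof.
move=> p_pr nz; apply/eqP; apply: contraT => b0.
by have := nz (- a / b)%R; rewrite Fp_natK divfK // subrr eqxx.
Qed.

Lemma Fp_pX_eq0 p k : prime p -> 0 < k -> ((p ^ k)%:R = 0 :> 'F_p)%R.
Proof. by move=> p_pr k0; apply/eqP; rewrite Fp_nat_eq0 // dvdn_exp. Qed.

Lemma lin2_eq0 (F : fieldType) (a b c d x y : F) :
  (a * d - b * c != 0 -> a * x = b * y -> c * x = d * y -> x = 0 /\ y = 0)%R.
Proof.
move=> D e1 e2; have ex : ((a * d - b * c) * x = 0)%R.
  by transitivity (d * (a * x) - b * (c * x))%R; [ring | rewrite e1 e2; ring].
have ey : ((a * d - b * c) * y = 0)%R.
  by transitivity (a * (d * y) - c * (b * y))%R; [ring | rewrite -e1 -e2; ring].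
by move/eqP: ex; move/eqP: ey; rewrite !mulf_eq0 (negPf D) /= => /eqP-> /eqP->.
Qed.

Section Data.

Variables (p : nat) (gT : finGroupType) (G : {group gT}) (g x y : gT).
Variables (m1 m2 m3 : nat) (n11 n12 n13 n21 n22 n23 n31 n32 n33 : 'F_p).

Hypothesis fr : frame p G g x y.
Hypothesis eg : g ^+ (p ^ m1) = W g x y n11 n12 n13.
Hypothesis ex : x ^+ (p ^ m2) = W g x y n21 n22 n23.
Hypothesis ey : y ^+ (p ^ m3) = W g x y n31 n32 n33.
Hypothesis ind : forall i j k, E3 g x y i j k \in G^`(1) ->
  [&& p ^ m1 %| i, p ^ m2 %| j & p ^ m3 %| k].
Hypothesis mG : metahamiltonian G.
Hypotheses (m1_gt0 : 0 < m1) (m2_gt0 : 0 < m2) (m3_gt0 : 0 < m3).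

Let p_pr : prime p. Proof. by case: fr. Qed.
Let mdet := metahamiltonian_det fr eg ex ey ind mG.
(** [mdet] up to equality, so that each use only has to match its determinant with a short
    expression by [ring]. *)
Let mdetE e u1 u2 u3 v1 v2 v3 a b t1 t2 t3 s1 s2 s3 e1 e2 e3 f1 f2 f3 dv nz :
  e = _ -> (e != 0)%R :=
  fun E => eq_ind_r (fun e => is_true (e != 0)%R)
    (@mdet u1 u2 u3 v1 v2 v3 a b t1 t2 t3 s1 s2 s3 e1 e2 e3 f1 f2 f3 dv nz) E.
Let p0 : 0 < p := prime_gt0 p_pr.

Lemma pX_dvd_pair s j k i : ~~ ((p %| j) && (p %| k)) ->
  p ^ s %| j * i -> p ^ s %| k * i -> p ^ s %| i.
Proof.
rewrite negb_and => /orP[] nd; first move=> D _; last move=> _ D.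
  by rewrite -(@Gauss_dvdr _ j) // coprimeXl // prime_coprime.
by rewrite -(@Gauss_dvdr _ k) // coprimeXl // prime_coprime.
Qed.

Lemma modn_pX_cancel m a b i : (a%:R != b%:R :> 'F_p)%R ->
  a * i == b * i %[mod p ^ m] -> p ^ m %| i.
Proof.
wlog le_ba : a b / b <= a => [IH | ] nab.
  have [|/ltnW lt] := leqP b a; first by move=> ?; apply: IH.
  by rewrite eq_sym; apply: IH; rewrite // eq_sym.
rewrite eqn_mod_dvd ?leq_mul2r ?le_ba ?orbT // -mulnBl Gauss_dvdr //.
rewrite coprimeXl // prime_coprime // -Fp_nat_eq0 //.
by rewrite natrB // subr_eq0.
Qed.

Section TypeA.

Hypotheses (lt21 : m2 < m1) (lt31 : m3 < m1).

(** The pair is y and g^(j p^(m1 - m2)) x. Since m2 < m1, the factor of g changes neither the order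
    p^m2 modulo G' nor the commutator, but it adds j times the power of g to the power of x. *)
Lemma typeA_line2 (j : nat) :
  (n33 * (n22 + j%:R * n12) - n32 * (n23 + j%:R * n13) != 0)%R.
Proof.
have V0 : ((p ^ (m1 - m2) * j)%N%:R = 0 :> 'F_p)%R.
  by rewrite natrM Fp_pX_eq0 ?mul0r ?subn_gt0.
apply: (@mdetE _ 0 0 1 (p ^ (m1 - m2) * j) 1 0 (p ^ m3) (p ^ m2) 0 0 1 j 1 0);
  rewrite ?muln0 ?mul0n ?muln1 ?mul1n //.
- by rewrite mulnAC -expnD subnK // ltnW.
- by move=> i k; rewrite ?mul0n ?addn0 ?add0n ?mul1n => _ D2 D3; rewrite D2 D3.
- by rewrite V0 ?mulr1n ?mulr1 ?mulr0 ?mul0r ?mulr0 ?subr0 ?sub0r ?oppr_eq0 ?oner_eq0 ?orbT.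
by rewrite V0 /det3; ring.
Qed.

Lemma typeA_line3 (j : nat) :
  (n22 * (n33 + j%:R * n13) - n23 * (n32 + j%:R * n12) != 0)%R.
Proof.
have V0 : ((p ^ (m1 - m3) * j)%N%:R = 0 :> 'F_p)%R.
  by rewrite natrM Fp_pX_eq0 ?mul0r ?subn_gt0.
apply: (@mdetE _ 0 1 0 (p ^ (m1 - m3) * j) 0 1 (p ^ m2) (p ^ m3) 0 1 0 j 0 1);
  rewrite ?muln0 ?mul0n ?muln1 ?mul1n //.
- by rewrite mulnAC -expnD subnK // ltnW.
- by move=> i k; rewrite ?mul0n ?addn0 ?add0n ?mul1n => _ D2 D3; rewrite D2 D3.
- by rewrite V0 ?mulr1n ?mulr1 ?mulr0 ?mul0r ?mulr0 ?subr0 ?sub0r ?oppr_eq0 ?oner_eq0 ?orbT.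
by rewrite V0 /det3; ring.
Qed.

Lemma typeA_disc : (n22 * n33 - n23 * n32 != 0)%R.
Proof. by have := typeA_line3 0; rewrite !mul0r !addr0. Qed.

(** The determinants of [typeA_line2] and [typeA_line3] are affine in j without a zero on F_p, so
    their slopes vanish. The slopes are two linear forms in n12 and n13, independent by
    [typeA_disc]. *)
Lemma typeA_shape : [/\ n11 != 0, n12 = 0 & n13 = 0]%R.
Proof.
have e1 : (n33 * n12 - n32 * n13 = 0)%R.
  apply: (@Fp_line_eq0 _ (n33 * n22 - n32 * n23)%R) => // j.
  by apply: eq_ind (typeA_line2 j) => //; congr (_ != 0)%R; ring.
have e2 : (n22 * n13 - n23 * n12 = 0)%R.
  apply: (@Fp_line_eq0 _ (n22 * n33 - n23 * n32)%R) => // j.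
  by apply: eq_ind (typeA_line3 j) => //; congr (_ != 0)%R; ring.
have [n120 n130] : n12 = 0%R /\ n13 = 0%R.
  apply: (@lin2_eq0 _ n33 n32 n23 n22); first by rewrite mulrC [(n32 * _)%R]mulrC typeA_disc.
    by apply/eqP; rewrite -subr_eq0 e1.
  by apply/eqP; rewrite eq_sym -subr_eq0 e2.
split=> //; suff : (n11 * n22 != 0)%R by rewrite mulf_eq0 negb_or => /andP[].
apply: (@mdetE _ 1 0 0 0 1 0 (p ^ m1) (p ^ m2) 1 0 0 0 1 0);
  rewrite ?muln0 ?mul0n ?muln1 ?mul1n //.
- by move=> i k; rewrite ?mul0n ?addn0 ?add0n ?mul1n => D1 D2; rewrite D1 D2.
- by rewrite ?mulr1n ?mulr1 ?mulr0 ?mul0r ?mulr0 ?subr0 ?sub0r ?oppr_eq0 ?oner_eq0 ?orbT.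
by rewrite n120 n130 /det3; ring.
Qed.

(** If m1 > m2 + 1, then g^(p^(m1 - m2 - 1)) x has order p^(m2 + 1) modulo G', and its power of that
    exponent is the one of g, a multiple of [x, y]. Its commutator with y is also a multiple of
    [x, y], so the determinant is 0. *)
Lemma typeA_exp2 : m1 = m2.+1.
Proof.
apply/eqP; rewrite eqn_leq lt21 andbT leqNgt; apply/negP=> lt.
have V0 : ((p ^ (m1 - m2.+1))%N%:R = 0 :> 'F_p)%R by rewrite Fp_pX_eq0 ?subn_gt0.
have p1 : (p%:R = 0 :> 'F_p)%R by rewrite -[p]expn1 Fp_pX_eq0.
have [_ n120 n130] := typeA_shape.
suff : (0 != 0 :> 'F_p)%R by rewrite eqxx.
apply: (@mdetE _ 0 0 1 (p ^ (m1 - m2.+1)) 1 0 (p ^ m3) (p ^ m2.+1) 0 0 1 1 p 0);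
  rewrite ?muln0 ?mul0n ?muln1 ?mul1n //.
- by rewrite -expnD subnK // ltnW.
- by rewrite expnSr.
- move=> i k; rewrite ?mul0n ?addn0 ?add0n ?mul1n => D1 _ ->.
  by move: D1; rewrite -(subnK (ltnW lt)) expnD addnK dvdn_pmul2l ?expn_gt0 ?p0.
- by rewrite V0 ?mulr1n ?mulr1 ?mulr0 ?mul0r ?mulr0 ?subr0 ?sub0r ?oppr_eq0 ?oner_eq0 ?orbT.
by rewrite V0 p1 n120 n130 /det3; ring.
Qed.

Lemma typeA_exp3 : m1 = m3.+1.
Proof.
apply/eqP; rewrite eqn_leq lt31 andbT leqNgt; apply/negP=> lt.
have V0 : ((p ^ (m1 - m3.+1))%N%:R = 0 :> 'F_p)%R by rewrite Fp_pX_eq0 ?subn_gt0.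
have p1 : (p%:R = 0 :> 'F_p)%R by rewrite -[p]expn1 Fp_pX_eq0.
have [_ n120 n130] := typeA_shape.
suff : (0 != 0 :> 'F_p)%R by rewrite eqxx.
apply: (@mdetE _ 0 1 0 (p ^ (m1 - m3.+1)) 0 1 (p ^ m2) (p ^ m3.+1) 0 1 0 1 0 p);
  rewrite ?muln0 ?mul0n ?muln1 ?mul1n //.
- by rewrite -expnD subnK // ltnW.
- by rewrite expnSr.
- move=> i k; rewrite ?mul0n ?addn0 ?add0n ?mul1n => D1 -> _.
  by move: D1; rewrite -(subnK (ltnW lt)) expnD addnK dvdn_pmul2l ?expn_gt0 ?p0.
- by rewrite ?mulr1n ?mulr1 ?mulr0 ?mul0r ?mulr0 ?subr0 ?sub0r ?oppr_eq0 ?oner_eq0 ?orbT.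
by rewrite V0 p1 n120 n130 /det3; ring.
Qed.

(** Pairing x^j y^k with g exposes the form. The binomial correction to the power of x^j y^k lies
    along [x, y], as does the power of g, so it drops out of the determinant even when p^m2 = 2. *)
Lemma typeA_aniso (j k : nat) : ~~ ((p %| j) && (p %| k)) ->
  (n22 * j%:R ^+ 2 + (n23 + n32) * (j%:R * k%:R) + n33 * k%:R ^+ 2 != 0)%R.
Proof.
move=> jk; have e2 := typeA_exp2; have e3 := typeA_exp3.
have e23 : m3 = m2 by apply: succn_inj; rewrite -e2 -e3.
have [n110 n120 n130] := typeA_shape.
set Q := (X in (X != 0)%R); suff : (n11 * Q != 0)%R by rewrite mulf_eq0 negb_or => /andP[].
apply: (@mdetE _ 0 j k 1 0 0 (p ^ m2) (p ^ m1) 0 j k 1 0 0);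
  rewrite ?muln0 ?mul0n ?muln1 ?mul1n ?e23 // 1?mulnC //.
- move=> i l; rewrite ?mul0n ?addn0 ?add0n ?mul1n => -> D2 D3.
  by rewrite (pX_dvd_pair jk D2 D3).
- rewrite -!Fp_nat_eq0 // in jk; move: jk; rewrite negb_and => /orP[] nz.
    apply/or3P; apply: Or33; rewrite (_ : (_ - _ = - j%:R :> 'F_p)%R) ?oppr_eq0 //.
    by ring.
  apply/or3P; apply: Or32; rewrite (_ : (_ - _ = k%:R :> 'F_p)%R) //.
  by ring.
by rewrite n120 n130 /det3 /Q; ring.
Qed.

End TypeA.

Section TypeB.

Hypotheses (lt12 : m1 < m2) (lt13 : m1 < m3).

(** Now g has the smallest exponent, so it is g that may be twisted: by y^(j p^(m3 - m1)) here, by a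
    power of x in [typeB_line2]. *)
Lemma typeB_line3 (j : nat) :
  (n22 * (n11 + j%:R * n31) - n21 * (n12 + j%:R * n32) != 0)%R.
Proof.
have V0 : ((p ^ (m3 - m1) * j)%N%:R = 0 :> 'F_p)%R.
  by rewrite natrM Fp_pX_eq0 ?mul0r ?subn_gt0.
apply: (@mdetE _ 0 1 0 1 0 (p ^ (m3 - m1) * j) (p ^ m2) (p ^ m1) 0 1 0 1 0 j);
  rewrite ?muln0 ?mul0n ?muln1 ?mul1n //.
- by rewrite mulnAC -expnD subnK // ltnW.
- by move=> i k; rewrite ?mul0n ?addn0 ?add0n ?mul1n => D2 D3; rewrite D2 D3.
- by rewrite V0 ?mulr1n ?mulr1 ?mulr0 ?mul0r ?mulr0 ?subr0 ?sub0r ?oppr_eq0 ?oner_eq0 ?orbT.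
by rewrite V0 /det3; ring.
Qed.

Lemma typeB_line2 (j : nat) :
  (n33 * (n11 + j%:R * n21) - n31 * (n13 + j%:R * n23) != 0)%R.
Proof.
have V0 : ((p ^ (m2 - m1) * j)%N%:R = 0 :> 'F_p)%R.
  by rewrite natrM Fp_pX_eq0 ?mul0r ?subn_gt0.
apply: (@mdetE _ 0 0 1 1 (p ^ (m2 - m1) * j) 0 (p ^ m3) (p ^ m1) 0 0 1 1 j 0);
  rewrite ?muln0 ?mul0n ?muln1 ?mul1n //.
- by rewrite mulnAC -expnD subnK // ltnW.
- by move=> i k; rewrite ?mul0n ?addn0 ?add0n ?mul1n => D2 _ D3; rewrite D2 D3.
- by rewrite V0 ?mulr1n ?mulr1 ?mulr0 ?mul0r ?mulr0 ?subr0 ?sub0r ?oppr_eq0 ?oner_eq0 ?orbT.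
by rewrite V0 /det3; ring.
Qed.

Lemma typeB_disc : (n22 * n33 - n23 * n32 != 0)%R.
Proof.
apply: (@mdetE _ 0 1 0 0 0 1 (p ^ m2) (p ^ m3) 0 1 0 0 0 1);
  rewrite ?muln0 ?mul0n ?muln1 ?mul1n //.
- by move=> i k; rewrite ?mul0n ?addn0 ?add0n ?mul1n => _ D2 D3; rewrite D2 D3.
- by rewrite ?mulr1n ?mulr1 ?mulr0 ?mul0r ?mulr0 ?subr0 ?sub0r ?oppr_eq0 ?oner_eq0 ?orbT.
by rewrite /det3; ring.
Qed.

(** Again the slopes in j vanish; here they are linear in n21 and n31, the [x, y]-components of the
    powers of x and y. *)
Lemma typeB_shape : [/\ n11 != 0, n21 = 0 & n31 = 0]%R.
Proof.
have e1 : (n22 * n31 - n21 * n32 = 0)%R.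
  apply: (@Fp_line_eq0 _ (n22 * n11 - n21 * n12)%R) => // j.
  by apply: eq_ind (typeB_line3 j) => //; congr (_ != 0)%R; ring.
have e2 : (n33 * n21 - n31 * n23 = 0)%R.
  apply: (@Fp_line_eq0 _ (n33 * n11 - n31 * n13)%R) => // j.
  by apply: eq_ind (typeB_line2 j) => //; congr (_ != 0)%R; ring.
have [n310 n210] : n31 = 0%R /\ n21 = 0%R.
  apply: (@lin2_eq0 _ n22 n32 n23 n33); first by rewrite [(n32 * _)%R]mulrC typeB_disc.
    by apply/eqP; rewrite -subr_eq0 [(n32 * _)%R]mulrC e1.
  by apply/eqP; rewrite eq_sym -subr_eq0 [(n23 * _)%R]mulrC e2.
split=> //; have := typeB_line3 0.
by rewrite n210 !mul0r subr0 addr0 mulf_eq0 negb_or => /andP[].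
Qed.

(** If m3 > m1 + 1, then g y^(p^(m3 - m1 - 1)) has order p^(m1 + 1) modulo G', and its power is the
    one of y; together with x it gives three rows without [x, y]-component. *)
Lemma typeB_exp3 : m3 = m1.+1.
Proof.
apply/eqP; rewrite eqn_leq lt13 andbT leqNgt; apply/negP=> lt.
have V0 : ((p ^ (m3 - m1.+1))%N%:R = 0 :> 'F_p)%R by rewrite Fp_pX_eq0 ?subn_gt0.
have p1 : (p%:R = 0 :> 'F_p)%R by rewrite -[p]expn1 Fp_pX_eq0.
have [_ n210 n310] := typeB_shape.
suff : (0 != 0 :> 'F_p)%R by rewrite eqxx.
apply: (@mdetE _ 0 1 0 1 0 (p ^ (m3 - m1.+1)) (p ^ m2) (p ^ m1.+1) 0 1 0 p 0 1);
  rewrite ?muln0 ?mul0n ?muln1 ?mul1n //.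
- by rewrite expnSr.
- by rewrite -expnD subnK // ltnW.
- move=> i k; rewrite ?mul0n ?addn0 ?add0n ?mul1n => _ -> D1.
  by move: D1; rewrite -(subnK (ltnW lt)) expnD addnK dvdn_pmul2l ?expn_gt0 ?p0.
- by rewrite V0 ?mulr1n ?mulr1 ?mulr0 ?mul0r ?mulr0 ?subr0 ?sub0r ?oppr_eq0 ?oner_eq0 ?orbT.
by rewrite V0 p1 n210 n310 /det3; ring.
Qed.

Lemma typeB_exp2 : m2 = m1.+1.
Proof.
apply/eqP; rewrite eqn_leq lt12 andbT leqNgt; apply/negP=> lt.
have V0 : ((p ^ (m2 - m1.+1))%N%:R = 0 :> 'F_p)%R by rewrite Fp_pX_eq0 ?subn_gt0.
have p1 : (p%:R = 0 :> 'F_p)%R by rewrite -[p]expn1 Fp_pX_eq0.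
have [_ n210 n310] := typeB_shape.
suff : (0 != 0 :> 'F_p)%R by rewrite eqxx.
apply: (@mdetE _ 0 0 1 1 (p ^ (m2 - m1.+1)) 0 (p ^ m3) (p ^ m1.+1) 0 0 1 p 1 0);
  rewrite ?muln0 ?mul0n ?muln1 ?mul1n //.
- by rewrite expnSr.
- by rewrite -expnD subnK // ltnW.
- move=> i k; rewrite ?mul0n ?addn0 ?add0n ?mul1n => _ D1 ->.
  by move: D1; rewrite -(subnK (ltnW lt)) expnD addnK dvdn_pmul2l ?expn_gt0 ?p0.
- by rewrite V0 ?mulr1n ?mulr1 ?mulr0 ?mul0r ?mulr0 ?subr0 ?sub0r ?oppr_eq0 ?oner_eq0 ?orbT.
by rewrite V0 p1 n210 n310 /det3; ring.
Qed.

Lemma typeB_aniso (j k : nat) : ~~ ((p %| j) && (p %| k)) ->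
  (n22 * j%:R ^+ 2 + (n23 + n32) * (j%:R * k%:R) + n33 * k%:R ^+ 2 != 0)%R.
Proof.
move=> jk; have e2 := typeB_exp2; have e3 := typeB_exp3.
have e23 : m3 = m2 by rewrite e2 e3.
have [n110 n210 n310] := typeB_shape.
(* Here m2 = m1 + 1 is at least 2, so the correction vanishes for p = 2 as well. *)
have C0 : ('C(p ^ m2, 2)%:R = 0 :> 'F_p)%R.
  by apply/eqP; rewrite Fp_nat_eq0 // bin2_pX // e2 ltnS m1_gt0 orbT.
set Q := (X in (X != 0)%R); suff : (n11 * Q != 0)%R by rewrite mulf_eq0 negb_or => /andP[].
apply: (@mdetE _ 0 j k 1 0 0 (p ^ m2) (p ^ m1) 0 j k 1 0 0);
  rewrite ?muln0 ?mul0n ?muln1 ?mul1n ?e23 // 1?mulnC //.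
- move=> i l; rewrite ?mul0n ?addn0 ?add0n ?mul1n => -> D2 D3.
  by rewrite (pX_dvd_pair jk D2 D3).
- rewrite -!Fp_nat_eq0 // in jk; move: jk; rewrite negb_and => /orP[] nz.
    apply/or3P; apply: Or33; rewrite (_ : (_ - _ = - j%:R :> 'F_p)%R) ?oppr_eq0 //.
    by ring.
  apply/or3P; apply: Or32; rewrite (_ : (_ - _ = k%:R :> 'F_p)%R) //.
  by ring.
by rewrite C0 n210 n310 /det3 /Q; ring.
Qed.

End TypeB.

(** With equal exponents any two vectors independent modulo p qualify, so the condition becomes
    polynomial in u and v over F_p. The scalar c carries the quadratic correction, non-zero only
    when p^m = 2. *)
Lemma typeC_det (m : nat) (c : 'F_p) : c = ('C(p ^ m, 2)%:R)%R -> m1 = m -> m2 = m -> m3 = m ->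
  forall u1 u2 u3 v1 v2 v3 : 'F_p,
  [|| u2 * v3 - u3 * v2 != 0, u3 * v1 - u1 * v3 != 0 | u1 * v2 - u2 * v1 != 0]%R ->
  (det3
    (u1 * n11 + u2 * n21 + u3 * n31 - c * (u2 * u3))
    (u1 * n12 + u2 * n22 + u3 * n32 + c * (u1 * u3))
    (u1 * n13 + u2 * n23 + u3 * n33 - c * (u1 * u2))
    (v1 * n11 + v2 * n21 + v3 * n31 - c * (v2 * v3))
    (v1 * n12 + v2 * n22 + v3 * n32 + c * (v1 * v3))
    (v1 * n13 + v2 * n23 + v3 * n33 - c * (v1 * v2))
    (u2 * v3 - u3 * v2) (u3 * v1 - u1 * v3) (u1 * v2 - u2 * v1) != 0)%R.
Proof.
move=> ec em1 em2 em3 u1 u2 u3 v1 v2 v3 nz.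
apply: (@mdetE _ u1 u2 u3 v1 v2 v3 (p ^ m) (p ^ m) u1 u2 u3 v1 v2 v3);
  rewrite ?em1 ?em2 ?em3 1?mulnC //; last first.
- by rewrite !Fp_natK -ec /det3; ring.
- by rewrite !Fp_natK.
move=> i j D1 D2 D3.
(* Cramer's rule modulo p^m: each unknown times a minor prime to p is 0. The equations are
   rearranged to avoid subtraction of natural numbers. *)
have key (a b a' b' : nat) : (a%:R * b'%:R - b%:R * a'%:R != 0 :> 'F_p)%R ->
    p ^ m %| a * i + a' * j -> p ^ m %| b * i + b' * j -> (p ^ m %| i) && (p ^ m %| j).
  move=> nd E1 E2.
  have nd' : (a%:R * b'%:R != b%:R * a'%:R :> 'F_p)%R by rewrite -subr_eq0.
  apply/andP; split.
    apply: (@modn_pX_cancel _ (a * b')%N (b * a')%N); rewrite ?natrM //.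
    rewrite -(eqn_modDr (a' * b' * j)%N).
    have -> : (a * b' * i + a' * b' * j = b' * (a * i + a' * j))%N by ring.
    have -> : (b * a' * i + a' * b' * j = a' * (b * i + b' * j))%N by ring.
    by rewrite (eqP (dvdn_mull _ E1)) (eqP (dvdn_mull _ E2)).
  apply: (@modn_pX_cancel _ (a * b')%N (b * a')%N); rewrite ?natrM //.
  rewrite -(eqn_modDr (a * b * i)%N).
  have -> : (a * b' * j + a * b * i = a * (b * i + b' * j))%N by ring.
  have -> : (b * a' * j + a * b * i = b * (a * i + a' * j))%N by ring.
  by rewrite (eqP (dvdn_mull _ E1)) (eqP (dvdn_mull _ E2)).
case/or3P: nz => nz.
- by apply: (key u2 u3 v2 v3); rewrite ?Fp_natK.
- by apply: (key u3 u1 v3 v1); rewrite ?Fp_natK.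
- by apply: (key u1 u2 v1 v2); rewrite ?Fp_natK.
Qed.

End Data.

(** * Quadratic forms over F_p and the normal form of the binary block *)

Local Open Scope ring_scope.

Section Squares.

Variable p : nat.
Hypotheses (p_pr : prime p) (p_odd : odd p).

(** The arguments 0, ..., (p - 1) / 2 take one element of each pair {a, -a}, which gives (p + 1) / 2
    distinct squares. *)
Let half_sqr (i : 'I_(p./2).+1) : 'F_p := (i : nat)%:R ^+ 2.

Lemma Fp_two_neq0 : (2%:R : 'F_p) != 0.
Proof.
rewrite Fp_nat_eq0 // dvdn_prime2 //; apply: contraL p_odd => /eqP->; done.
Qed.

Lemma half_sqr_inj : injective half_sqr.
Proof.
move=> i j /eqP; rewrite eqf_sqr; have [li lj] := (ltn_ord i, ltn_ord j).
have := odd_double_half p; rewrite p_odd -addnn => ep.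
case/orP; last first.
  rewrite -addr_eq0 -natrD Fp_nat_eq0 // => /dvdnP[q eq].
  apply: val_inj => /=; case: q eq => [|q]; rewrite ?mulSn; lia.
rewrite -[_ == _]subr_eq0 => e0; apply: val_inj => /=.
wlog le_ji : i j li lj e0 / (j <= i)%N => [IH | ].
  have [le | /ltnW le] := leqP j i; first exact: IH.
  by symmetry; apply: IH => //; rewrite -opprB oppr_eq0.
move: e0; rewrite -natrB // Fp_nat_eq0 // => /dvdnP[[|q] eq]; move: eq; rewrite ?mulSn; lia.
Qed.

(** Pigeonhole: the squares and the values d - a t^2 form two sets of (p + 1) / 2 elements of F_p,
    so they meet. *)
Lemma sqr_add_sqr_repr (a d : 'F_p) : a != 0 -> exists s t, s ^+ 2 + a * t ^+ 2 = d.
Proof.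
move=> a0; pose f i := d - a * half_sqr i.
have injf : injective f.
  by move=> i j /addrI/oppr_inj/(mulfI a0)/half_sqr_inj.
have [/existsP[i /existsP[j /eqP e]] | none] := boolP [exists i, exists j, half_sqr i == f j].
  exists (i : nat)%:R, (j : nat)%:R.
  by rewrite -/(half_sqr i) -/(half_sqr j) e /f subrK.
have dis : [disjoint half_sqr @: setT & f @: setT].
  apply/pred0P=> z /=; apply/andP=> -[/imsetP[i _ ei] /imsetP[j _ ej]].
  by case/existsP: none; exists i; apply/existsP; exists j; rewrite -ei -ej.
have := max_card (mem (half_sqr @: setT :|: f @: setT)).
rewrite cardsU (eqP (_ : half_sqr @: setT :&: f @: setT == set0)) ?setI_eq0 //.
rewrite cards0 subn0 !card_imset //; last exact: half_sqr_inj.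
rewrite cardsT card_ord card_Fp //.
by have := odd_double_half p; rewrite p_odd -addnn; lia.
Qed.

(** The squares and the products b t^2 have (p + 1) / 2 elements each and share only 0, so together
    they fill F_p; a non-square must be of the second kind. *)
Lemma nonsquare_ratio (a b : 'F_p) : ~~ is_square a -> ~~ is_square b ->
  exists2 l, l != 0 & a = l ^+ 2 * b.
Proof.
move=> na nb; have b0 : b != 0.
  by apply: contraNneq nb => ->; apply/existsP; exists 0; rewrite expr0n.
have a0 : a != 0.
  by apply: contraNneq na => ->; apply/existsP; exists 0; rewrite expr0n.
pose f i := b * half_sqr i.
have injf : injective f by move=> i j /(mulfI b0)/half_sqr_inj.
have sub0 : half_sqr @: setT :&: f @: setT \subset [set 0].
  apply/subsetP=> z; rewrite !inE => /andP[/imsetP[i _ ei] /imsetP[j _ ej]].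
  apply: contraR nb => z0; apply/existsP; exists ((i : nat)%:R / (j : nat)%:R).
  have j0 : (j : nat)%:R != 0 :> 'F_p.
    by apply: contraNneq z0 => j0; rewrite ej /f /half_sqr j0 expr0n mulr0.
  by rewrite expr_div_n -[X in X / _]/(half_sqr i) -ei ej /f /half_sqr mulfK // expf_neq0.
have : a \in half_sqr @: setT :|: f @: setT.
  suff -> : half_sqr @: setT :|: f @: setT = setT by rewrite inE.
  apply/eqP; rewrite eqEcard subsetT /= cardsT card_Fp //.
  have := cardsUI (half_sqr @: setT) (f @: setT).
  rewrite !card_imset //; last exact: half_sqr_inj.
  rewrite cardsT card_ord; have := subset_leq_card sub0; rewrite cards1.
  move: #|_ :&: _| #|_ :|: _| => ci cu; by have := odd_double_half p; rewrite p_odd -addnn; lia.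
rewrite inE => /orP[/imsetP[i _ ea] | /imsetP[i _ ea]].
  by case/negP: na; apply/existsP; exists (i : nat)%:R; rewrite ea.
exists (i : nat)%:R; last by rewrite ea /f mulrC.
by apply: contraNneq a0 => i0; rewrite ea /f /half_sqr i0 expr0n mulr0.
Qed.

End Squares.

Lemma F2P p (a : 'F_p) : p = 2 -> a = 0 \/ a = 1.
Proof.
move=> p2; subst p; case: a => [[|[|a]] la]; [left | right | by []]; exact: val_inj.
Qed.

Lemma F2_eq1 p (a : 'F_p) : p = 2 -> a != 0 -> a = 1.
Proof. by move=> p2; case: (F2P a p2) => ->; rewrite ?eqxx. Qed.

Lemma complete_square1 (F : fieldType) (A B C s t : F) : 2%:R != 0 :> F -> A != 0 ->
  4%:R * A * (t ^+ 2 + A * ((s - B) / (2%:R * A)) ^+ 2 +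
              B * ((s - B) / (2%:R * A) * 1) + C * 1 ^+ 2) =
  s ^+ 2 + 4%:R * A * t ^+ 2 - (B ^+ 2 - 4%:R * A * C).
Proof. by move=> t0 A0; field; rewrite A0. Qed.

Lemma complete_square2 (F : fieldType) (a b c d e f t y z : F) :
  2%:R != 0 :> F -> a != 0 ->
  let x := (t - b * y - d * z) / (2%:R * a) in
  4%:R * a * (a * x ^+ 2 + b * (x * y) + c * y ^+ 2 + d * (x * z)
              + e * (y * z) + f * z ^+ 2) =
  t ^+ 2 + (4%:R * a * c - b ^+ 2) * y ^+ 2
  + (4%:R * a * e - 2%:R * b * d) * (y * z) + (4%:R * a * f - d ^+ 2) * z ^+ 2.
Proof. by move=> t0 a0 x; rewrite /x; field; rewrite a0. Qed.

(** Chevalley's theorem for a conic. For odd p, completing the square twice turns a zero with z = 1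
    into a representation by s^2 + 4 A t^2; for p = 2 the zeros are explicit. *)
Lemma ternary_isotropic p (a b c d e f : 'F_p) : prime p ->
  exists x y z, [|| x != 0, y != 0 | z != 0] /\
    a * x ^+ 2 + b * (x * y) + c * y ^+ 2 + d * (x * z) + e * (y * z) + f * z ^+ 2 = 0.
Proof.
move=> p_pr; have nz1 : (1 : 'F_p) != 0 by exact: oner_neq0.
have [-> | a0] := eqVneq a 0; first by exists 1, 0, 0; rewrite nz1; split=> //; ring.
have [p_odd | ] := boolP (odd p); last first.
  move=> /(prime_oddPn p_pr) p2.
  have [-> | c0] := eqVneq c 0; first by exists 0, 1, 0; rewrite nz1 orbT; split=> //; ring.
  have [-> | f0] := eqVneq f 0; first by exists 0, 0, 1; rewrite nz1 !orbT; split=> //; ring.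
  have t0 : 1 + 1 = 0 :> 'F_p.
    by apply/eqP; rewrite -[1 + 1]/(2%:R) Fp_nat_eq0 // p2.
  (* Over F_2 all square coefficients are now 1: two coordinates suffice if a mixed term is absent,
     otherwise (1, 1, 1) gives a sum of six ones. *)
  rewrite (F2_eq1 p2 a0) (F2_eq1 p2 c0) (F2_eq1 p2 f0).
  have [-> | b0] := eqVneq b 0.
    by exists 1, 1, 0; rewrite nz1; split=> //; rewrite -[RHS]t0; ring.
  have [-> | d0] := eqVneq d 0.
    by exists 1, 0, 1; rewrite nz1; split=> //; rewrite -[RHS]t0; ring.
  have [-> | e0] := eqVneq e 0.
    by exists 0, 1, 1; rewrite nz1 orbT; split=> //; rewrite -[RHS]t0; ring.
  rewrite (F2_eq1 p2 b0) (F2_eq1 p2 d0) (F2_eq1 p2 e0).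
  exists 1, 1, 1; rewrite nz1; split=> //.
  by transitivity ((1 + 1) * (1 + 1 + 1) : 'F_p); [ring | rewrite t0 mul0r].
have t0 := Fp_two_neq0 p_pr p_odd.
pose A := 4%:R * a * c - b ^+ 2; pose B := 4%:R * a * e - 2%:R * b * d.
pose C := 4%:R * a * f - d ^+ 2.
have [t [y [z [nz e0]]]] : exists t y z, [|| t != 0, y != 0 | z != 0] /\
    t ^+ 2 + A * y ^+ 2 + B * (y * z) + C * z ^+ 2 = 0.
  have [-> | A0] := eqVneq A 0; first by exists 0, 1, 0; rewrite nz1 orbT; split=> //; ring.
  have f4 : 4%:R * A != 0 by rewrite (natrM _ 2 2) !mulf_neq0.
  have [s [t e1]] := sqr_add_sqr_repr p_pr p_odd (B ^+ 2 - 4%:R * A * C) f4.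
  exists t, ((s - B) / (2%:R * A)), 1; rewrite nz1 !orbT; split=> //.
  apply: (mulfI f4); rewrite mulr0.
  by rewrite complete_square1 // e1 subrr.
exists ((t - b * y - d * z) / (2%:R * a)), y, z; split.
  have [y0 | y0] := eqVneq y 0; last by rewrite orbT.
  have [z0 | z0] := eqVneq z 0; last by rewrite !orbT.
  move: nz; rewrite y0 z0 eqxx !orbF !mulr0 !subr0 => nzt.
  by rewrite mulf_neq0 // invr_eq0 mulf_neq0.
have f4 : 4%:R * a != 0 by rewrite (natrM _ 2 2) !mulf_neq0.
by apply: (mulfI f4); rewrite mulr0 -[RHS]e0 complete_square2.
Qed.

(** Completing the square writes 4 a times the form as s^2 + (4 a c - b^2) y^2, and
    [sqr_add_sqr_repr] reaches 4 a n. Over F_2 the only non-zero value is 1. *)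
Lemma binary_repr p (a b c n : 'F_p) : prime p -> n != 0 ->
    (forall x y, (x != 0) || (y != 0) ->
       a * x ^+ 2 + b * (x * y) + c * y ^+ 2 != 0) ->
  exists x y, a * x ^+ 2 + b * (x * y) + c * y ^+ 2 = n.
Proof.
move=> p_pr n0 an; have nz1 : (1 : 'F_p) != 0 by exact: oner_neq0.
have a0 : a != 0.
  by have := an 1 0; rewrite nz1 expr1n mulr1 mulr0 expr0n !mulr0 !addr0 => ->.
have [p_odd | ] := boolP (odd p); last first.
  move=> /(prime_oddPn p_pr) p2; exists 1, 0.
  by rewrite (F2_eq1 p2 n0) (F2_eq1 p2 a0); ring.
have t0 := Fp_two_neq0 p_pr p_odd.
have D0 : 4%:R * a * c - b ^+ 2 != 0.
  (* At (-b, 2 a) the form takes the value a (4 a c - b^2). *)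
  have := an (- b) (2%:R * a); rewrite [2%:R * a == 0]mulf_eq0 (negPf t0) (negPf a0) orbT.
  move=> /(_ isT); apply: contraNneq => D0; apply/eqP.
  transitivity (a * (4%:R * a * c - b ^+ 2)); last by rewrite D0 mulr0.
  by rewrite (natrM _ 2 2); ring.
have [s [y e]] := sqr_add_sqr_repr p_pr p_odd (4%:R * a * n) D0.
exists ((s - b * y) / (2%:R * a)), y.
have f4 : 4%:R * a != 0 by rewrite (natrM _ 2 2) !mulf_neq0.
apply: (mulfI f4); rewrite -[RHS]e.
have := complete_square2 b c 0 0 0 s y 0 t0 a0; rewrite /= expr0n /= !mulr0 !addr0 subr0 => ->; ring.
Qed.

(* The sign [e] is -1 for the families (1)-(3) and 1 for (4)-(6). *)
Definition good_coefs p (eta e al ga de : 'F_p) : Prop :=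
  [\/ [/\ odd p, al = 0, ga = eta & de = 0],
      [/\ odd p, al = 0, ~~ is_square (1 + 4%:R * ga) & de = e] |
      [/\ p = 2, al = 1, ga = 1 & de = 0]].

Section NormalForm.

Variables (F : fieldType) (a b c d : F).
Let D := a * d - b * c.
Hypothesis D0 : D != 0.

(** Let N = [[a, b], [c, d]] and let T send a row w = (j, k) to (-k, j) N^-1; T has trace t and
    determinant 1 / D. The second and third identities force w' = l T w - al w, and the last two are
    then Cayley-Hamilton for l T. *)
Lemma normal_form_identities (l al j k : F) :
  let j' := l * (- k * d - j * c) / D - al * j in
  let k' := l * (k * b + j * a) / D - al * k in
  let t := (b - c) / D in
  let de := l * t - al in
  let ga := al * de - l ^+ 2 / D in
  [/\ j * k' - k * j' = l * ((a * j ^+ 2 + (b + c) * (j * k) + d * k ^+ 2) / D),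
      al * (j * a + k * c) + (j' * a + k' * c) = - (l * k),
      al * (j * b + k * d) + (j' * b + k' * d) = l * j,
      ga * (j * a + k * c) + de * (j' * a + k' * c) = - (l * k') &
      ga * (j * b + k * d) + de * (j' * b + k' * d) = l * j'].
Proof. by move=> /=; have := D0; rewrite /D => ?; split; field. Qed.

(** The discriminant of the form is D^2 times that of the characteristic polynomial of T. *)
Lemma normal_form_disc :
  (b + c) ^+ 2 - 4%:R * a * d = ((b - c) / D) ^+ 2 * D ^+ 2 - 4%:R * D.
Proof. by have := D0; rewrite /D => ?; field. Qed.

End NormalForm.

Lemma anisotropic_disc p (a b c : 'F_p) : prime p -> odd p ->
    (forall x y, (x != 0) || (y != 0) ->
       a * x ^+ 2 + b * (x * y) + c * y ^+ 2 != 0) ->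
  ~~ is_square (b ^+ 2 - 4%:R * a * c).
Proof.
move=> p_pr p_odd an; apply/negP=> /existsP[s /eqP es].
have t0 := Fp_two_neq0 p_pr p_odd.
have a0 : a != 0.
  by have := an 1 0; rewrite oner_neq0 expr1n mulr1 mulr0 expr0n !mulr0 !addr0 => ->.
have := an (s - b) (2%:R * a); rewrite [2%:R * a == 0]mulf_eq0 (negPf t0) (negPf a0) orbT.
move=> /(_ isT)/eqP[]; transitivity (a * (s ^+ 2 - (b ^+ 2 - 4%:R * a * c))).
  by ring.
by rewrite es subrr mulr0.
Qed.

Lemma normal_form p (eta e n a b c d : 'F_p) : prime p ->
    (odd p -> ~~ is_square eta) -> e ^+ 2 = 1 -> n != 0 ->
    (forall x y, (x != 0) || (y != 0) ->
       a * x ^+ 2 + (b + c) * (x * y) + d * y ^+ 2 != 0) ->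
    a * d - b * c != 0 ->
  exists l j k j' k' al ga de : 'F_p,
   [/\ l != 0, good_coefs eta e al ga de, j * k' - k * j' = l * n &
    [/\
      al * (j * a + k * c) + (j' * a + k' * c) = - (l * k),
      al * (j * b + k * d) + (j' * b + k' * d) = l * j,
      ga * (j * a + k * c) + de * (j' * a + k' * c) = - (l * k') &
      ga * (j * b + k * d) + de * (j' * b + k' * d) = l * j']].
Proof.
move=> p_pr eta_ns e2 n0 an D0; set D := a * d - b * c in D0.
(* The value n D makes det (w, w') equal to l n, as the relation for the commutator of the new x and
   y demands. *)
have [j [k ejk]] := binary_repr p_pr (mulf_neq0 n0 D0) an.
suff [l [al [l0 good]]] : exists l al, l != 0 /\
    good_coefs eta e al (al * (l * ((b - c) / D) - al) - l ^+ 2 / D) (l * ((b - c) / D) - al).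
  have [e1 e3 e4 e5 e6] := normal_form_identities D0 l al j k.
  do 8 eexists; split; [exact: l0 | exact: good | | split; [exact: e3 | exact: e4 | exact: e5 | exact: e6]].
  by rewrite e1 ejk mulfK.
have [p_odd | ] := boolP (odd p); last first.
  (* Over F_2 anisotropy leaves only u^2 + u v + v^2, so D and the trace are 1; al = 1 then gives
     the coefficients of (3) and (6). *)
  move=> /(prime_oddPn p_pr) p2; exists 1, 1; rewrite oner_neq0; split=> //.
  have t0 : 1 + 1 = 0 :> 'F_p.
    by apply/eqP; rewrite -[1 + 1]/(2%:R) Fp_nat_eq0 // p2.
  have N1 : -1 = 1 :> 'F_p by apply/eqP; rewrite eq_sym -addr_eq0 t0.
  have a1 : a = 1.
    apply: (F2_eq1 p2); have := an 1 0; rewrite oner_neq0.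
    by rewrite expr1n mulr1 mulr0 expr0n !mulr0 !addr0 => ->.
  have d1 : d = 1.
    apply: (F2_eq1 p2); have := an 0 1; rewrite oner_neq0 orbT.
    by rewrite !expr1n !mulr1 expr0n !mulr0 !add0r => ->.
  have := an 1 1; rewrite oner_neq0 a1 d1 !expr1n !mulr1 => /(_ isT) bc.
  apply: Or33; have eD : D = 1.
    move: D0; rewrite /D a1 d1; case: (F2P b p2) => -> ; first by rewrite mul0r mulr1 subr0.
    case: (F2P c p2) => ->; first by rewrite mulr0 mulr1 subr0.
    by rewrite !mulr1 subrr eqxx.
  have t1 : b - c = 1.
    apply: (F2_eq1 p2); apply: contraNneq bc => /eqP; rewrite subr_eq0 => /eqP->.
    case: (F2P c p2) => ->; first by rewrite !addr0 t0.
    by rewrite t0 addr0 t0.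
  by rewrite t1 eD !divr1 mulr1 subrr mulr0 sub0r N1.
have t0 := Fp_two_neq0 p_pr p_odd.
have := anisotropic_disc p_pr p_odd an; rewrite (normal_form_disc D0) -/D => ns.
(* For trace 0 the discriminant is -4 D, so -1 / D is a non-square and a factor l^2 turns it into
   eta. *)
have [t_0 | t_neq0] := eqVneq ((b - c) / D) 0.
  have [|l l0 el] := @nonsquare_ratio _ p_pr p_odd eta (- D^-1) (eta_ns p_odd).
    apply: contra ns => /existsP[s /eqP es]; rewrite t_0 expr0n mul0r sub0r.
    apply/existsP; exists (2%:R * s * D); rewrite !exprMn -es -mulNr.
    apply/eqP; transitivity (- 4%:R * (D * (D / D))); last by ring.
    by rewrite divff // mulr1.
  exists l, 0; split=> //; apply: Or31; split=> //; last by rewrite t_0 mulr0 subr0.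
  by rewrite mul0r sub0r el mulrN.
(* This l makes the trace e, and 1 + 4 ga becomes the discriminant of the form divided by (t
   D)^2. *)
exists (e / ((b - c) / D)), 0.
have e0 : e != 0.
  by apply: contraTneq (oner_neq0 'F_p) => e0; rewrite -e2 e0 expr0n eqxx.
split; first by rewrite mulf_neq0 ?invr_eq0.
apply: Or32; split=> //; last by rewrite divfK // subr0.
apply: contra ns; move: ((b - c) / D) t_neq0 => t tn /existsP[s /eqP es].
apply/existsP; exists (s * t * D); apply/eqP.
rewrite !exprMn -es mul0r sub0r exprMn exprVn e2; move: (D) D0 => D' D0.
by field; rewrite D0.
Qed.

Local Close Scope ring_scope.

(* Common form of the relations of (1)-(6): [(g, x, y)] is [(a1, a2, a3)] in
   (1)-(3), where [r = s.+1], and [(a3^-1, a2, a1)] in (4)-(6), where [s = r.+1]. *)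
Definition rel3 p r s (al ga de : nat) (gT : finGroupType) (g x y : gT) : Prop :=
  [/\ g ^+ (p ^ r.+1) = 1, x ^+ (p ^ s.+1) = 1, y ^+ (p ^ s.+1) = 1,
      {in [set g; x; y] & &, forall u v w, [~ u, v, w] = 1} &
    [/\ [~ x, y] = g ^+ (p ^ r),
        [~ g, x] = x ^+ (al * p ^ s) * y ^+ (p ^ s) &
        [~ g, y] = x ^+ (ga * p ^ s) * y ^+ (de * p ^ s)]].

(** Invertibility of the exponent matrix modulo p gives generation modulo Phi(G), and Phi(G)
    consists of non-generators. *)
Lemma E3_gen p (gT : finGroupType) (G : {group gT}) (g x y : gT)
    (u1 u2 u3 v1 v2 v3 w1 w2 w3 : nat) :
    frame p G g x y -> p.-group G ->
    (det3 u1%:R u2%:R u3%:R v1%:R v2%:R v3%:R w1%:R w2%:R w3%:R != 0 :> 'F_p)%R ->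
  <<[set E3 g x y u1 u2 u3; E3 g x y v1 v2 v3; E3 g x y w1 w2 w3]>> = G.
Proof.
move=> fr pG d0; have [p_pr defG cl2 abG' oG'] := fr.
pose X := [set E3 g x y u1 u2 u3; E3 g x y v1 v2 v3; E3 g x y w1 w2 w3].
have [Gg Gx Gy] := And3 (gen3_memg defG) (gen3_memx defG) (gen3_memy defG).
have sXG : X \subset G.
  by apply/subsetP=> z; rewrite !inE -orbA => /or3P[]/eqP->; apply: (E3_in defG).
pose K := ('Phi(G) <*> <<X>>)%G.
have sPK : 'Phi(G) \subset K by apply: joing_subl.
have sXK : X \subset K by apply: subset_trans (subset_gen X) (joing_subr _ _).
have sDK : G^`(1) \subset K.
  by apply: subset_trans sPK; rewrite (Phi_joing pG) joing_subl.
have pK h n : h \in G -> p %| n -> h ^+ n \in K.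
  move=> Gh /dvdnP[m ->]; apply: (subsetP sPK); rewrite (Phi_joing pG) mulnC expgM groupX //.
  by apply: (subsetP (joing_subr _ _)); apply: Mho_p_elt (mem_p_elt pG Gh) => //; rewrite expn1.
have key (a b c : 'F_p) : exists i j k : nat, [/\ E3 g x y i j k \in K,
    (i%:R = a)%R, (j%:R = b)%R & (k%:R = c)%R].
  have [r [s [t [ea eb ec]]]] := cramer3 a b c d0.
  have K1 : E3 g x y u1 u2 u3 \in K by apply: (subsetP sXK); rewrite !inE eqxx.
  have K2 : E3 g x y v1 v2 v3 \in K by apply: (subsetP sXK); rewrite !inE eqxx orbT.
  have K3 : E3 g x y w1 w2 w3 \in K by apply: (subsetP sXK); rewrite !inE eqxx !orbT.
  have scale i j k n : E3 g x y i j k \in K -> E3 g x y (i * n) (j * n) (k * n) \in K.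
    move=> Ki; have := groupX n Ki; rewrite (E3_expX fr) groupMr //.
    by apply: (subsetP sDK); apply: (W_in fr).
  have add i j k i' j' k' : E3 g x y i j k \in K -> E3 g x y i' j' k' \in K ->
      E3 g x y (i + i') (j + j') (k + k') \in K.
    move=> Ki Ki'; have := groupM Ki Ki'.
    have [w Dw ->] := E3_mul i j k i' j' k' defG.
    by rewrite groupMr // (subsetP sDK).
  exists (u1 * r + v1 * s + w1 * t)%N, (u2 * r + v2 * s + w2 * t)%N,
    (u3 * r + v3 * s + w3 * t)%N; split; first by rewrite !add ?scale.
  - by rewrite ea !natrD !natrM !Fp_natK; ring.
  - by rewrite eb !natrD !natrM !Fp_natK; ring.
  - by rewrite ec !natrD !natrM !Fp_natK; ring.
have nat1 h n : h \in G -> (n%:R = 1 :> 'F_p)%R -> h ^+ n \in K -> h \in K.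
  move=> Gh n1 Kn; have n0 : 0 < n.
    by case: n n1 {Kn} => // /esym/eqP; rewrite oner_eq0.
  have pn : p %| n.-1.
    by rewrite -(Fp_nat_eq0 p_pr) -subn1 natrB // n1 subrr.
  by move: Kn; rewrite -(prednK n0) expgS groupMr // pK.
have [Kg Kx Ky] : [/\ g \in K, x \in K & y \in K].
  split.
  - have [i [j [k [Kz i1 /eqP j0 /eqP k0]]]] := key 1%R 0%R 0%R.
    rewrite !Fp_nat_eq0 // in j0 k0; apply: (nat1 _ i) => //.
    by move: Kz; rewrite E3E (groupMr _ (pK y k Gy k0)) (groupMr _ (pK x j Gx j0)).
  - have [i [j [k [Kz /eqP i0 j1 /eqP k0]]]] := key 0%R 1%R 0%R.
    rewrite !Fp_nat_eq0 // in i0 k0; apply: (nat1 _ j) => //.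
    by move: Kz; rewrite E3E (groupMr _ (pK y k Gy k0)) (groupMl _ (pK g i Gg i0)).
  - have [i [j [k [Kz /eqP i0 /eqP j0 k1]]]] := key 0%R 0%R 1%R.
    rewrite !Fp_nat_eq0 // in i0 j0; apply: (nat1 _ k) => //.
    by move: Kz; rewrite E3E (groupMl _ (groupM (pK g i Gg i0) (pK x j Gx j0))).
rewrite -/X; apply: Phi_nongen; apply/eqP.
rewrite -joing_idr eqEsubset join_subG Phi_sub gen_subG sXG /=.
suff: <<[set g; x; y]>> \subset K by rewrite defG.
by rewrite gen_subG; apply/subsetP=> z;
  rewrite !inE -orbA => /or3P[]/eqP->.
Qed.

Lemma cramer2 (F : fieldType) (a b c d u v : F) : (a * d - b * c != 0)%R ->
  exists i j, (u + i * a + j * c = 0 /\ v + i * b + j * d = 0)%R.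
Proof.
move=> D0; exists ((v * c - u * d) / (a * d - b * c))%R, ((u * b - v * a) / (a * d - b * c))%R.
by split; field.
Qed.

Section ChangeBasis.

Variables (p s : nat) (gT : finGroupType) (G : {group gT}) (g x y : gT).
Variables (n11 n12 n13 n21 n22 n23 n31 n32 n33 : 'F_p).
Variables (l j k j' k' al ga de : 'F_p).

Hypotheses (fr : frame p G g x y) (pG : p.-group G).
Hypotheses (l0 : l != 0%R) (n0 : n11 != 0%R).
Hypothesis edet : (j * k' - k * j' = l * n11)%R.
Hypothesis e1 : (al * (j * n22 + k * n32) + (j' * n22 + k' * n32) = - (l * k))%R.
Hypothesis e2 : (al * (j * n23 + k * n33) + (j' * n23 + k' * n33) = l * j)%R.
Hypothesis e3 : (ga * (j * n22 + k * n32) + de * (j' * n22 + k' * n32) = - (l * k'))%R.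
Hypothesis e4 : (ga * (j * n23 + k * n33) + de * (j' * n23 + k' * n33) = l * j')%R.

Let p_pr : prime p. Proof. by case: fr. Qed.
Let defG : <<[set g; x; y]>> = G. Proof. by case: fr. Qed.
Let cl2 : G^`(1) \subset 'Z(G). Proof. by case: fr. Qed.

Lemma class2_gens (a b c : gT) : <<[set a; b; c]>> = G ->
  {in [set a; b; c] & &, forall u v w, [~ u, v, w] = 1}.
Proof.
move=> defG'; have sG : [set a; b; c] \subset G by rewrite -defG' subset_gen.
move=> u v w /(subsetP sG) Gu /(subsetP sG) Gv /(subsetP sG) Gw.
by apply/eqP/commgP; apply: (class2_comm cl2).
Qed.

Lemma W_exp_p (a b c : 'F_p) : (W g x y a b c) ^+ p = 1 :> gT.
Proof. by apply: (der1_exp fr); apply: (W_in fr). Qed.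

Let natp0 : (p%:R = 0 :> 'F_p)%R.
Proof. by apply/eqP; rewrite Fp_nat_eq0. Qed.

(** The factors g^(p i) and g^(p i') do not affect commutators. Their p^s-th powers are multiples of
    g^(p^(s+1)) and cancel the [x, y]-components of the powers of x' and y', binomial correction
    included. *)
Lemma typeA_rel3 :
    g ^+ (p ^ s.+1) = W g x y n11 0 0 ->
    x ^+ (p ^ s) = W g x y n21 n22 n23 ->
    y ^+ (p ^ s) = W g x y n31 n32 n33 ->
  exists g' x' y', <<[set g'; x'; y']>> = G /\ rel3 p s.+1 s al ga de g' x' y'.
Proof.
move=> eg ex ey.
pose C : 'F_p := ('C(p ^ s, 2)%:R)%R.
pose i : 'F_p := (- (j * n21 + k * n31 - C * (j * k)) / n11)%R.
pose i' : 'F_p := (- (j' * n21 + k' * n31 - C * (j' * k')) / n11)%R.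
pose g' := E3 g x y l 0 0; pose x' := E3 g x y (p * i) j k.
pose y' := E3 g x y (p * i') j' k'; exists g', x', y'.
have pg : g' ^+ (p ^ s.+1) = W g x y (l * n11) 0 0.
  rewrite (E3_pow (t1 := l) (t2 := 0) (t3 := 0) fr eg ex ey) ?muln0 ?mul0n 1?mulnC //.
  by rewrite !Fp_natK; congr W; ring.
have px : x' ^+ (p ^ s) = W g x y 0 (j * n22 + k * n32) (j * n23 + k * n33).
  rewrite (E3_pow (t1 := i) (t2 := j) (t3 := k) fr eg ex ey) 1?[in RHS]mulnC //; last first.
    by rewrite expnS; lia.
  rewrite natrM natp0 !Fp_natK -/C; congr W; rewrite /i; try ring.
  by rewrite divfK //; ring.
have py : y' ^+ (p ^ s) = W g x y 0 (j' * n22 + k' * n32) (j' * n23 + k' * n33).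
  rewrite (E3_pow (t1 := i') (t2 := j') (t3 := k') fr eg ex ey) 1?[in RHS]mulnC //; last first.
    by rewrite expnS; lia.
  rewrite natrM natp0 !Fp_natK -/C; congr W; rewrite /i'; try ring.
  by rewrite divfK //; ring.
have gen' : <<[set g'; x'; y']>> = G.
  apply: (E3_gen fr pG); rewrite natrM natp0 !Fp_natK.
  rewrite (_ : det3 _ _ _ _ _ _ _ _ _ = (l * (l * n11))%R) ?mulf_neq0 //.
  by rewrite -edet /det3; ring.
split=> //; split; last split.
- by rewrite expnSr expgM pg W_exp_p.
- by rewrite expnSr expgM px W_exp_p.
- by rewrite expnSr expgM py W_exp_p.
- exact: class2_gens.
- rewrite pg (E3_comm fr) !natrM natp0 !Fp_natK -edet; congr W; ring.
- rewrite (E3_comm fr) [(al * _)%N]mulnC expgM px py (WX fr) (WD fr) !natrM natp0 !Fp_natK.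
  by rewrite e1 e2; congr W; ring.
- rewrite (E3_comm fr) ![(_ * p ^ s)%N]mulnC !expgM px py !(WX fr) (WD fr) !natrM natp0 !Fp_natK.
  by rewrite e3 e4; congr W; ring.
Qed.

(** Dually, g' is corrected by p-th powers of x and y that remove the components of its power along
    [y, g] and [g, x]; the system for i and i' is solvable because the 2 x 2 block is invertible. *)
Lemma typeB_rel3 : 0 < s -> (n22 * n33 - n23 * n32 != 0)%R ->
    g ^+ (p ^ s) = W g x y n11 n12 n13 ->
    x ^+ (p ^ s.+1) = W g x y 0 n22 n23 ->
    y ^+ (p ^ s.+1) = W g x y 0 n32 n33 ->
  exists g' x' y', <<[set g'; x'; y']>> = G /\ rel3 p s s.+1 al ga de g' x' y'.
Proof.
move=> s0 D0 eg ex ey.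
have C0 : ('C(p ^ s.+1, 2)%:R = 0 :> 'F_p)%R.
  by apply/eqP; rewrite Fp_nat_eq0 // bin2_pX // ltnS s0 orbT.
have [i [i' [ei ei']]] : exists i i' : 'F_p, (l * n12 + i * n22 + i' * n32 = 0 /\
    l * n13 + i * n23 + i' * n33 = 0)%R.
  exact: cramer2.
pose g' := E3 g x y l (p * i) (p * i'); pose x' := E3 g x y 0 j k.
pose y' := E3 g x y 0 j' k'; exists g', x', y'.
have pg : g' ^+ (p ^ s) = W g x y (l * n11) 0 0.
  rewrite (E3_pow (t1 := l) (t2 := i) (t3 := i') fr eg ex ey) 1?[in RHS]mulnC //; try by rewrite expnS; lia.
  by rewrite !natrM natp0 !Fp_natK; congr W; [ring | rewrite -[RHS]ei; ring | rewrite -[RHS]ei'; ring].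
have px : x' ^+ (p ^ s.+1) = W g x y 0 (j * n22 + k * n32) (j * n23 + k * n33).
  rewrite (E3_pow (t1 := 0) (t2 := j) (t3 := k) fr eg ex ey) ?muln0 ?mul0n 1?mulnC //.
  rewrite C0 !Fp_natK; congr W; ring.
have py : y' ^+ (p ^ s.+1) = W g x y 0 (j' * n22 + k' * n32) (j' * n23 + k' * n33).
  rewrite (E3_pow (t1 := 0) (t2 := j') (t3 := k') fr eg ex ey) ?muln0 ?mul0n 1?mulnC //.
  rewrite C0 !Fp_natK; congr W; ring.
have gen' : <<[set g'; x'; y']>> = G.
  apply: (E3_gen fr pG); rewrite !natrM natp0 !Fp_natK.
  rewrite (_ : det3 _ _ _ _ _ _ _ _ _ = (l * (l * n11))%R) ?mulf_neq0 //.
  by rewrite -edet /det3; ring.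
split=> //; split; last split.
- by rewrite expnSr expgM pg W_exp_p.
- by rewrite expnSr expgM px W_exp_p.
- by rewrite expnSr expgM py W_exp_p.
- exact: class2_gens.
- rewrite pg (E3_comm fr) !Fp_natK -edet; congr W; ring.
- rewrite (E3_comm fr) [(al * _)%N]mulnC expgM px py (WX fr) (WD fr) !natrM natp0 !Fp_natK.
  by rewrite e1 e2; congr W; ring.
- rewrite (E3_comm fr) ![(_ * p ^ s.+1)%N]mulnC !expgM px py !(WX fr) (WD fr) !natrM natp0 !Fp_natK.
  by rewrite e3 e4; congr W; ring.
Qed.

End ChangeBasis.

(** * From metahamiltonian groups to normalised relations *)

Lemma dprod3_eq1 (gT : finGroupType) (A : {group gT}) (a b c : gT) i j k :
    \big[dprod/1]_(z <- [:: a; b; c]) <[z]> = A -> a ^+ i * b ^+ j * c ^+ k = 1 ->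
  [/\ a ^+ i = 1, b ^+ j = 1 & c ^+ k = 1].
Proof.
rewrite !big_cons big_nil dprodg1.
case/dprodP=> [[_ K _ eK]] _ _; rewrite eK; move: eK => /dprodP[_ eK _ tibc] tia.
rewrite -mulgA => e; have Kbc : b ^+ j * c ^+ k \in K.
  by rewrite -eK mem_mulg // mem_cycle.
have a1 : a ^+ i \in <[a]> :&: K.
  by rewrite inE mem_cycle -(groupMr _ Kbc) e group1.
rewrite tia inE in a1; move: e; rewrite (eqP a1) mul1g => e.
have b1 : b ^+ j \in <[b]> :&: <[c]>.
  by rewrite inE mem_cycle -(groupMr _ (mem_cycle c k)) e group1.
by move: b1 e; rewrite tibc inE => /eqP-> ; rewrite mul1g => ->.
Qed.

(** A cyclic decomposition of G / G' is lifted to G. It has three factors: no more than d(G), and no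
    fewer because the lifts generate G, as G' lies in Phi(G). *)
Lemma der1_basis p (gT : finGroupType) (G : {group gT}) :
    prime p -> p.-group G -> 'm(G) = 3 ->
  exists a1 a2 a3 m1 m2 m3, [/\ <<[set a1; a2; a3]>> = G,
    [/\ 0 < m3, m3 <= m2 & m2 <= m1],
    [/\ a1 ^+ (p ^ m1) \in G^`(1), a2 ^+ (p ^ m2) \in G^`(1) & a3 ^+ (p ^ m3) \in G^`(1)],
    (forall i j k, E3 a1 a2 a3 i j k \in G^`(1) ->
      [&& p ^ m1 %| i, p ^ m2 %| j & p ^ m3 %| k]) &
    #|G / G^`(1)| = (p ^ (m1 + m2 + m3))%N].
Proof.
move=> p_pr pG mG; have nG := der_norm 1 G.
have cQ : abelian (G / G^`(1)) by apply: sub_der1_abelian.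
have [b defQ ob] := abelian_structure cQ.
have bQ z : z \in b -> z \in G / G^`(1).
  move=> bz; have := bigdprodWY defQ => <-; rewrite bigcup_seq.
  by apply: mem_gen; apply/bigcupP; exists z; rewrite ?cycle_id.
have lift z : exists h, z \in b -> h \in G /\ z = coset G^`(1) h.
  have [/bQ/morphimP[h _ Gh ->] | ] := boolP (z \in b); first by exists h.
  by exists 1.
have [f fP] := fin_all_exists lift.
have genf : <<[set f z | z in b]>> = G.
  apply: Phi_nongen; apply/eqP.
  have sfG : [set f z | z in b] \subset G.
    by apply/subsetP=> _ /imsetP[z /fP[Gf _] ->].
  rewrite eqEsubset; apply/andP; split.
    by rewrite -joing_idr join_subG Phi_sub gen_subG.
  pose K := ('Phi(G) <*> <<[set f z | z in b]>>)%G.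
  have sDK : G^`(1) \subset K.
    by apply: subset_trans (joing_subl _ _); rewrite (Phi_joing pG) joing_subl.
  rewrite -joing_idr -/(gval K) -(quotientSGK nG sDK).
  rewrite -(bigdprodWY defQ) gen_subG bigcup_seq; apply/bigcupsP=> z bz.
  rewrite cycle_subG; have [Gf ->] := fP z bz.
  by rewrite mem_quotient // (subsetP (joing_subr _ _)) // mem_gen // imset_f.
have szb : size b = 3.
  apply/eqP; rewrite eqn_leq; apply/andP; split.
    rewrite -(size_map order) ob size_abelian_type // -grank_abelian // -mG.
    exact: quotient_grank.
  rewrite -mG -{1}genf; apply: leq_trans (grank_min _) _.
  by apply: leq_trans (leq_imset_card _ _) (card_size _).
case: b => [|x1 [|x2 [|x3 []]]] // in defQ ob bQ fP genf szb lift *.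
have oX z : z \in [:: x1; x2; x3] -> exists m, #[z] = (p ^ m)%N.
  by move=> /bQ Qz; have /p_natP[m ->] := mem_p_elt (quotient_pgroup _ pG) Qz; exists m.
have b1 : x1 \in [:: x1; x2; x3] by rewrite !inE eqxx.
have b2 : x2 \in [:: x1; x2; x3] by rewrite !inE eqxx orbT.
have b3 : x3 \in [:: x1; x2; x3] by rewrite !inE eqxx !orbT.
have [[m1 o1] [m2 o2] [m3 o3]] := And3 (oX _ b1) (oX _ b2) (oX _ b3).
have [[G1 e1] [G2 e2] [G3 e3]] := And3 (fP _ b1) (fP _ b2) (fP _ b3).
exists (f x1), (f x2), (f x3), m1, m2, m3.
have N z : z \in G -> z \in 'N(G^`(1)) by move/(subsetP nG).
have gt1 := abelian_type_gt1 (G / G^`(1)); rewrite -ob /= in gt1.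
have srt := abelian_type_dvdn_sorted (G / G^`(1)); rewrite -ob /= in srt.
move: gt1 srt; rewrite o1 o2 o3 !andbT => /and3P[_ _ m3_gt1].
rewrite !dvdn_Pexp2l ?prime_gt1 // => /andP[le21 le32].
have defG : <<[set f x1; f x2; f x3]>> = G.
  rewrite -[RHS]genf; congr <<_>>; apply/setP=> z; rewrite !inE -orbA.
  apply/or3P/imsetP=> [[]/eqP-> | [w]]; [by exists x1 | by exists x2 | by exists x3 |].
  by rewrite !inE => /or3P[]/eqP-> ->; [constructor 1 | constructor 2 | constructor 3].
split=> //.
- by rewrite le21 le32; split=> //; move: m3_gt1; case: (m3) => //; rewrite expn0.
- by split; apply: coset_idr; rewrite ?N ?groupX // morphX ?N //= -?e1 -?e2 -?e3 -?o1 -?o2 -?o3 expg_order.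
- move=> i j k Dijk; have := coset_id Dijk.
  rewrite E3E !morphM ?morphX ?N ?groupM ?groupX //= -e1 -e2 -e3.
  case/(dprod3_eq1 defQ) => /eqP + /eqP + /eqP; rewrite -!order_dvdn o1 o2 o3.
  by move=> -> -> ->.
by rewrite -(bigdprod_card defQ) !big_cons big_nil -!/#[_] o1 o2 o3 muln1 -!expnD addnA.
Qed.

Definition rel7 (gT : finGroupType) (a b c : gT) : Prop :=
  [/\ a ^+ 4 = 1, b ^+ 4 = 1, c ^+ 4 = 1, [~ c ^+ 2, a] = 1 /\ [~ c ^+ 2, b] = 1 &
    [/\ [~ b, c] = a ^+ 2 * b ^+ 2, [~ c, a] = b ^+ 2 * c ^+ 2 & [~ a, b] = c ^+ 2]].

Section Det.
Local Open Scope ring_scope.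

(** Lagrange's identity for (a x b) . (u x v). *)
Lemma det3_lagrange (R : comPzRingType) (a1 a2 a3 b1 b2 b3 u1 u2 u3 v1 v2 v3 : R) :
  det3 a1 a2 a3 b1 b2 b3 (u2 * v3 - u3 * v2) (u3 * v1 - u1 * v3) (u1 * v2 - u2 * v1) =
  (a1 * u1 + a2 * u2 + a3 * u3) * (b1 * v1 + b2 * v2 + b3 * v3) -
  (a1 * v1 + a2 * v2 + a3 * v3) * (b1 * u1 + b2 * u2 + b3 * u3).
Proof. by rewrite /det3; ring. Qed.

(* An isotropic vector u of the form u N u^T gives the contradiction: all v
   orthogonal to u N would be proportional to u. *)
Lemma bilinear_degenerate p (n11 n12 n13 n21 n22 n23 n31 n32 n33 : 'F_p) : prime p ->
  ~ (forall u1 u2 u3 v1 v2 v3 : 'F_p,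
  [|| u2 * v3 - u3 * v2 != 0, u3 * v1 - u1 * v3 != 0 | u1 * v2 - u2 * v1 != 0] ->
  (det3
    (u1 * n11 + u2 * n21 + u3 * n31)
    (u1 * n12 + u2 * n22 + u3 * n32)
    (u1 * n13 + u2 * n23 + u3 * n33)
    (v1 * n11 + v2 * n21 + v3 * n31)
    (v1 * n12 + v2 * n22 + v3 * n32)
    (v1 * n13 + v2 * n23 + v3 * n33)
    (u2 * v3 - u3 * v2) (u3 * v1 - u1 * v3) (u1 * v2 - u2 * v1) != 0)).
Proof.
move=> p_pr nd.
have [u1 [u2 [u3 [u0 qu]]]] :=
  @ternary_isotropic p n11 (n12 + n21) n22 (n13 + n31) (n23 + n32) n33 p_pr.
pose a1 := u1 * n11 + u2 * n21 + u3 * n31.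
pose a2 := u1 * n12 + u2 * n22 + u3 * n32.
pose a3 := u1 * n13 + u2 * n23 + u3 * n33.
have au : a1 * u1 + a2 * u2 + a3 * u3 = 0 by rewrite -[RHS]qu /a1 /a2 /a3; ring.
have deg v1 v2 v3 : a1 * v1 + a2 * v2 + a3 * v3 = 0 ->
    u2 * v3 - u3 * v2 = 0 /\ u3 * v1 - u1 * v3 = 0 /\ u1 * v2 - u2 * v1 = 0.
  move=> av; have := nd u1 u2 u3 v1 v2 v3.
  rewrite det3_lagrange -/a1 -/a2 -/a3 au av !mul0r subrr eqxx.
  case: eqP => [->|_ /(_ isT)//]; case: eqP => [->|_ /(_ isT)//].
  by case: eqP => [->|_ /(_ isT)//].
have {}deg v1 v2 v3 : a1 * v1 + a2 * v2 + a3 * v3 = 0 ->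
    [/\ u2 * v3 = u3 * v2, u3 * v1 = u1 * v3 & u1 * v2 = u2 * v1].
  by move/deg=> [/subr0_eq e1 [/subr0_eq e2 /subr0_eq e3]].
have a_eq0 : [/\ a1 = 0, a2 = 0 & a3 = 0].
  (* The vectors a x e_i are orthogonal to a, hence proportional to u; as u is orthogonal to a as
     well, this forces a = 0. *)
  have [d1 d2 d3] := deg 0 a3 (- a2) ltac:(ring).
  have [d4 d5 d6] := deg a3 0 (- a1) ltac:(ring).
  have [d7 d8 d9] := deg a2 (- a1) 0 ltac:(ring).
  case/or3P: u0 => un.
  - have e2 : a2 = 0.
      by apply: (mulfI un); rewrite mulr0; apply: oppr_inj; rewrite -mulrN -d2 mulr0 oppr0.
    have e3 : a3 = 0 by apply: (mulfI un); rewrite mulr0 d3 mulr0.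
    split=> //; apply: (mulfI un); rewrite mulr0; move: au.
    by rewrite e2 e3 !mul0r !addr0 mulrC.
  - have e1 : a1 = 0.
      by apply: (mulfI un); rewrite mulr0; apply: oppr_inj; rewrite -mulrN d4 mulr0 oppr0.
    have e3 : a3 = 0 by apply: (mulfI un); rewrite mulr0 -d6 mulr0.
    split=> //; apply: (mulfI un); rewrite mulr0; move: au.
    by rewrite e1 e3 !mul0r addr0 add0r mulrC.
  have e1 : a1 = 0.
    by apply: (mulfI un); rewrite mulr0; apply: oppr_inj; rewrite -mulrN -d7 mulr0 oppr0.
  have e2 : a2 = 0 by apply: (mulfI un); rewrite mulr0 d8 mulr0.
  split=> //; apply: (mulfI un); rewrite mulr0; move: au.
  by rewrite e1 e2 !mul0r !add0r mulrC.
have [e1 e2 e3] := a_eq0.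
(* With a = 0 every vector is orthogonal to a, so every vector would be proportional to u. *)
have [d1 d2 d3] := deg 1 0 0 ltac:(rewrite e1 e2 e3; ring).
have [d4 d5 d6] := deg 0 1 0 ltac:(rewrite e1 e2 e3; ring).
move: d2 d3 d6; rewrite !mulr0 !mulr1 => d2 d3 d6.
by move: u0; rewrite d6 -d3 d2 eqxx.
Qed.

End Det.

Section BoolSearch.

Variables n11 n12 n13 n21 n22 n23 n31 n32 n33 : bool.

(** Coordinates of the square of the element with exponents u: the linear part plus the correction
    with C(2, 2) = 1; signs vanish over F_2. *)
Let sq1 u1 u2 u3 := u1 && n11 (+) u2 && n21 (+) u3 && n31 (+) u2 && u3.
Let sq2 u1 u2 u3 := u1 && n12 (+) u2 && n22 (+) u3 && n32 (+) u1 && u3.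
Let sq3 u1 u2 u3 := u1 && n13 (+) u2 && n23 (+) u3 && n33 (+) u1 && u2.
Let crs a b c d := a && b (+) c && d.
Let bdet a1 a2 a3 b1 b2 b3 c1 c2 c3 :=
  a1 && crs b2 c3 b3 c2 (+) a2 && crs b1 c3 b3 c1 (+) a3 && crs b1 c2 b2 c1.
Let bools := [:: false; true].
Let all3 (P : bool -> bool -> bool -> bool) :=
  all (fun u1 => all (fun u2 => all (P u1 u2) bools) bools) bools.
Let has3 (P : bool -> bool -> bool -> bool) :=
  has (fun u1 => has (fun u2 => has (P u1 u2) bools) bools) bools.

(* For p = 2 and m1 = m2 = m3 = 1 there are only 2 ^ 9 power maps, and the bases
   satisfying the relations of (7) are found by exhaustive search. *)
Definition bool_det_hyp :=
  all3 (fun u1 u2 u3 => all3 (fun v1 v2 v3 =>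
    [|| crs u2 v3 u3 v2, crs u3 v1 u1 v3 | crs u1 v2 u2 v1] ==>
    bdet (sq1 u1 u2 u3) (sq2 u1 u2 u3) (sq3 u1 u2 u3)
         (sq1 v1 v2 v3) (sq2 v1 v2 v3) (sq3 v1 v2 v3)
         (crs u2 v3 u3 v2) (crs u3 v1 u1 v3) (crs u1 v2 u2 v1))).

Definition bool_rel7_goal :=
  has3 (fun u1 u2 u3 => has3 (fun v1 v2 v3 => has3 (fun w1 w2 w3 =>
    [&& bdet u1 u2 u3 v1 v2 v3 w1 w2 w3,
        [&& crs v2 w3 v3 w2 == sq1 u1 u2 u3 (+) sq1 v1 v2 v3,
            crs v3 w1 v1 w3 == sq2 u1 u2 u3 (+) sq2 v1 v2 v3 &
            crs v1 w2 v2 w1 == sq3 u1 u2 u3 (+) sq3 v1 v2 v3],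
        [&& crs w2 u3 w3 u2 == sq1 v1 v2 v3 (+) sq1 w1 w2 w3,
            crs w3 u1 w1 u3 == sq2 v1 v2 v3 (+) sq2 w1 w2 w3 &
            crs w1 u2 w2 u1 == sq3 v1 v2 v3 (+) sq3 w1 w2 w3] &
        [&& crs u2 v3 u3 v2 == sq1 w1 w2 w3,
            crs u3 v1 u1 v3 == sq2 w1 w2 w3 &
            crs u1 v2 u2 v1 == sq3 w1 w2 w3]]))).

End BoolSearch.

Lemma bool_det_rel7 n11 n12 n13 n21 n22 n23 n31 n32 n33 :
  bool_det_hyp n11 n12 n13 n21 n22 n23 n31 n32 n33 ->
  bool_rel7_goal n11 n12 n13 n21 n22 n23 n31 n32 n33.
Proof.
by apply/implyP; move: n11 n12 n13 n21 n22 n23 n31 n32 n33; do 9![case]; vm_compute.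
Qed.

Section BoolF2.
Local Open Scope ring_scope.
Variable p : nat.
Hypothesis p2 : p = 2.

Definition b2F (b : bool) : 'F_p := (b : nat)%:R.

Let p_pr : prime p. Proof. by rewrite p2. Qed.
Let t0 : 1 + 1 = 0 :> 'F_p.
Proof. by apply/eqP; rewrite -[1 + 1]/(2%:R) Fp_nat_eq0 // p2. Qed.

Lemma F2_opp (a : 'F_p) : - a = a.
Proof. by apply/eqP; rewrite eq_sym -addr_eq0 -[a]mulr1 -mulrDr t0 mulr0. Qed.

Lemma b2FD a b : b2F (a (+) b) = b2F a + b2F b.
Proof. by case: a b => [] []; rewrite /b2F /= ?t0 ?addr0 ?add0r. Qed.

Lemma b2FM a b : b2F (a && b) = b2F a * b2F b.
Proof. by case: a b => [] []; rewrite /b2F /= ?mulr1 ?mulr0 ?mul0r. Qed.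

Lemma b2F_surj a : exists b, a = b2F b.
Proof. by case: (F2P a p2) => ->; [exists false | exists true]. Qed.

Lemma b2F_neq0 b : (b2F b != 0) = b.
Proof. by case: b; rewrite /b2F /= ?oner_neq0 ?eqxx. Qed.

End BoolF2.

Lemma typeC_rel7 p (gT : finGroupType) (G : {group gT}) (g x y : gT)
    (n11 n12 n13 n21 n22 n23 n31 n32 n33 : 'F_p) :
    p = 2 -> frame p G g x y -> p.-group G ->
    g ^+ (p ^ 1) = W g x y n11 n12 n13 ->
    x ^+ (p ^ 1) = W g x y n21 n22 n23 ->
    y ^+ (p ^ 1) = W g x y n31 n32 n33 ->
  (forall u1 u2 u3 v1 v2 v3 : 'F_p,
  [|| u2 * v3 - u3 * v2 != 0, u3 * v1 - u1 * v3 != 0 | u1 * v2 - u2 * v1 != 0]%R ->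
  (det3
    (u1 * n11 + u2 * n21 + u3 * n31 - 1 * (u2 * u3))
    (u1 * n12 + u2 * n22 + u3 * n32 + 1 * (u1 * u3))
    (u1 * n13 + u2 * n23 + u3 * n33 - 1 * (u1 * u2))
    (v1 * n11 + v2 * n21 + v3 * n31 - 1 * (v2 * v3))
    (v1 * n12 + v2 * n22 + v3 * n32 + 1 * (v1 * v3))
    (v1 * n13 + v2 * n23 + v3 * n33 - 1 * (v1 * v2))
    (u2 * v3 - u3 * v2) (u3 * v1 - u1 * v3) (u1 * v2 - u2 * v1) != 0)%R) ->
  exists a b c, <<[set a; b; c]>> = G /\ rel7 a b c.
Proof.
move=> p2 fr pG eg ex ey hN; have [p_pr defG cl2 _ _] := fr.
have bE (b : bool) : ((b : nat)%:R = b2F p b)%R by [].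
have D := b2FD p2; have M := @b2FM p.
have [[b11 e11] [b12 e12] [b13 e13]] := And3 (b2F_surj p2 n11) (b2F_surj p2 n12) (b2F_surj p2 n13).
have [[b21 e21] [b22 e22] [b23 e23]] := And3 (b2F_surj p2 n21) (b2F_surj p2 n22) (b2F_surj p2 n23).
have [[b31 e31] [b32 e32] [b33 e33]] := And3 (b2F_surj p2 n31) (b2F_surj p2 n32) (b2F_surj p2 n33).
have eqF a b : a = b -> b2F p a = b2F p b by move->.
have N := F2_opp p2.
have sol : bool_rel7_goal b11 b12 b13 b21 b22 b23 b31 b32 b33.
  apply: bool_det_rel7; apply/allP=> u1 _; apply/allP=> u2 _; apply/allP=> u3 _.
  apply/allP=> v1 _; apply/allP=> v2 _; apply/allP=> v3 _; apply/implyP => nz.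
  have := hN (b2F p u1) (b2F p u2) (b2F p u3) (b2F p v1) (b2F p v2) (b2F p v3).
  rewrite e11 e12 e13 e21 e22 e23 e31 e32 e33 /det3 !N !mul1r -!M -!D -!M -!D -!M -!D !(@b2F_neq0 p).
  by move=> /(_ nz).
case/hasP: sol => u1 _ /hasP[u2 _ /hasP[u3 _ /hasP[v1 _ /hasP[v2 _ /hasP[v3 _]]]]].
case/hasP=> w1 _ /hasP[w2 _ /hasP[w3 _ /and4P[d0]]].
case/and3P=> /eqP/eqF r11 /eqP/eqF r12 /eqP/eqF r13.
case/and3P=> /eqP/eqF r21 /eqP/eqF r22 /eqP/eqF r23.
case/and3P=> /eqP/eqF r31 /eqP/eqF r32 /eqP/eqF r33.
have C1 : ('C(p, 2)%:R = 1 :> 'F_p)%R by rewrite p2.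
have pw i j k := E3_pow (i := i) (j := j) (k := k) (t1 := i) (t2 := j) (t3 := k) fr eg ex ey
   (mulnC _ _) (mulnC _ _) (mulnC _ _).
rewrite expn1 in pw.
have gen : <<[set E3 g x y u1 u2 u3; E3 g x y v1 v2 v3; E3 g x y w1 w2 w3]>> = G.
  apply: (E3_gen fr pG).
  rewrite !bE /det3 !N -!M -!D -!M -!D (@b2F_neq0 p).
  exact: d0.
exists (E3 g x y u1 u2 u3), (E3 g x y v1 v2 v3), (E3 g x y w1 w2 w3); split=> //.
have pw2 i j k : E3 g x y i j k ^+ 2 \in G^`(1) by rewrite -{1}p2 pw (W_in fr).
have pw4 i j k : E3 g x y i j k ^+ 4 = 1.
  by rewrite (expgM _ 2 2) -[X in _ ^+ X]p2 (der1_exp fr).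
have cz z : z \in G -> [~ E3 g x y w1 w2 w3 ^+ 2, z] = 1.
  by move=> Gz; apply/eqP/commgP; apply: (der1_commute cl2).
have sq i j k := pw i j k; rewrite {1}p2 in sq.
split; rewrite ?pw4 ?cz ?(E3_in defG) //.
have pw' := pw; rewrite {1}p2 in pw'.
rewrite !(E3_comm fr) !bE !N -!M -!D r11 r12 r13 r21 r22 r23 r31 r32 r33.
by split; rewrite !pw' ?(WD fr) !C1 !bE !N e11 e12 e13 e21 e22 e23 e31 e32 e33 !D !M; congr W; ring.
Qed.

(** Conjugation by c^i moves that factor to the other end, and G' is normal. *)
Lemma E3_rot (gT : finGroupType) (G : {group gT}) (a b c : gT) i j k :
    <<[set a; b; c]>> = G ->
  E3 c a b i j k \in G^`(1) -> E3 a b c j k i \in G^`(1).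
Proof.
move=> defG D; have nG := normal_norm (der_normal 1 G).
have Gc := gen3_memy defG.
have := D; rewrite -(memJ_norm _ (subsetP nG _ (groupX i Gc))).
by rewrite !E3E /conjg !mulgA mulVg mul1g.
Qed.

Lemma gen3_rot (gT : finGroupType) (a b c : gT) :
  [set c; a; b] = [set a; b; c].
Proof. by apply/setP=> z; rewrite !inE -orbA orbC. Qed.

Lemma metahamiltonian_gens p (eta : 'F_p) (gT : finGroupType) (G : {group gT}) :
    prime p -> (odd p -> ~~ is_square eta) -> p.-group G -> 'm(G) = 3 ->
    'Phi(G) \subset 'Z(G) -> p.-abelem G^`(1) -> #|G^`(1)| = (p ^ 3)%N ->
    metahamiltonian G ->
  [\/ [/\ p = 2, #|G| = (2 ^ 6)%N & exists a b c, <<[set a; b; c]>> = G /\ rel7 a b c],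
      exists s (al ga de : 'F_p) g x y, [/\ 0 < s, #|G| = (p ^ (s.+1 + s + s + 3))%N,
        good_coefs eta (-1)%R al ga de, <<[set g; x; y]>> = G &
        rel3 p s.+1 s al ga de g x y] |
      exists s (al ga de : 'F_p) g x y, [/\ 0 < s, #|G| = (p ^ (s + s.+1 + s.+1 + 3))%N,
        good_coefs eta 1%R al ga de, <<[set g; x; y]>> = G &
        rel3 p s s.+1 al ga de g x y]].
Proof.
move=> p_pr eta_ns pG mG3 sPZ abG' oG' mG.
have cl2 : G^`(1) \subset 'Z(G).
  by apply: subset_trans sPZ; rewrite (Phi_joing pG) joing_subl.
have [a1 [a2 [a3 [m1 [m2 [m3 [defG [m3_gt0 le32 le21] [p1 p2 p3] ind oQ]]]]]]] :=
  der1_basis p_pr pG mG3.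
have m2_gt0 := leq_trans m3_gt0 le32; have m1_gt0 := leq_trans m2_gt0 le21.
have oG : #|G| = (p ^ (m1 + m2 + m3 + 3))%N.
  by rewrite -(Lagrange (der_sub 1 G)) -card_quotient ?der_norm // oQ oG' -expnD addnC.
have fr : frame p G a1 a2 a3 by [].
have [lt21 | le12] := ltnP m2 m1.
  have [n11 [n12 [n13 eg]]] := W_surj fr p1.
  have [n21 [n22 [n23 ex]]] := W_surj fr p2.
  have [n31 [n32 [n33 ey]]] := W_surj fr p3.
  have lt31 := leq_ltn_trans le32 lt21.
  have [n0 n120 n130] := typeA_shape fr eg ex ey ind mG lt21 lt31.
  have D0 := typeA_disc fr eg ex ey ind mG lt31.
  have em2 := typeA_exp2 fr eg ex ey ind mG lt21 lt31.
  have em3 := typeA_exp3 fr eg ex ey ind mG lt21 lt31.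
  have e23 : m3 = m2 by apply: succn_inj; rewrite -em2 -em3.
  have an := typeA_aniso fr eg ex ey ind mG lt21 lt31.
  have {}an (u v : 'F_p) : ((u != 0) || (v != 0))%R ->
      (n22 * u ^+ 2 + (n23 + n32) * (u * v) + n33 * v ^+ 2 != 0)%R.
    by move=> uv; have := an u v; rewrite -!Fp_nat_eq0 // !Fp_natK negb_and; apply.
  have em : ((-1) ^+ 2 = 1 :> 'F_p)%R by rewrite sqrrN expr1n.
  have [l [j [k [j' [k' [al [ga [de [l0 good ed [c1 c2 c3 c4]]]]]]]]]] :=
    normal_form p_pr eta_ns em n0 an D0.
  rewrite em2 n120 n130 in eg; rewrite e23 in ey.
  have [g' [x' [y' [gen rel]]]] := typeA_rel3 fr pG l0 n0 ed c1 c2 c3 c4 eg ex ey.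
  constructor 2; exists m2, al, ga, de, g', x', y'; split=> //.
  by rewrite oG em2 e23.
have em12 : m1 = m2 by apply/eqP; rewrite eqn_leq le12 le21.
have [lt32 | le23] := ltnP m3 m2.
  (* The smallest exponent belongs to the third generator, which moves to the front to play the role
     of g. *)
  have fr' : frame p G a3 a1 a2 by split; rewrite // gen3_rot.
  have [n11 [n12 [n13 eg]]] := W_surj fr' p3.
  have [n21 [n22 [n23 ex]]] := W_surj fr' p1.
  have [n31 [n32 [n33 ey]]] := W_surj fr' p2.
  have ind' i j k : E3 a3 a1 a2 i j k \in G^`(1) ->
      [&& p ^ m3 %| i, p ^ m1 %| j & p ^ m2 %| k].
    by move=> /(E3_rot defG)/ind/and3P[-> -> ->].
  have lt31 : m3 < m1 by rewrite em12.
  have [n0 n210 n310] := typeB_shape fr' eg ex ey ind' mG lt31 lt32.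
  have D0 := typeB_disc fr' eg ex ey ind' mG.
  have em1 := typeB_exp2 fr' eg ex ey ind' mG lt31 lt32.
  have em2 := typeB_exp3 fr' eg ex ey ind' mG lt31 lt32.
  have an := typeB_aniso fr' eg ex ey ind' mG m3_gt0 m1_gt0 lt31 lt32.
  have {}an (u v : 'F_p) : ((u != 0) || (v != 0))%R ->
      (n22 * u ^+ 2 + (n23 + n32) * (u * v) + n33 * v ^+ 2 != 0)%R.
    by move=> uv; have := an u v; rewrite -!Fp_nat_eq0 // !Fp_natK negb_and; apply.
  have em : (1 ^+ 2 = 1 :> 'F_p)%R by rewrite expr1n.
  have [l [j [k [j' [k' [al [ga [de [l0 good ed [c1 c2 c3 c4]]]]]]]]]] :=
    normal_form p_pr eta_ns em n0 an D0.
  rewrite em1 n210 in ex; rewrite em2 n310 in ey.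
  have [g' [x' [y' [gen rel]]]] := typeB_rel3 fr' pG l0 n0 ed c1 c2 c3 c4 m3_gt0 D0 eg ex ey.
  constructor 3; exists m3, al, ga, de, g', x', y'; split=> //.
  by rewrite oG em1 em2; congr (p ^ _)%N; ring.
have em23 : m2 = m3 by apply/eqP; rewrite eqn_leq le23 le32.
have [n11 [n12 [n13 eg]]] := W_surj fr p1.
have [n21 [n22 [n23 ex]]] := W_surj fr p2.
have [n31 [n32 [n33 ey]]] := W_surj fr p3.
have C := fun c ec => typeC_det fr eg ex ey ind mG (c := c) ec em12 (erefl m2) (esym em23).
(* In the first case the binomial correction vanishes and the power map is linear, which
   [bilinear_degenerate] excludes. *)
have [big | ] := boolP (odd p || (1 < m2)).
  case: (@bilinear_degenerate p n11 n12 n13 n21 n22 n23 n31 n32 n33 p_pr).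
  move=> u1 u2 u3 v1 v2 v3 nz.
  have C0 : (0 = 'C(p ^ m2, 2)%:R :> 'F_p)%R.
    by apply/eqP; rewrite eq_sym Fp_nat_eq0 // bin2_pX.
  by have := C _ C0 u1 u2 u3 v1 v2 v3 nz; rewrite !mul0r !subr0 !addr0.
rewrite negb_or -leqNgt => /andP[/(prime_oddPn p_pr) ep le1].
have m21 : m2 = 1%N by apply/eqP; rewrite eqn_leq le1.
have m11 : m1 = 1%N by rewrite em12.
have m31 : m3 = 1%N by rewrite -em23.
constructor 1; split=> //; first by rewrite oG m11 m21 m31 ep.
rewrite m11 in eg; rewrite m21 in ex; rewrite m31 in ey.
apply: (typeC_rel7 ep fr pG eg ex ey); apply: C.
by rewrite m21 expn1 (_ : 'C(p, 2) = 1%N) // ep.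
Qed.

(** * The relations imply the metahamiltonian property *)

Section Data.

Variables (p s : nat) (gT : finGroupType) (G : {group gT}) (g x y : gT).
Variables (a b c d : 'F_p).
Hypothesis fr : frame p G g x y.
Hypothesis s_gt0 : 0 < s.
Hypothesis D0 : (a * d - b * c != 0)%R.
Hypothesis an : forall u v : 'F_p, ((u != 0) || (v != 0))%R ->
  (a * u ^+ 2 + (b + c) * (u * v) + d * v ^+ 2 != 0)%R.

Let p_pr : prime p. Proof. by case: fr. Qed.
Let defG : <<[set g; x; y]>> = G. Proof. by case: fr. Qed.
Let cl2 : G^`(1) \subset 'Z(G). Proof. by case: fr. Qed.
Local Notation W := (@W p gT g x y).
Local Notation E3 := (E3 g x y).

Lemma E3w_exp (H : {group gT}) i j k w n : w \in G^`(1) -> p %| n ->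
  E3 i j k * w \in H -> E3 i j k ^+ n \in H.
Proof.
move=> Dw /dvdnP[m ->] Hz; have := groupX (m * p) Hz; rewrite expgMn; last first.
  by apply: commute_sym; apply: (der1_commute cl2) => //; apply: (E3_in defG).
by rewrite [(m * p)%N]mulnC [w ^+ _]expgM (der1_exp fr) // expg1n mulg1.
Qed.

Lemma E3w_mulX (H : {group gT}) u1 u2 u3 v1 v2 v3 w w' n :
    w \in G^`(1) -> w' \in G^`(1) ->
    E3 u1 u2 u3 * w \in H -> E3 v1 v2 v3 * w' \in H ->
  exists2 w'', w'' \in G^`(1) &
    E3 (u1 + v1 * n) (u2 + v2 * n) (u3 + v3 * n) * w'' \in H.
Proof.
move=> Dw Dw' Hu Hv; have := groupM Hu (groupX n Hv).
have Gv := E3_in defG v1 v2 v3.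
rewrite expgMn; last by apply: commute_sym; apply: (der1_commute cl2).
rewrite (E3_expX fr); set z := W _ _ _; have Dz : z \in G^`(1) by apply: (W_in fr).
have Gv' := E3_in defG (v1 * n) (v2 * n) (v3 * n).
have [w0 Dw0 ee] := E3_mul u1 u2 u3 (v1 * n) (v2 * n) (v3 * n) defG.
rewrite -!mulgA [w * _]mulgA (der1_commute cl2 Dw Gv') -!mulgA [E3 u1 _ _ * _]mulgA ee -mulgA => Hz.
by eexists; last exact: Hz; rewrite !groupM ?groupX.
Qed.

Let natp0 : (p%:R = 0 :> 'F_p)%R.
Proof. by apply/eqP; rewrite Fp_nat_eq0. Qed.

Section TypeA.

Variables (n21 n31 : 'F_p).
Hypothesis eg : g ^+ (p ^ s.+1) = W 1 0 0.
Hypothesis ex : x ^+ (p ^ s) = W n21 a b.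
Hypothesis ey : y ^+ (p ^ s) = W n31 c d.

(** Besides the commutator, H contains the p^s-th power of the first element and a power of the
    second. If p divides v1, this is again the p^s-th power and the determinant is n^2 (a d - b c),
    with n the [x, y]-component of the commutator; otherwise the p^(s+1)-th power yields v1^2 times
    the form at (u2, u3). *)
Lemma typeA_step (H : {group gT}) (u1 u2 u3 v1 v2 v3 : nat) w w' :
    w \in G^`(1) -> w' \in G^`(1) -> p %| u1 ->
    E3 u1 u2 u3 * w \in H -> E3 v1 v2 v3 * w' \in H ->
    W (u2%:R * v3%:R - u3%:R * v2%:R) (u3%:R * v1%:R - u1%:R * v3%:R)
      (u1%:R * v2%:R - u2%:R * v1%:R) \in H ->
    [|| u2%:R * v3%:R - u3%:R * v2%:R != 0 :> 'F_p,
        u3%:R * v1%:R - u1%:R * v3%:R != 0 :> 'F_p |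
        u1%:R * v2%:R - u2%:R * v1%:R != 0 :> 'F_p]%R ->
  G^`(1) \subset H.
Proof.
move=> Dw Dw' pu Hu Hv HR nz.
have ps : p %| p ^ s by rewrite dvdn_exp.
have u0 : (u1%:R = 0 :> 'F_p)%R by apply/eqP; rewrite Fp_nat_eq0.
have Ku := E3w_exp Dw ps Hu.
have [q eq] := dvdnP pu.
rewrite (E3_pow (t1 := q) (t2 := u2) (t3 := u3) fr eg ex ey) 1?[RHS]mulnC // in Ku; last first.
  by rewrite eq expnS -mulnA mulnC.
have [v0 | v0] := eqVneq (v1%:R : 'F_p)%R 0%R.
  have pv : p %| v1 by rewrite -Fp_nat_eq0 // v0.
  have Kv := E3w_exp Dw' ps Hv.
  have [q' eq'] := dvdnP pv.
  rewrite (E3_pow (t1 := q') (t2 := v2) (t3 := v3) fr eg ex ey) 1?[RHS]mulnC // in Kv; last first.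
    by rewrite eq' expnS -mulnA mulnC.
  apply: (W_gen fr Ku Kv HR); rewrite u0 v0.
  pose n := (u2%:R * v3%:R - u3%:R * v2%:R : 'F_p)%R.
  rewrite (_ : det3 _ _ _ _ _ _ _ _ _ = n * n * (a * d - b * c))%R; last first.
    by rewrite /det3 /n; ring.
  have n0 : (n != 0)%R.
    by move: nz; rewrite u0 v0 -/n !mulr0 !mul0r subrr eqxx !orbF.
  by apply: mulf_neq0 => //; apply: mulf_neq0.
have ps1 : p %| p ^ s.+1 by rewrite dvdn_exp.
have Kv := E3w_exp Dw' ps1 Hv.
rewrite (E3_pow (t1 := v1) (t2 := p * v2) (t3 := p * v3) fr eg ex ey) 1?[RHS]mulnC // in Kv; first last.
- by rewrite expnS mulnA [(_ * p)%N]mulnC.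
- by rewrite expnS mulnA [(_ * p)%N]mulnC.
have C0 : ('C(p ^ s.+1, 2)%:R = 0 :> 'F_p)%R.
  by apply/eqP; rewrite Fp_nat_eq0 // bin2_pX // ltnS s_gt0 orbT.
apply: (W_gen fr Ku Kv HR); rewrite u0 C0 !natrM natp0.
pose Q := (a * u2%:R ^+ 2 + (b + c) * (u2%:R * u3%:R) + d * u3%:R ^+ 2 : 'F_p)%R.
rewrite (_ : det3 _ _ _ _ _ _ _ _ _ = v1%:R * v1%:R * Q)%R; last first.
  by rewrite /det3 /Q; ring.
apply: mulf_neq0; first exact: mulf_neq0.
apply: an; apply: contraTT nz; rewrite negb_or !negbK.
by move=> /andP[/eqP-> /eqP->]; rewrite u0 !mul0r !subrr eqxx.
Qed.

Lemma typeA_metahamiltonian : metahamiltonian G.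
Proof.
apply: (gen2_metahamiltonian fr) => h1 h2 G1 G2 c12.
set H := <<[set h1; h2]>>%G.
have H1 : h1 \in H by rewrite mem_gen // !inE eqxx.
have H2 : h2 \in H by rewrite mem_gen // !inE eqxx orbT.
have HR := groupR H1 H2; have HR' := groupR H2 H1.
have [u1 [u2 [u3 [w [Dw e1]]]]] := gen3P defG G1.
have [v1 [v2 [v3 [w' [Dw' e2]]]]] := gen3P defG G2.
rewrite e1 e2 (E3w_comm defG cl2) // (E3_comm fr) in HR.
rewrite e1 e2 (E3w_comm defG cl2) // (E3_comm fr) in HR'.
rewrite e1 e2 (E3w_comm defG cl2) // (E3_comm fr) (W_eq1 fr) !negb_and in c12.
rewrite e1 in H1; rewrite e2 in H2.
have [u0 | u0] := boolP (p %| u1); first exact: (typeA_step Dw Dw' u0 H1 H2 HR c12).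
rewrite -Fp_nat_eq0 // in u0.
(* Adding n times the first exponent vector to the second makes its leading exponent divisible by p;
   listing the new vector first only changes the sign of the commutator. *)
pose n : 'F_p := (- v1%:R / u1%:R)%R.
have [w'' Dw'' H3] := E3w_mulX n Dw' Dw H2 H1.
have en : (v1%:R + u1%:R * n = 0 :> 'F_p)%R by rewrite /n mulrC divfK // subrr.
apply: (typeA_step Dw'' Dw _ H3 H1).
- by rewrite -Fp_nat_eq0 // natrD natrM Fp_natK en.
- move: HR'; congr (is_true (W _ _ _ \in H)); rewrite !natrD !natrM !Fp_natK; ring.
move: c12; congr is_true; rewrite !natrD !natrM !Fp_natK.
by congr [|| _, _ | _]; rewrite -[in LHS]oppr_eq0; congr (_ != _); ring.
Qed.

End TypeA.

Section TypeB.

Hypothesis eg : g ^+ (p ^ s) = W 1 0 0.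
Hypothesis ex : x ^+ (p ^ s.+1) = W 0 a b.
Hypothesis ey : y ^+ (p ^ s.+1) = W 0 c d.

Let C0 : ('C(p ^ s.+1, 2)%:R = 0 :> 'F_p)%R.
Proof. by apply/eqP; rewrite Fp_nat_eq0 // bin2_pX // ltnS s_gt0 orbT. Qed.

(** The exponent p^(s+1) kills the contribution of g, whose p^s-th power lies in G'. *)
Lemma typeB_high (H : {group gT}) (v1 v2 v3 : nat) w :
    w \in G^`(1) -> E3 v1 v2 v3 * w \in H ->
  W 0 (v2%:R * a + v3%:R * c) (v2%:R * b + v3%:R * d) \in H.
Proof.
move=> Dw Hv; have ps1 : p %| p ^ s.+1 by rewrite dvdn_exp.
have := E3w_exp Dw ps1 Hv.
rewrite (E3_pow (t1 := p * v1) (t2 := v2) (t3 := v3) fr eg ex ey) 1?[RHS]mulnC //; last first.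
  by rewrite expnS mulnA [(_ * p)%N]mulnC.
by rewrite C0 natrM natp0; congr (is_true (W _ _ _ \in H)); ring.
Qed.

Lemma typeB_low (H : {group gT}) (u1 u2 u3 v1 v2 v3 : nat) w w' :
    w \in G^`(1) -> w' \in G^`(1) -> p %| u2 -> p %| u3 ->
    E3 u1 u2 u3 * w \in H -> E3 v1 v2 v3 * w' \in H ->
    W (u2%:R * v3%:R - u3%:R * v2%:R) (u3%:R * v1%:R - u1%:R * v3%:R)
      (u1%:R * v2%:R - u2%:R * v1%:R) \in H ->
    [|| u2%:R * v3%:R - u3%:R * v2%:R != 0 :> 'F_p,
        u3%:R * v1%:R - u1%:R * v3%:R != 0 :> 'F_p |
        u1%:R * v2%:R - u2%:R * v1%:R != 0 :> 'F_p]%R ->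
  G^`(1) \subset H.
Proof.
move=> Dw Dw' pu2 pu3 Hu Hv HR nz.
have u20 : (u2%:R = 0 :> 'F_p)%R by apply/eqP; rewrite Fp_nat_eq0.
have u30 : (u3%:R = 0 :> 'F_p)%R by apply/eqP; rewrite Fp_nat_eq0.
have Kv := typeB_high Dw' Hv.
have ps : p %| p ^ s by rewrite dvdn_exp.
have Ku := E3w_exp Dw ps Hu.
have [[q2 eq2] [q3 eq3]] := (dvdnP pu2, dvdnP pu3).
rewrite (E3_pow (t1 := u1) (t2 := q2) (t3 := q3) fr eg ex ey) 1?[RHS]mulnC // in Ku; first last.
- by rewrite eq3 expnS -mulnA mulnC.
- by rewrite eq2 expnS -mulnA mulnC.
move: nz; rewrite u20 u30 !mul0r !subr0 !sub0r eqxx oppr_eq0 /= => nz.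
apply: (W_gen fr Ku Kv HR); rewrite u20 u30.
pose Q := (a * v2%:R ^+ 2 + (b + c) * (v2%:R * v3%:R) + d * v3%:R ^+ 2 : 'F_p)%R.
rewrite (_ : det3 _ _ _ _ _ _ _ _ _ = u1%:R * u1%:R * Q)%R; last first.
  by rewrite /det3 /Q; ring.
have u10 : (u1%:R != 0 :> 'F_p)%R.
  by apply: contraTneq nz => ->; rewrite !mul0r eqxx.
apply: mulf_neq0; first exact: mulf_neq0.
apply: an; apply: contraTT nz; rewrite negb_or !negbK.
by move=> /andP[/eqP-> /eqP->]; rewrite !mulr0 eqxx.
Qed.

(** If the (x, y)-parts of the exponent vectors are independent modulo p, their p^(s+1)-th powers
    span the plane of [y, g] and [g, x], and the commutator supplies [x, y]. Otherwise a combination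
    has both these exponents divisible by p, and [typeB_low] applies. *)
Lemma typeB_metahamiltonian : metahamiltonian G.
Proof.
apply: (gen2_metahamiltonian fr) => h1 h2 G1 G2 c12.
set H := <<[set h1; h2]>>%G.
have H1 : h1 \in H by rewrite mem_gen // !inE eqxx.
have H2 : h2 \in H by rewrite mem_gen // !inE eqxx orbT.
have HR := groupR H1 H2; have HR' := groupR H2 H1.
have [u1 [u2 [u3 [w [Dw e1]]]]] := gen3P defG G1.
have [v1 [v2 [v3 [w' [Dw' e2]]]]] := gen3P defG G2.
rewrite e1 e2 (E3w_comm defG cl2) // (E3_comm fr) in HR.
rewrite e1 e2 (E3w_comm defG cl2) // (E3_comm fr) in HR'.
rewrite e1 e2 (E3w_comm defG cl2) // (E3_comm fr) (W_eq1 fr) !negb_and in c12.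
rewrite e1 in H1; rewrite e2 in H2.
have [n0 | n0] := eqVneq (u2%:R * v3%:R - u3%:R * v2%:R : 'F_p)%R 0%R; last first.
  apply: (W_gen fr (typeB_high Dw H1) (typeB_high Dw' H2) HR).
  pose n := (u2%:R * v3%:R - u3%:R * v2%:R : 'F_p)%R.
  rewrite (_ : det3 _ _ _ _ _ _ _ _ _ = n * n * (a * d - b * c))%R; last first.
    by rewrite /det3 /n; ring.
  by apply: mulf_neq0 => //; apply: mulf_neq0.
have swap m : (v2%:R + u2%:R * m = 0 :> 'F_p)%R -> (v3%:R + u3%:R * m = 0 :> 'F_p)%R ->
    G^`(1) \subset H.
  move=> m2 m3; have [w'' Dw'' H3] := E3w_mulX m Dw' Dw H2 H1.
  apply: (typeB_low Dw'' Dw _ _ H3 H1).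
  - by rewrite -Fp_nat_eq0 // natrD natrM Fp_natK m2.
  - by rewrite -Fp_nat_eq0 // natrD natrM Fp_natK m3.
  - move: HR'; congr (is_true (W _ _ _ \in H)); rewrite !natrD !natrM !Fp_natK; ring.
  move: c12; congr is_true; rewrite !natrD !natrM !Fp_natK.
  by congr [|| _, _ | _]; rewrite -[in LHS]oppr_eq0; congr (_ != _); ring.
have [u20 | u20] := eqVneq (u2%:R : 'F_p)%R 0%R.
  have [u30 | u30] := eqVneq (u3%:R : 'F_p)%R 0%R.
    by apply: (typeB_low Dw Dw' _ _ H1 H2 HR c12); rewrite -Fp_nat_eq0 // ?u20 ?u30.
  apply: (swap (- v3%:R / u3%:R)%R); last by rewrite mulrC divfK // subrr.
  rewrite u20 mul0r addr0; apply/eqP; move/eqP: n0.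
  by rewrite u20 mul0r sub0r oppr_eq0 mulf_eq0 (negPf u30).
apply: (swap (- v2%:R / u2%:R)%R); first by rewrite mulrC divfK // subrr.
apply: (mulfI u20); rewrite mulr0 -[RHS]n0.
by rewrite mulrDr mulrCA [(u2%:R * (_ / _))%R]mulrC divfK // mulrN.
Qed.

End TypeB.

End Data.

(** The relations express commutators by powers. Inverting [[al, 1], [ga, de]] expresses the powers
    by commutators, and the resulting form is the given one divided by al de - ga. *)
Lemma rel3_metahamiltonian p r s (al ga de : 'F_p) (gT : finGroupType)
    (G : {group gT}) (g x y : gT) :
    frame p G g x y -> rel3 p r s al ga de g x y ->
    0 < r -> 0 < s -> r = s.+1 \/ s = r.+1 ->
    (forall u v : 'F_p, (u != 0) || (v != 0) ->
      u ^+ 2 + (de - al) * (u * v) - ga * v ^+ 2 != 0)%R ->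
  metahamiltonian G.
Proof.
move=> fr [gp xp yp _ [rxy rgx rgy]] r0 s0 rs an.
have [p_pr defG cl2 abG' oG'] := fr.
have [Gg Gx Gy] := And3 (gen3_memg defG) (gen3_memx defG) (gen3_memy defG).
(* This is the value of the form at (al, 1). *)
have d0 : (al * de - ga != 0)%R.
  have := an al 1%R; rewrite oner_neq0 orbT => /(_ isT).
  by congr (is_true (_ != _)); ring.
pose X := x ^+ (p ^ s); pose Y := y ^+ (p ^ s).
have Xp : X ^+ p = 1 by rewrite -expgM -expnSr.
have Yp : Y ^+ p = 1 by rewrite -expgM -expnSr.
have ps h : h \in G -> forall z, z \in G -> commute (h ^+ (p ^ s)) z.
  move=> Gh z Gz; apply/commgP; rewrite (class2_commXl cl2) //.
  by rewrite -(prednK s0) expnS expgM (der1_exp fr) ?expg1n ?mem_commg.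
rewrite [(al * _)%N]mulnC expgM -/X -/Y in rgx.
rewrite ![(_ * p ^ s)%N]mulnC !expgM -/X -/Y in rgy.
have cXY : commute X Y by apply: ps => //; rewrite groupX.
have Dgx : X ^+ al * Y \in G^`(1) by rewrite -rgx mem_commg.
have Dgy : X ^+ ga * Y ^+ de \in G^`(1) by rewrite -rgy mem_commg.
(* Eliminating Y from the two commutators leaves X^(al de - ga), hence X. *)
have DX : X \in G^`(1).
  pose q := (al * de - ga)%R.
  have : X ^+ q \in G^`(1).
    have := groupM (groupX de Dgx) (groupVr Dgy).
    rewrite expgMn; last by apply: commute_sym; apply: commuteX; apply: commute_sym.
    rewrite invMg mulgA mulgK -(Fp_expN p_pr _ Xp).
    by rewrite Fp_expX // -Fp_expD // Fp_natK mulrC.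
  move/(groupX (q^-1)%R); rewrite Fp_expX // Fp_natK mulVf // Fp_exp1 //.
have DY : Y \in G^`(1) by rewrite -(groupMl _ (groupX al DX)).
have [n21 [n22 [n23 ex]]] := W_surj fr DX.
have [n31 [n32 [n33 ey]]] := W_surj fr DY.
have eg : g ^+ (p ^ r) = @W p gT g x y 1 0 0 by rewrite -rxy (W_c1 fr).
have := rgx; rewrite -(W_c3 fr) ex ey (WX fr) (WD fr) Fp_natK => /(W_inj fr)[a1 a2 a3].
have := rgy; rewrite -invg_comm -(W_c2 fr) (WN fr) ex ey !(WX fr) (WD fr) !Fp_natK.
case/(W_inj fr) => b1 b2 b3.
have n310 : n31 = (- (al * n21))%R by apply/eqP; rewrite -addr_eq0 addrC -a1.
have n210 : n21 = 0%R.
  apply: (mulfI d0); rewrite mulr0.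
  transitivity (de * (al * n21 + n31) - (ga * n21 + de * n31))%R; first by ring.
  by rewrite -a1 -b1 mulr0 oppr0 subr0.
rewrite n210 mulr0 oppr0 in n310.
have e32 : n32 = (- (al * n22))%R by apply/eqP; rewrite -addr_eq0 addrC -a2.
have e33 : n33 = (1 - al * n23)%R by rewrite a3; ring.
pose D := (al * de - ga)%R.
have e22 : n22 = (D^-1)%R.
  by apply: (mulfI d0); rewrite mulfV //; apply: oppr_inj; rewrite b2 e32; ring.
have e23 : n23 = (de / D)%R.
  apply: (mulfI d0); rewrite [(de / D)%R]mulrC mulrA mulfV // mul1r.
  transitivity (de - (ga * n23 + de * (1 - al * n23)))%R; first by ring.
  by rewrite -e33 -b3 oppr0 subr0.
have D0 : (n22 * n33 - n23 * n32 != 0)%R.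
  rewrite e33 e32 (_ : _ - _ = n22)%R; last by ring.
  by rewrite e22 invr_eq0.
have an' (u v : 'F_p) : ((u != 0) || (v != 0))%R ->
    (n22 * u ^+ 2 + (n23 + n32) * (u * v) + n33 * v ^+ 2 != 0)%R.
  move=> uv; have -> : n33 = (- ga / D)%R.
    by rewrite e33 e23 /D; field.
  rewrite e32 e22 e23 (_ : _ + _ = (u ^+ 2 + (de - al) * (u * v) - ga * v ^+ 2) * D^-1)%R; last by ring.
  by rewrite mulf_neq0 ?invr_eq0 // an.
rewrite n210 in ex; rewrite n310 in ey.
case: rs => rs; subst.
  exact: (typeA_metahamiltonian fr s0 D0 an' eg ex ey).
exact: (typeB_metahamiltonian fr r0 D0 an' eg ex ey).
Qed.

(** The relations are triangular: c^2, b^2 and a^2 have coordinates (0, 0, 1), (0, 1, 1) and (1, 1,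
    1). The determinant is then checked on the 64 pairs of vectors over F_2. *)
Lemma rel7_metahamiltonian p (gT : finGroupType) (G : {group gT}) (a b c : gT) :
  p = 2 -> frame p G a b c -> rel7 a b c -> metahamiltonian G.
Proof.
move=> p2 fr [a4 b4 c4 _ [rbc rca rab]]; have [p_pr defG cl2 _ _] := fr.
have N := F2_opp p2.
have t0 : (1 + 1 = 0 :> 'F_p)%R by rewrite -{2}(N 1%R) subrr.
have c2 : c ^+ 2 = @W p gT a b c 0 0 1 by rewrite -rab (W_c3 fr).
have b2 : b ^+ 2 = @W p gT a b c 0 1 1.
  by apply: (mulIg (c ^+ 2)); rewrite -rca c2 (WD fr) -(W_c2 fr) t0 !addr0.
have a2 : a ^+ 2 = @W p gT a b c 1 1 1.
  by apply: (mulIg (b ^+ 2)); rewrite -rbc b2 (WD fr) -(W_c1 fr) t0 addr0.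
have e2p : (p ^ 1 = 2)%N by rewrite expn1.
have ea : a ^+ (p ^ 1) = @W p gT a b c 1 1 1 by rewrite e2p.
have eb : b ^+ (p ^ 1) = @W p gT a b c 0 1 1 by rewrite e2p.
have ec : c ^+ (p ^ 1) = @W p gT a b c 0 0 1 by rewrite e2p.
apply: (gen2_metahamiltonian fr) => h1 h2 G1 G2 c12.
set H := <<[set h1; h2]>>%G.
have H1 : h1 \in H by rewrite mem_gen // !inE eqxx.
have H2 : h2 \in H by rewrite mem_gen // !inE eqxx orbT.
have HR := groupR H1 H2.
have [u1 [u2 [u3 [w [Dw e1]]]]] := gen3P defG G1.
have [v1 [v2 [v3 [w' [Dw' e2]]]]] := gen3P defG G2.
rewrite e1 e2 (E3w_comm defG cl2) // (E3_comm fr) in HR.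
rewrite e1 e2 (E3w_comm defG cl2) // (E3_comm fr) (W_eq1 fr) !negb_and in c12.
rewrite e1 in H1; rewrite e2 in H2.
have pp : p %| p ^ 1 by rewrite expn1.
have K1 := E3w_exp fr Dw pp H1; have K2 := E3w_exp fr Dw' pp H2.
rewrite (E3_pow (t1 := u1) (t2 := u2) (t3 := u3) fr ea eb ec) 1?mulnC // in K1.
rewrite (E3_pow (t1 := v1) (t2 := v2) (t3 := v3) fr ea eb ec) 1?mulnC // in K2.
apply: (W_gen fr K1 K2 HR).
have -> : 'C(p ^ 1, 2) = 1%N by rewrite e2p.
have [[x1 ex1] [x2 ex2] [x3 ex3]] := And3 (b2F_surj p2 (u1%:R)%R) (b2F_surj p2 (u2%:R)%R) (b2F_surj p2 (u3%:R)%R).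
have [[y1 ey1] [y2 ey2] [y3 ey3]] := And3 (b2F_surj p2 (v1%:R)%R) (b2F_surj p2 (v2%:R)%R) (b2F_surj p2 (v3%:R)%R).
have D := b2FD p2; have M := @b2FM p.
move: c12; rewrite ex1 ex2 ex3 ey1 ey2 ey3 /det3 !N !mulr0 !mulr1 !mul1r !addr0.
rewrite -!M -!D -!M -!D -!M -!D !b2F_neq0 => c12.
move: c12; clear; by case: x1 x2 x3 y1 y2 y3 => [] [] [] [] [] [].
Qed.

(** * Upper bounds for the order of groups satisfying the relations *)

Lemma card_class2_gen3 p (gT : finGroupType) (K : {group gT}) (a b c : gT) m1 m2 m3 :
    prime p -> <<[set a; b; c]>> = K ->
    (forall z, z \in [:: a ^+ (p ^ m1); b ^+ (p ^ m2); c ^+ (p ^ m3)] ->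
       z ^+ p = 1 /\ {in [set a; b; c], forall h, commute z h}) ->
    [/\ [~ b, c] \in <<[set a ^+ (p ^ m1); b ^+ (p ^ m2); c ^+ (p ^ m3)]>>,
        [~ c, a] \in <<[set a ^+ (p ^ m1); b ^+ (p ^ m2); c ^+ (p ^ m3)]>> &
        [~ a, b] \in <<[set a ^+ (p ^ m1); b ^+ (p ^ m2); c ^+ (p ^ m3)]>>] ->
  #|K| <= p ^ (m1 + m2 + m3 + 3).
Proof.
move=> p_pr defK hz [Z1 Z2 Z3].
pose Z := <<[set a ^+ (p ^ m1); b ^+ (p ^ m2); c ^+ (p ^ m3)]>>%G.
have {}Z1 : [~ b, c] \in Z by []; have {}Z2 : [~ c, a] \in Z by [].
have {}Z3 : [~ a, b] \in Z by [].
have p0 : 0 < p := prime_gt0 p_pr.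
have sgen h : h \in [set a; b; c] -> h \in K.
  by move=> Sh; rewrite -defK mem_gen.
have Ka : a \in K by rewrite sgen // !inE eqxx.
have Kb : b \in K by rewrite sgen // !inE eqxx orbT.
have Kc : c \in K by rewrite sgen // !inE eqxx orbT.
have za := hz _ (mem_head _ _).
have zb : b ^+ (p ^ m2) \in [:: a ^+ (p ^ m1); b ^+ (p ^ m2); c ^+ (p ^ m3)].
  by rewrite !inE eqxx orbT.
have zc : c ^+ (p ^ m3) \in [:: a ^+ (p ^ m1); b ^+ (p ^ m2); c ^+ (p ^ m3)].
  by rewrite !inE eqxx !orbT.
have {}zb := hz _ zb; have {}zc := hz _ zc.
have cen z : z \in K -> {in [set a; b; c], forall h, commute z h} -> z \in 'Z(K).
  move=> Kz cz; rewrite inE Kz /= -defK cent_gen; apply/centP=> h Sh; exact: cz.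
(* The bound splits along Z, which is central with at most p^3 elements, and K / Z, which is abelian
   and generated by elements of orders dividing p^m1, p^m2 and p^m3. *)
have sZ : Z \subset 'Z(K).
  rewrite gen_subG; apply/subsetP=> z; rewrite !in_setU !in_set1 -orbA.
  by case/or3P=> /eqP->; apply: cen; rewrite ?groupX //; [case: za | case: zb | case: zc].
have abZ : abelian Z by apply: abelianS sZ (center_abelian _).
have nZK : K \subset 'N(Z).
  by apply: cents_norm; rewrite centsC (subset_trans sZ) // subsetIr.
have sZK : Z \subset K by apply: subset_trans sZ (center_sub _).
have oZ : #|Z| <= p ^ 3.
  rewrite !expnS expn0 muln1 mulnA; apply: card_abelian_gen3 => //; [by case: za | by case: zb | by case: zc].
have sS : [set a; b; c] \subset 'N(Z).
  by apply: subset_trans nZK; rewrite -defK subset_gen.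
have eQ := quotient_gen3 sS; rewrite defK in eQ.
have N h : h \in K -> h \in 'N(Z) by move/(subsetP nZK).
have abQ : abelian (K / Z).
  rewrite eQ abelian_gen; apply/centsP=> u Su v Sv; apply/commgP.
  have cmt h k : h \in K -> k \in K -> [~ h, k] \in Z -> [~ coset Z h, coset Z k] == 1.
    by move=> Kh Kk Zhk; rewrite -morphR ?N //= coset_id.
  have Z1' : [~ c, b] \in Z by rewrite -invg_comm groupV.
  have Z2' : [~ a, c] \in Z by rewrite -invg_comm groupV.
  have Z3' : [~ b, a] \in Z by rewrite -invg_comm groupV.
  by move: Su Sv; rewrite !inE -!orbA => /or3P[]/eqP-> /or3P[]/eqP->;
    rewrite ?commgg // cmt.
have oQ : #|K / Z| <= p ^ m1 * p ^ m2 * p ^ m3.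
  rewrite eQ; rewrite eQ in abQ.
  have one h n : h \in K -> h ^+ n \in Z -> coset Z h ^+ n = 1.
    by move=> Kh Zh; rewrite -morphX ?N //= coset_id.
  by apply: card_abelian_gen3; rewrite ?expn_gt0 ?p0 // one //; apply: mem_gen;
    rewrite !inE eqxx ?orbT.
rewrite -(Lagrange sZK) -card_quotient // !expnD mulnC.
by apply: leq_mul.
Qed.

Section CardRel3.

Variables (p r s al ga de : nat) (gT : finGroupType) (g x y : gT).
Hypotheses (p_pr : prime p) (r_gt0 : 0 < r) (s_gt0 : 0 < s).
Hypothesis rel : rel3 p r s al ga de g x y.

Let K := <<[set g; x; y]>>%G.

Lemma rel3_class2 : K^`(1) \subset 'Z(K).
Proof. by case: rel => _ _ _ cS _; apply: class2_gen. Qed.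

Let cl2 := rel3_class2.
Let defK : <<[set g; x; y]>> = K. Proof. by []. Qed.
Let Kg : g \in K := gen3_memg defK.
Let Kx : x \in K := gen3_memx defK.
Let Ky : y \in K := gen3_memy defK.

(** The order of g bounds that of [x, y]. As s > 0, x^(p^s) and y^(p^s) then commute, so the
    right-hand sides of the other two relations have p-th power 1. *)
Lemma rel3_comm_p : [/\ [~ x, y] ^+ p = 1, [~ y, g] ^+ p = 1 & [~ g, x] ^+ p = 1].
Proof.
case: rel => gp xp yp _ [rxy rgx rgy].
have cxy : [~ x, y] ^+ p = 1 by rewrite rxy -expgM -expnSr.
have cps : [~ x, y] ^+ (p ^ s) = 1.
  by rewrite -(prednK s_gt0) expnS expgM cxy expg1n.
have cXY : commute (x ^+ (p ^ s)) (y ^+ (p ^ s)).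
  apply/commgP; rewrite (class2_commXl cl2) ?groupX // (class2_commXr cl2) //.
  by rewrite cps expg1n.
have XY i j : (x ^+ (i * p ^ s) * y ^+ (j * p ^ s)) ^+ p = 1.
  rewrite ![(_ * p ^ s)%N]mulnC !expgM expgMn; last by apply: commuteX2.
  have hX (h : gT) n : h ^+ (p ^ s.+1) = 1 -> h ^+ (p ^ s) ^+ n ^+ p = 1.
    by move=> hp; rewrite -(expgM (h ^+ _)) mulnC (expgM (h ^+ _)) -(expgM h) -expnSr hp expg1n.
  by rewrite !hX // mulg1.
split=> //; first by rewrite -invg_comm expgVn rgy XY invg1.
by rewrite rgx -[(p ^ s)%N in X in _ * X]mul1n XY.
Qed.

Lemma rel3_pow_central z h : z \in [:: g ^+ (p ^ r); x ^+ (p ^ s); y ^+ (p ^ s)] ->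
  h \in [set g; x; y] -> commute z h.
Proof.
have [c1 c2 c3] := rel3_comm_p.
have c1' : [~ y, x] ^+ p = 1 by rewrite -invg_comm expgVn c1 invg1.
have c2' : [~ g, y] ^+ p = 1 by rewrite -invg_comm expgVn c2 invg1.
have c3' : [~ x, g] ^+ p = 1 by rewrite -invg_comm expgVn c3 invg1.
have cX a b n : a \in K -> b \in K -> 0 < n -> [~ a, b] ^+ p = 1 -> commute (a ^+ (p ^ n)) b.
  move=> Ka Kb n0 ab; apply/commgP; rewrite (class2_commXl cl2) //.
  by rewrite -(prednK n0) expnS expgM ab expg1n.
by rewrite !inE -!orbA => /or3P[]/eqP-> /or3P[]/eqP->; apply: cX;
  rewrite ?commgg ?expg1n.
Qed.

Lemma card_rel3 : #|K| <= p ^ (r + s + s + 3).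
Proof.
apply: (card_class2_gen3 p_pr defK).
  move=> z Sz; split; last by move=> h; apply: rel3_pow_central.
  case: rel => gp xp yp _ _.
  by move: Sz; rewrite !inE => /or3P[]/eqP->; rewrite -expgM -expnSr.
case: rel => _ _ _ _ [rxy rgx rgy].
set Z := <<_>>.
have Zg : g ^+ (p ^ r) \in Z by apply: mem_gen; rewrite !inE eqxx.
have Zx : x ^+ (p ^ s) \in Z by apply: mem_gen; rewrite !inE eqxx orbT.
have Zy : y ^+ (p ^ s) \in Z by apply: mem_gen; rewrite !inE eqxx orbT.
split; first by rewrite rxy.
  by rewrite -invg_comm groupV rgy groupM // mulnC expgM groupX.
by rewrite rgx groupM // mulnC expgM groupX.
Qed.

End CardRel3.

Section CardRel7.

Variables (gT : finGroupType) (a b c : gT).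
Hypothesis rel : rel7 a b c.
Let K := <<[set a; b; c]>>%G.

(** Only c^2 is assumed to commute with a and b. From [a, b] = c^2 one gets [a^2, b] = c^4 = 1 and
    likewise for b^2 and a; the three squares then commute, and the other relations settle
    commutation with c. *)
Lemma rel7_sq_central z h : z \in [:: a ^+ 2; b ^+ 2; c ^+ 2] ->
  h \in [set a; b; c] -> commute z h.
Proof.
case: rel => a4 b4 c4 [/eqP/commgP Ca /eqP/commgP Cb] [rbc rca rab].
have Cc : commute (c ^+ 2) c by apply: commute_sym; apply: commuteX.
have Aa : commute (a ^+ 2) a by apply: commute_sym; apply: commuteX.
have Bb : commute (b ^+ 2) b by apply: commute_sym; apply: commuteX.
have Ab : commute (a ^+ 2) b.
  apply/commgP; rewrite commXg; last by rewrite rab; apply: commute_sym.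
  by rewrite rab -expgM c4.
have Ba : commute (b ^+ 2) a.
  apply: commute_sym; apply/commgP; rewrite commgX; last by rewrite rab; apply: commute_sym.
  by rewrite rab -expgM c4.
have AB : commute (a ^+ 2) (b ^+ 2) by apply: commuteX.
have BC : commute (b ^+ 2) (c ^+ 2) by apply: commute_sym; apply: commuteX.
have Bc : commute (b ^+ 2) c.
  apply/commgP; rewrite commXg; last first.
    by rewrite rbc; apply: commuteM; apply: commute_sym.
  by rewrite rbc expgMn // -!expgM a4 b4 mulg1.
have Ac : commute (a ^+ 2) c.
  apply: commute_sym; apply/commgP; rewrite commgX; last first.
    by rewrite rca; apply: commuteM; apply: commute_sym.
  by rewrite rca expgMn // -!expgM b4 c4 mulg1.
by rewrite !inE -!orbA => /or3P[]/eqP-> /or3P[]/eqP->.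
Qed.

Lemma card_rel7 : #|K| <= 2 ^ 6.
Proof.
have defK : <<[set a; b; c]>> = K by [].
apply: (@card_class2_gen3 2 _ _ _ _ _ 1 1 1 isT defK).
  rewrite expn1 => z Sz; split; last by move=> h; apply: rel7_sq_central.
  case: rel => a4 b4 c4 _ _.
  by move: Sz; rewrite !inE => /or3P[]/eqP->; rewrite -expgM.
case: rel => _ _ _ _ [rbc rca rab]; rewrite expn1.
set Z := <<_>>.
have Za : a ^+ 2 \in Z by apply: mem_gen; rewrite !inE eqxx.
have Zb : b ^+ 2 \in Z by apply: mem_gen; rewrite !inE eqxx orbT.
have Zc : c ^+ 2 \in Z by apply: mem_gen; rewrite !inE eqxx orbT.
by rewrite rbc rca rab; split; [exact: groupM | exact: groupM | exact: Zc].
Qed.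

End CardRel7.

(** * Universal property from an order bound *)

Lemma morphim_gen3 (aT rT : finGroupType) (D : {group aT}) (f : {morphism D >-> rT})
    (a b c : aT) : [set a; b; c] \subset D ->
  f @* <<[set a; b; c]>> = <<[set f a; f b; f c]>>.
Proof.
by move=> sD; rewrite morphim_gen // morphimEsub // !imsetU !imset_set1.
Qed.

Section Universal.

Variables gT rT : finGroupType.

Lemma expg_pair (a : gT) (b : rT) n : (a, b) ^+ n = (a ^+ n, b ^+ n).
Proof. by elim: n => // n IHn; rewrite !expgS IHn. Qed.

Lemma mulg_pair (a a' : gT) (b b' : rT) : (a, b) * (a', b') = (a * a', b * b').
Proof. by []. Qed.

Lemma commg_pair (a a' : gT) (b b' : rT) : [~ (a, b), (a', b')] = ([~ a, a'], [~ b, b']).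
Proof. by []. Qed.

(* Both groups are images of the subgroup of the product generated by the pairs;
   if it is no larger than [G], it is isomorphic to [G]. *)
Lemma homg_of_card (G : {group gT}) (H : {group rT}) a b c a' b' c' :
    <<[set a; b; c]>> = G -> <<[set a'; b'; c']>> = H ->
    #|<<[set (a, a'); (b, b'); (c, c')]>>| <= #|G| ->
  H \homg G.
Proof.
move=> defG defH leK; pose K := <<[set (a, a'); (b, b'); (c, c')]>>%G.
have im1 : [morphism of @fst gT rT] @* K = G by rewrite morphim_gen3 ?subsetT.
have im2 : [morphism of @snd gT rT] @* K = H by rewrite morphim_gen3 ?subsetT.
have isoGK : G \isog K.
  rewrite isogEcard; apply/andP; split; last exact: leK.
  by rewrite -[X in X \homg _]im1 morphim_homg ?subsetT.
have homKG : K \homg G by apply: isog_hom; rewrite isog_sym.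
by apply: homg_trans homKG; rewrite -im2 morphim_homg ?subsetT.
Qed.

Lemma rel3_pair p r s al ga de (g x y : gT) (g' x' y' : rT) :
  rel3 p r s al ga de g x y -> rel3 p r s al ga de g' x' y' ->
  rel3 p r s al ga de (g, g') (x, x') (y, y').
Proof.
move=> [e1 e2 e3 e4 [e5 e6 e7]] [f1 f2 f3 f4 [f5 f6 f7]].
split; rewrite ?expg_pair ?e1 ?e2 ?e3 ?f1 ?f2 ?f3 //.
  have sp u : u \in [set (g, g'); (x, x'); (y, y')] ->
      u.1 \in [set g; x; y] /\ u.2 \in [set g'; x'; y'].
    by rewrite !inE -!orbA => /or3P[]/eqP-> /=; rewrite !eqxx ?orbT.
  move=> u v w /sp[u1 u2] /sp[v1 v2] /sp[w1 w2].
  case: u v w u1 u2 v1 v2 w1 w2 => [u u'] [v v'] [w w'] /= u1 u2 v1 v2 w1 w2.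
  by rewrite !commg_pair e4 // f4.
by rewrite !commg_pair ?expg_pair ?mulg_pair e5 e6 e7 f5 f6 f7.
Qed.

Lemma rel7_pair (a b c : gT) (a' b' c' : rT) :
  rel7 a b c -> rel7 a' b' c' -> rel7 (a, a') (b, b') (c, c').
Proof.
move=> [e1 e2 e3 [e4 e5] [e6 e7 e8]] [f1 f2 f3 [f4 f5] [f6 f7 f8]].
by split; rewrite ?expg_pair ?commg_pair ?e1 ?e2 ?e3 ?f1 ?f2 ?f3 ?e4 ?e5 ?f4 ?f5 //
   e6 e7 e8 f6 f7 f8.
Qed.

End Universal.

(** * Presentations *)

Definition gen_rel (R : forall gT : finGroupType, gT -> gT -> gT -> Prop)
    (gT : finGroupType) (G : {group gT}) : Prop :=
  exists a b c, <<[set a; b; c]>> = G /\ R gT a b c.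

(** A form of [G \isog Grp] with the relations in [Prop], so that [rel3] can replace the literal
    presentations of (1)-(6). *)
Definition presented (R : forall gT : finGroupType, gT -> gT -> gT -> Prop)
    (gT : finGroupType) (G : {group gT}) : Prop :=
  gen_rel R G /\ forall (rT : finGroupType) (H : {group rT}), gen_rel R H -> H \homg G.

Lemma isoGrp_presented p R :
    (forall rT (H : {group rT}), H \homg Grp p <-> gen_rel R H) ->
  forall (gT : finGroupType) (G : {group gT}), G \isog Grp p <-> presented R G.
Proof.
move=> hR gT G; split=> [isoG | [relG univ]].
  split; first by apply/hR; apply: isoGrp_hom.
  by move=> rT H /hR; rewrite isoG.
by apply: intro_isoGrp => [|rT H /hR]; [apply/hR | apply: univ].
Qed.

Definition comm_rel (gT : finGroupType) (a1 a2 a3 : gT) : Prop :=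
  {in [set a1; a2; a3] & &, forall u v w, [~ u, v, w] = 1}.

Lemma comm_relP (gT : finGroupType) (a1 a2 a3 : gT) :
  [/\ [/\ [~ a1, a2, a1] = 1, [~ a1, a2, a2] = 1 & [~ a1, a2, a3] = 1],
      [/\ [~ a1, a3, a1] = 1, [~ a1, a3, a2] = 1 & [~ a1, a3, a3] = 1] &
      [/\ [~ a2, a3, a1] = 1, [~ a2, a3, a2] = 1 & [~ a2, a3, a3] = 1]] <->
  comm_rel a1 a2 a3.
Proof.
split=> [[[e1 e2 e3] [e4 e5 e6] [e7 e8 e9]] | cS]; last first.
  by split; split; apply: cS; rewrite !inE eqxx ?orbT.
have sym (u v w : gT) : [~ u, v, w] = 1 -> [~ v, u, w] = 1.
  move=> /eqP/commgP c; apply/eqP/commgP; rewrite -invg_comm.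
  by apply: commute_sym; apply: commuteV; apply: commute_sym.
move=> u v w; rewrite !inE -!orbA.
by case/or3P=> /eqP->; case/or3P=> /eqP->; case/or3P=> /eqP->;
  rewrite ?commgg ?comm1g //; apply: sym.
Qed.

Fixpoint sat_formula (gT : finGroupType) (e : seq gT) (f : Presentation.formula) : Prop :=
  match f with
  | Presentation.Eq2 s t => Presentation.eval e s = Presentation.eval e t
  | Presentation.And f1 f2 => sat_formula e f1 /\ sat_formula e f2
  end.

Lemma bool_of_relE (gT : finGroupType) (e : seq gT) f r :
  Presentation.bool_of_rel (Presentation.rel e f r) <->
  sat_formula e f /\ Presentation.bool_of_rel r.
Proof.
have andE (vT : finType) (v1 v2 : vT) r' :
    Presentation.bool_of_rel (Presentation.and_rel v1 v2 r') <->
    v1 = v2 /\ Presentation.bool_of_rel r'.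
  case: r' => [|wT w1 w2] /=; first by split=> [/eqP | [->]] //.
  by rewrite xpair_eqE; split=> [/andP[/eqP] | [-> ->]]; rewrite ?eqxx.
elim: f r => [s t | f1 IH1 f2 IH2] r /=; first exact: andE.
by rewrite IH1 IH2; split=> [[? [? ?]] | [[? ?] ?]].
Qed.

(** The formula is kept abstract so that a single unfolding of the boolean encoding serves all seven
    presentations. *)
Lemma homGrp3P (F : Presentation.term -> Presentation.term -> Presentation.term ->
      Presentation.formula) (rT : finGroupType) (H : {group rT}) :
  Presentation.hom H (fun a1 => Presentation.Cast (Presentation.Generator (fun a2 =>
    Presentation.Cast (Presentation.Generator (fun a3 =>
      Presentation.Cast (Presentation.Formula (F a1 a2 a3))))))) <->
  exists a b c : rT, <<[set a; b; c]>> = H /\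
    sat_formula [:: a; b; c]
      (F (Presentation.Cst 0) (Presentation.Cst 1) (Presentation.Cst 2)).
Proof.
have E (v : rT * rT * rT) : Presentation.bool_of_rel
    (Presentation.and_rel (<[v.1.1]> <*> <[v.1.2]> <*> <[v.2]>) (H : {set rT})
      (Presentation.rel [:: v.1.1; v.1.2; v.2]
        (F (Presentation.Cst 0) (Presentation.Cst 1) (Presentation.Cst 2))
        Presentation.NoRel)) <->
    <<[set v.1.1; v.1.2; v.2]>> = H /\ sat_formula [:: v.1.1; v.1.2; v.2]
      (F (Presentation.Cst 0) (Presentation.Cst 1) (Presentation.Cst 2)).
  rewrite gen3_join; have := bool_of_relE [:: v.1.1; v.1.2; v.2]
      (F (Presentation.Cst 0) (Presentation.Cst 1) (Presentation.Cst 2)) Presentation.NoRel.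
  case: (Presentation.rel _ _ _) => [|wT w1 w2] /= hr.
    by split=> [/eqP -> | [-> _]]; [split=> //; apply hr | rewrite eqxx].
  rewrite xpair_eqE; split=> [/andP[/eqP-> e] | [-> e]]; first by split=> //; apply hr.
  by rewrite eqxx; apply hr.
split=> [/existsP[v ev] | [a [b [c abc]]]].
  by exists v.1.1, v.1.2, v.2; apply/E.
by apply/existsP; exists (a, b, c); apply/E.
Qed.

Lemma comm_rel_gen (gT : finGroupType) (a b c a' b' c' : gT) :
  <<[set a; b; c]>> = <<[set a'; b'; c']>> -> comm_rel a b c -> comm_rel a' b' c'.
Proof.
move=> eG cS; have /= := class2_gen cS; rewrite eG => cl2.
move=> u v w Su Sv Sw; apply/eqP/commgP.
by apply: (@class2_comm _ <<[set a'; b'; c']>>%G cl2); apply: mem_gen.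
Qed.

Section CommRel.

Variables (gT : finGroupType) (a b c : gT).
Hypothesis cS : comm_rel a b c.
Let K := <<[set a; b; c]>>%G.
Let cl2 : K^`(1) \subset 'Z(K). Proof. exact: class2_gen. Qed.
Let Ka : a \in K. Proof. by rewrite mem_gen // !inE eqxx. Qed.
Let Kb : b \in K. Proof. by rewrite mem_gen // !inE eqxx orbT. Qed.
Let Kc : c \in K. Proof. by rewrite mem_gen // !inE eqxx !orbT. Qed.

Lemma comm_rel_inv : [/\ [~ c^-1, b] = [~ b, c], [~ c^-1, a] = [~ a, c] &
  <<[set c^-1; b; a]>> = <<[set a; b; c]>>].
Proof.
split; [by rewrite (class2_commVl cl2) // invg_comm | by rewrite (class2_commVl cl2) // invg_comm |].
apply/eqP; rewrite eqEsubset !gen_subG; apply/andP; split; apply/subsetP=> z;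
  rewrite !in_setU !in_set1 -orbA => /or3P[]/eqP-> //; last by rewrite -(groupV) mem_gen // !inE eqxx ?orbT.
- by rewrite groupV mem_gen // !inE eqxx ?orbT.
- by rewrite mem_gen // !inE eqxx ?orbT.
- by rewrite mem_gen // !inE eqxx ?orbT.
Qed.

Lemma comm_rel_commute p s i j : 0 < s -> [~ a, b] ^+ p = 1 ->
  commute (a ^+ (i * p ^ s)) (b ^+ (j * p ^ s)).
Proof.
move=> s0 abp; apply/commgP; rewrite (class2_commXl cl2) ?groupX // (class2_commXr cl2) //.
have /dvdnP[m ->] : p %| j * p ^ s by rewrite dvdn_mull ?dvdn_exp.
by rewrite [(m * p)%N]mulnC (expgM [~ a, b]) abp !expg1n.
Qed.

End CommRel.

Lemma gen3_rev (gT : finGroupType) (u v w : gT) : [set u; v; w] = [set w; v; u].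
Proof. by apply/setP=> z; rewrite !inE orbC [(_ == u) || _]orbC orbA. Qed.

(** The inversion aligns the signs for (4)-(6): with (g, x, y) = (c^-1, b, a) the relation [a, b] =
    c^(p^m) becomes [x, y] = g^(p^m), while [g, x] = [b, c] and [g, y] = [a, c]. *)
Lemma comm_rel_fwd (gT : finGroupType) (a b c : gT) : comm_rel a b c ->
  [/\ comm_rel c^-1 b a, <<[set c^-1; b; a]>> = <<[set a; b; c]>>,
      [~ c^-1, b] = [~ b, c] & [~ c^-1, a] = [~ a, c]].
Proof.
move=> cS; have [e1 e2 e3] := comm_rel_inv cS; split=> //.
by apply: comm_rel_gen cS.
Qed.

Lemma comm_rel_bwd (gT : finGroupType) (g x y : gT) : comm_rel g x y ->
  [/\ comm_rel y x g^-1, <<[set y; x; g^-1]>> = <<[set g; x; y]>>,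
      [~ x, g^-1] = [~ g, x] & [~ y, g^-1] = [~ g, y]].
Proof.
move=> cS; have cS' : comm_rel y x g by apply: comm_rel_gen cS; rewrite gen3_rev.
have [e1 e2 e3] := comm_rel_inv cS'.
have eg : <<[set y; x; g^-1]>> = <<[set g; x; y]>> by rewrite (gen3_rev y x g^-1) e3 (gen3_rev y x g).
split=> //; first by apply: comm_rel_gen cS.
  by rewrite -invg_comm e1 invg_comm.
by rewrite -invg_comm e2 invg_comm.
Qed.

Lemma invg_expg2 (gT : finGroupType) (a : gT) m : a ^+ (2 ^ m.+1) = 1 ->
  (a ^+ (2 ^ m))^-1 = a ^+ (2 ^ m).
Proof. by move=> a1; apply/eqP; rewrite eq_invg_mul -expgD addnn -mul2n -expnS a1. Qed.

Section Labels.

Variables (p : nat) (eta : 'F_p).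
Hypothesis p_pr : prime p.

Lemma presented_L1 m (gT : finGroupType) (G : {group gT}) :
  presented_by eta (L1 m.+1 m m) G <->
  presented (rel3 p m.+1 m 0 eta 0) G.
Proof.
apply: isoGrp_presented => rT H; apply: iff_trans (homGrp3P (fun _ _ _ => _) H) _ => /=.
split=> -[a1 [a2 [a3 [defH]]]].
  case=> [r1 [r2 [r3 [r4 [r5 [r6 [r7 [r8 [r9 [r10 [r11 [r12 [r13 [r14 r15]]]]]]]]]]]]]].
  exists a1, a2, a3; split=> //; rewrite !addn1 in r1 r2 r3.
  split=> //; first by apply/comm_relP.
  by rewrite !mul0n !expg0 mul1g mulg1.
case=> r1 r2 r3 /comm_relP[[r7 r8 r9] [r10 r11 r12] [r13 r14 r15]].
rewrite !mul0n !expg0 mul1g mulg1 => -[r4 r5 r6].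
by exists a1, a2, a3; rewrite !addn1; do !split.
Qed.

Let Fp1 : ((1 : 'F_p)%R : nat) = 1%N.
Proof. by rewrite -[1%R]/(1%:R)%R val_Fp_nat // modn_small ?prime_gt1. Qed.

Lemma presented_L2 (l : 'F_p) m (gT : finGroupType) (G : {group gT}) :
  presented_by eta (L2 m.+1 m m l) G <->
  presented (rel3 p m.+1 m 0 l (- 1 : 'F_p)%R) G.
Proof.
have he (hT : finGroupType) (z : hT) : z ^+ p = 1 -> z ^+ (-1 : 'F_p)%R = z^-1.
  by move=> zp; rewrite (Fp_expN p_pr) // Fp1.
(* The representative p - 1 of -1 is made opaque; only its effect on elements with trivial p-th
   power matters. *)
move: ((-1 : 'F_p)%R : nat) he => e he.
apply: isoGrp_presented => rT H; apply: iff_trans (homGrp3P (fun _ _ _ => _) H) _ => /=.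
split=> -[a1 [a2 [a3 [defH]]]].
  case=> [r1 [r2 [r3 [r4 [r5 [r6 [r7 [r8 [r9 [r10 [r11 [r12 [r13 [r14 r15]]]]]]]]]]]]]].
  have cS : comm_rel a1 a2 a3 by apply/comm_relP.
  rewrite ?p2 !addn1 in r1 r2 r3; exists a1, a2, a3; split=> //; split=> //.
  rewrite mul0n expg0 mul1g; split=> //; rewrite r5; congr (_ * _).
  by rewrite mulnC expgM he // -expgM -expnSr.
case=> r1 r2 r3 /comm_relP[[r7 r8 r9] [r10 r11 r12] [r13 r14 r15]].
rewrite mul0n expg0 mul1g => -[r4 r5 r6].
exists a1, a2, a3; rewrite !addn1; do !split=> //; rewrite r6; congr (_ * _).
by rewrite mulnC expgM he // -expgM -expnSr.
Qed.

Lemma presented_L3 m (gT : finGroupType) (G : {group gT}) :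
  p = 2 -> presented_by eta (L3 m.+1 m m) G <->
  presented (rel3 p m.+1 m 1 1 0) G.
Proof.
move=> p2; apply: isoGrp_presented => rT H; apply: iff_trans (homGrp3P (fun _ _ _ => _) H) _ => /=.
split=> -[a1 [a2 [a3 [defH]]]].
  case=> [r1 [r2 [r3 [r4 [r5 [r6 [r7 [r8 [r9 [r10 [r11 [r12 [r13 [r14 r15]]]]]]]]]]]]]].
  have cS : comm_rel a1 a2 a3 by apply/comm_relP.
  rewrite ?p2 !addn1 in r1 r2 r3; exists a1, a2, a3; split=> //; split; rewrite ?p2 //.
  rewrite ?p2 !mul1n mul0n expg0 mulg1; split=> //.
  by rewrite -invg_comm r5 invg_expg2.
case=> r1 r2 r3 /comm_relP[[r7 r8 r9] [r10 r11 r12] [r13 r14 r15]].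
rewrite p2 !mul1n mul0n expg0 mulg1 => -[r4 r5 r6].
rewrite p2 in r1 r2 r3.
exists a1, a2, a3; rewrite !addn1; do !split=> //.
by rewrite -invg_comm r6 invg_expg2.
Qed.

Lemma presented_L4 m (gT : finGroupType) (G : {group gT}) :
  presented_by eta (L4 m.+1 m.+1 m) G <->
  presented (rel3 p m m.+1 0 eta 0) G.
Proof.
apply: isoGrp_presented => rT H; apply: iff_trans (homGrp3P (fun _ _ _ => _) H) _ => /=.
split=> -[a1 [a2 [a3 [defH]]]].
  case=> [r1 [r2 [r3 [r4 [r5 [r6 [r7 [r8 [r9 [r10 [r11 [r12 [r13 [r14 r15]]]]]]]]]]]]]].
  have cS : comm_rel a1 a2 a3 by apply/comm_relP.
  rewrite ?p2 !addn1 in r1 r2 r3; have [cS' eG e1 e2] := comm_rel_fwd cS.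
  exists a3^-1, a2, a1; rewrite eG; split=> //; split; rewrite ?p2 ?expgVn ?r3 ?invg1 //.
  rewrite e1 e2 -invg_comm r6; split=> //.
    by rewrite mul0n expg0 mul1g.
  by rewrite mul0n expg0 mulg1.
case=> r1 r2 r3 cS; have [/comm_relP[[r7 r8 r9] [r10 r11 r12] [r13 r14 r15]] eG e1 e2] := comm_rel_bwd cS.
case=> r4 r5 r6; rewrite ?p2 in r1 r2 r3 r4 r5 r6.
rewrite mul0n expg0 mul1g in r5; rewrite mul0n expg0 mulg1 in r6.
rewrite -e1 in r5; rewrite -e2 in r6.
have q1 : a1^-1 ^+ (p ^ m.+1) = 1 by rewrite expgVn r1 invg1.
have q4 : [~ a3, a2] = a1^-1 ^+ (p ^ m) by rewrite expgVn -r4 invg_comm.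
exists a3, a2, a1^-1; rewrite eG !addn1.
by do !split.
Qed.

Lemma presented_L5 (l : 'F_p) m (gT : finGroupType) (G : {group gT}) :
  presented_by eta (L5 m.+1 m.+1 m l) G <->
  presented (rel3 p m m.+1 0 l (1 : 'F_p)%R) G.
Proof.
rewrite Fp1; apply: isoGrp_presented => rT H; apply: iff_trans (homGrp3P (fun _ _ _ => _) H) _ => /=.
split=> -[a1 [a2 [a3 [defH]]]].
  case=> [r1 [r2 [r3 [r4 [r5 [r6 [r7 [r8 [r9 [r10 [r11 [r12 [r13 [r14 r15]]]]]]]]]]]]]].
  have cS : comm_rel a1 a2 a3 by apply/comm_relP.
  rewrite ?p2 !addn1 in r1 r2 r3; have [cS' eG e1 e2] := comm_rel_fwd cS.
  exists a3^-1, a2, a1; rewrite eG; split=> //; split; rewrite ?p2 ?expgVn ?r3 ?invg1 //.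
  rewrite e1 e2 -invg_comm r6; split=> //.
    by rewrite mul0n expg0 mul1g.
  (* The presentation has the two factors in the opposite order; they commute because [a1, a2] has
     trivial p-th power. *)
  rewrite r5 -[(p ^ m.+1)%N in X in X * _]mul1n; apply: (comm_rel_commute cS) => //.
  by rewrite r6 -expgM -expnSr.
case=> r1 r2 r3 cS; have [/comm_relP[[r7 r8 r9] [r10 r11 r12] [r13 r14 r15]] eG e1 e2] := comm_rel_bwd cS.
case=> r4 r5 r6; rewrite ?p2 in r1 r2 r3 r4 r5 r6.
rewrite mul0n expg0 mul1g in r5.
have c32 : [~ a3, a2] ^+ p = 1 by rewrite -invg_comm r4 expgVn -expgM -expnSr r1 invg1.
have cS3 : comm_rel a3 a2 a1 by apply: comm_rel_gen cS; rewrite gen3_rev.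
rewrite -(comm_rel_commute cS3 1%N l (ltn0Sn m) c32) mul1n in r6.
rewrite -e1 in r5; rewrite -e2 in r6.
have q1 : a1^-1 ^+ (p ^ m.+1) = 1 by rewrite expgVn r1 invg1.
have q4 : [~ a3, a2] = a1^-1 ^+ (p ^ m) by rewrite expgVn -r4 invg_comm.
exists a3, a2, a1^-1; rewrite eG !addn1.
by do !split.
Qed.

Lemma presented_L6 m (gT : finGroupType) (G : {group gT}) :
  p = 2 -> presented_by eta (L6 m.+1 m.+1 m) G <->
  presented (rel3 p m m.+1 1 1 0) G.
Proof.
move=> p2; apply: isoGrp_presented => rT H; apply: iff_trans (homGrp3P (fun _ _ _ => _) H) _ => /=.
split=> -[a1 [a2 [a3 [defH]]]].
  case=> [r1 [r2 [r3 [r4 [r5 [r6 [r7 [r8 [r9 [r10 [r11 [r12 [r13 [r14 r15]]]]]]]]]]]]]].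
  have cS : comm_rel a1 a2 a3 by apply/comm_relP.
  rewrite ?p2 !addn1 in r1 r2 r3; have [cS' eG e1 e2] := comm_rel_fwd cS.
  exists a3^-1, a2, a1; rewrite eG; split=> //; split; rewrite ?p2 ?expgVn ?r3 ?invg1 //.
  rewrite e1 e2 -invg_comm r6; split=> //.
    have c12 : [~ a1, a2] ^+ 2 = 1 by rewrite r6 -expgM -expnSr.
    by have := comm_rel_commute cS 1%N 1%N (ltn0Sn m) c12; rewrite r4 !mul1n.
  by rewrite !mul1n mul0n expg0 mulg1 -invg_comm r5 invg_expg2.
case=> r1 r2 r3 cS; have [/comm_relP[[r7 r8 r9] [r10 r11 r12] [r13 r14 r15]] eG e1 e2] := comm_rel_bwd cS.
case=> r4 r5 r6; rewrite ?p2 in r1 r2 r3 r4 r5 r6.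
rewrite !mul1n mul0n expg0 mulg1 in r5 r6.
have c32 : [~ a3, a2] ^+ 2 = 1 by rewrite -invg_comm r4 expgVn -expgM -expnSr r1 invg1.
have cS3 : comm_rel a3 a2 a1 by apply: comm_rel_gen cS; rewrite gen3_rev.
have := comm_rel_commute cS3 1%N 1%N (ltn0Sn m) c32; rewrite !mul1n => c.
rewrite -c in r5.
have {}r6 : [~ a1, a3] = a2 ^+ (2 ^ m.+1) by rewrite r6.
have q6 : [~ a1^-1, a3] = a2 ^+ (2 ^ m.+1) by rewrite -invg_comm e2 r6 invg_expg2.
rewrite -e1 in r5; rewrite -e2 in r6.
have q1 : a1^-1 ^+ (2 ^ m.+1) = 1 by rewrite expgVn r1 invg1.
have q4 : [~ a3, a2] = a1^-1 ^+ (2 ^ m) by rewrite expgVn -r4 invg_comm.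
exists a3, a2, a1^-1; rewrite eG !addn1.
by do !split.
Qed.

End Labels.

Lemma presented_L7 p (eta : 'F_p) (gT : finGroupType) (G : {group gT}) :
  presented_by eta L7 G <-> presented rel7 G.
Proof.
apply: isoGrp_presented => rT H; apply: iff_trans (homGrp3P (fun _ _ _ => _) H) _ => /=.
split=> -[a [b [c [defH]]]].
  by case=> [r1 [r2 [r3 [r4 [r5 [r6 [r7 r8]]]]]]]; exists a, b, c.
by case=> r1 r2 r3 [r7 r8] [r4 r5 r6]; exists a, b, c; do !split.
Qed.

Lemma gen_rel_rel3 p r s al ga de (gT : finGroupType) (G : {group gT}) :
    prime p -> 0 < r -> 0 < s -> p ^ (r + s + s + 3) <= #|G| ->
    gen_rel (rel3 p r s al ga de) G -> presented (rel3 p r s al ga de) G.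
Proof.
move=> p_pr r0 s0 oG [g [x [y [defG rel]]]]; split; first by exists g, x, y.
move=> rT H [g' [x' [y' [defH rel']]]].
apply: (homg_of_card defG defH); apply: leq_trans oG.
exact: card_rel3 p_pr r0 s0 (rel3_pair rel rel').
Qed.

Lemma gen_rel_rel7 (gT : finGroupType) (G : {group gT}) :
  2 ^ 6 <= #|G| -> gen_rel rel7 G -> presented rel7 G.
Proof.
move=> oG [g [x [y [defG rel]]]]; split; first by exists g, x, y.
move=> rT H [g' [x' [y' [defH rel']]]].
apply: (homg_of_card defG defH); apply: leq_trans oG.
exact: card_rel7 (rel7_pair rel rel').
Qed.

(** A zero with v non-zero would exhibit a square root: eta = (u / v)^2, or 1 + 4 ga = (2 u / v +
    e)^2. Over F_2 the form is u^2 + u v + v^2. *)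
Lemma good_coefs_anisotropic p (eta e al ga de u v : 'F_p) : prime p ->
    (odd p -> ~~ is_square eta) -> (e ^+ 2 = 1)%R -> good_coefs eta e al ga de ->
    ((u != 0) || (v != 0))%R ->
  (u ^+ 2 + (de - al) * (u * v) - ga * v ^+ 2 != 0)%R.
Proof.
move=> p_pr eta_ns e2 good uv.
have [v0 | v0] := eqVneq v 0%R.
  move: uv; rewrite v0 eqxx orbF => u0.
  by rewrite !mulr0 expr0n mulr0 subr0 addr0 expf_neq0.
case: good => [[p_odd -> -> ->] | [p_odd -> ns ->] | [p2 -> -> ->]].
- apply: contra (eta_ns p_odd) => /eqP e0; apply/existsP; exists (u / v)%R.
  rewrite expr_div_n; apply/eqP; apply: (canRL (mulfK _)); first exact: expf_neq0.
  by apply/eqP; rewrite eq_sym -subr_eq0 -e0; apply/eqP; ring.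
- apply: contra ns => /eqP e0; apply/existsP; exists (2%:R * (u / v) + e)%R.
  apply/eqP; apply: (mulIf (expf_neq0 2 v0)).
  transitivity ((2%:R * u + e * v) ^+ 2)%R; last first.
    by field.
  transitivity (v ^+ 2 + 4%:R * ga * v ^+ 2 + 4%:R * (u ^+ 2 + (e - 0) * (u * v) - ga * v ^+ 2))%R.
    by rewrite e0; ring.
  transitivity (4%:R * u ^+ 2 + 4%:R * e * (u * v) + e ^+ 2 * v ^+ 2)%R; last by ring.
  by rewrite e2; ring.
rewrite (F2_eq1 p2 v0); have t0 : (1 + 1 = 0 :> 'F_p)%R.
  by rewrite -{2}(F2_opp p2 1%R) subrr.
case: (F2P u p2) => ->.
  by rewrite mul0r mulr0 expr0n /= !add0r expr1n mulr1 (F2_opp p2) oner_neq0.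
by rewrite sub0r !expr1n !mulr1 subrr sub0r oppr_eq0 oner_neq0.
Qed.

(* The label carries redundant data: it is determined by [m] and by the
   coefficients of the normalised relations. *)
Definition labelA p (m : nat) (al ga de : 'F_p) : label p :=
  if al == 1%R then L3 m.+1 m m
  else if de == 0%R then L1 m.+1 m m else L2 m.+1 m m ga.

Definition labelB p (m : nat) (al ga de : 'F_p) : label p :=
  if al == 1%R then L6 m.+1 m.+1 m
  else if de == 0%R then L4 m.+1 m.+1 m else L5 m.+1 m.+1 m ga.

Lemma label_spec p (eta : 'F_p) (t : label p) (gT : finGroupType) (G : {group gT}) :
    prime p -> admissible t -> presented_by eta t G ->
  [\/ [/\ p = 2, t = L7 & presented rel7 G],
      exists m al ga de, [/\ 0 < m, good_coefs eta (-1)%R al ga de,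
        t = labelA m al ga de & presented (rel3 p m.+1 m al ga de) G] |
      exists m al ga de, [/\ 0 < m, good_coefs eta 1%R al ga de,
        t = labelB m al ga de & presented (rel3 p m m.+1 al ga de) G]].
Proof.
move=> p_pr.
have F1 : ((1 : 'F_p)%R : nat) = 1%N.
  by rewrite -[1%R]/(1%:R)%R val_Fp_nat // modn_small ?prime_gt1.
have n01 : (0 == 1 :> 'F_p)%R = false by rewrite eq_sym oner_eq0.
have nN1 : (-1 == 0 :> 'F_p)%R = false by rewrite oppr_eq0 oner_eq0.
case: t => [m1 m2 m3 | m1 m2 m3 l | m1 m2 m3 | m1 m2 m3 | m1 m2 m3 l | m1 m2 m3 |].
- case=> p_odd m0 e1 e2; have [-> ->] : m1 = m3.+1 /\ m2 = m3 by lia.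
  move=> /(presented_L1 eta) pr; constructor 2; exists m3, 0%R, eta, 0%R.
  by rewrite /labelA n01 eqxx; split=> //; apply: Or31.
- case=> p_odd m0 e1 e2 ns; have [-> ->] : m1 = m3.+1 /\ m2 = m3 by lia.
  move=> /(presented_L2 eta p_pr) pr; constructor 2; exists m3, 0%R, l, (-1)%R.
  by rewrite /labelA n01 nN1; split=> //; apply: Or32.
- case=> p2 m0 e1 e2; have [-> ->] : m1 = m3.+1 /\ m2 = m3 by lia.
  move=> /(presented_L3 eta _ _ p2) pr; constructor 2; exists m3, 1%R, 1%R, 0%R.
  by rewrite /labelA eqxx F1; split=> //; apply: Or33.
- case=> p_odd m0 e1 e2; have [-> ->] : m1 = m3.+1 /\ m2 = m3.+1 by lia.
  move=> /(presented_L4 eta) pr; constructor 3; exists m3, 0%R, eta, 0%R.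
  by rewrite /labelB n01 eqxx; split=> //; apply: Or31.
- case=> p_odd m0 e1 e2 ns; have [-> ->] : m1 = m3.+1 /\ m2 = m3.+1 by lia.
  move=> /(presented_L5 eta p_pr) pr; constructor 3; exists m3, 0%R, l, 1%R.
  by rewrite /labelB n01 oner_eq0; split=> //; apply: Or32.
- case=> p2 m0 e1 e2; have [-> ->] : m1 = m3.+1 /\ m2 = m3.+1 by lia.
  move=> /(presented_L6 eta _ _ p2) pr; constructor 3; exists m3, 1%R, 1%R, 0%R.
  by rewrite /labelB eqxx F1; split=> //; apply: Or33.
by move=> p2 /(presented_L7 eta) pr; constructor 1.
Qed.

Section FirstPart.

Variables (p : nat) (eta : 'F_p).
Hypotheses (p_pr : prime p) (eta_ns : odd p -> ~~ is_square eta).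
Variables (gT : finGroupType) (G : {group gT}).
Hypotheses (pG : p.-group G) (mG3 : 'm(G) = 3) (sPZ : 'Phi(G) \subset 'Z(G)).
Hypotheses (abG' : p.-abelem G^`(1)) (oG' : #|G^`(1)| = (p ^ 3)%N).

Let cl2 : G^`(1) \subset 'Z(G).
Proof. by apply: subset_trans sPZ; rewrite (Phi_joing pG) joing_subl. Qed.

Let F1 : ((1 : 'F_p)%R : nat) = 1%N.
Proof. by rewrite -[1%R]/(1%:R)%R val_Fp_nat // modn_small ?prime_gt1. Qed.

Lemma metahamiltonian_presented : metahamiltonian G ->
  exists t : label p, admissible t /\ presented_by eta t G.
Proof.
move=> mG; case: (metahamiltonian_gens p_pr eta_ns pG mG3 sPZ abG' oG' mG).
- case=> p2 oG gen; exists L7; split=> //; apply/presented_L7.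
  by apply: gen_rel_rel7; rewrite ?oG.
- case=> m [al [ga [de [g [x [y [m0 oG good gen rel]]]]]]].
  have {}rel : presented (rel3 p m.+1 m al ga de) G.
    by apply: gen_rel_rel3; rewrite ?oG //; exists g, x, y.
  case: good rel => [[p_odd -> -> ->] | [p_odd -> ns ->] | [p2 -> -> ->]] rel.
  + by exists (L1 m.+1 m m); split; [rewrite /= !addn1 | apply/presented_L1].
  + by exists (L2 m.+1 m m ga); split; [rewrite /= !addn1 | apply/presented_L2].
  + exists (L3 m.+1 m m); split; first by rewrite /= !addn1.
    by apply/presented_L3 => //; rewrite F1 in rel.
case=> m [al [ga [de [g [x [y [m0 oG good gen rel]]]]]]].
have {}rel : presented (rel3 p m m.+1 al ga de) G.
  by apply: gen_rel_rel3; rewrite ?oG //; exists g, x, y.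
case: good rel => [[p_odd -> -> ->] | [p_odd -> ns ->] | [p2 -> -> ->]] rel.
+ by exists (L4 m.+1 m.+1 m); split; [rewrite /= !addn1 | apply/presented_L4].
+ by exists (L5 m.+1 m.+1 m ga); split; [rewrite /= !addn1 | apply/presented_L5].
exists (L6 m.+1 m.+1 m); split; first by rewrite /= !addn1.
by apply/presented_L6 => //; rewrite F1 in rel.
Qed.

Lemma rel3_gen_metahamiltonian r s (e al ga de : 'F_p) : 0 < r -> 0 < s ->
    r = s.+1 \/ s = r.+1 -> (e ^+ 2 = 1)%R -> good_coefs eta e al ga de ->
  presented (rel3 p r s al ga de) G -> metahamiltonian G.
Proof.
move=> r0 s0 rs e2 good [[g [x [y [defG rel]]]] _].
have fr : frame p G g x y by [].
apply: (rel3_metahamiltonian fr rel r0 s0 rs) => u v.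
exact: good_coefs_anisotropic e2 good.
Qed.

Lemma presented_metahamiltonian (t : label p) :
  admissible t -> presented_by eta t G -> metahamiltonian G.
Proof.
move=> adm /(label_spec p_pr adm) [[p2 _ [[a [b [c [defG rel]]]] _]] | |].
- have fr : frame p G a b c by [].
  exact: rel7_metahamiltonian p2 fr rel.
- case=> m [al [ga [de [m0 good _ pr]]]].
  apply: (@rel3_gen_metahamiltonian m.+1 m (-1)%R) good pr => //; first by left.
  by rewrite sqrrN expr1n.
case=> m [al [ga [de [m0 good _ pr]]]].
apply: (@rel3_gen_metahamiltonian m m.+1 1%R) good pr => //; first by right.
by rewrite expr1n.
Qed.

End FirstPart.

(** * Non-isomorphism *)

(** Rows are coordinates of affine maps: k for the linear part, v = (a, b) for the translation. The
    two equations say that the second and third maps commute, k2 M v1 = k1 M v2 with M invertible;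
    unless k1 = k2 = 0, their rows would be proportional. *)
Lemma commuting_pair_degenerate (F : fieldType) (k0 a0 b0 k1 a1 b1 k2 a2 b2 ga de : F) :
    (ga != 0 -> det3 k0 a0 b0 k1 a1 b1 k2 a2 b2 != 0 ->
    k2 * (ga * b1) + -1 * (k1 * (ga * b2)) = 0 ->
    k2 * (a1 + de * b1) + -1 * (k1 * (a2 + de * b2)) = 0 ->
  k1 = 0 /\ k2 = 0)%R.
Proof.
move=> ga0 d0 h1 h2.
have e1 : (k2 * b1 = k1 * b2)%R.
  by apply: (mulfI ga0); apply/eqP; rewrite -subr_eq0 -h1; apply/eqP; ring.
have e2 : (k2 * a1 = k1 * a2)%R.
  apply/eqP; rewrite -subr_eq0; apply/eqP; rewrite -[RHS]h2.
  transitivity (k2 * a1 - k1 * a2 + de * (k2 * b1 - k1 * b2))%R; last by ring.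
  by rewrite e1 subrr mulr0 addr0.
have D0 : (a1 * b2 - b1 * a2 != 0)%R.
  apply: contraNneq d0 => D0; apply/eqP.
  transitivity (k0 * (a1 * b2 - b1 * a2) + a0 * (k2 * b1 - k1 * b2)
    - b0 * (k2 * a1 - k1 * a2))%R; first by rewrite /det3; ring.
  by rewrite D0 e1 e2 !subrr !mulr0 subr0 addr0.
split; apply: (mulIf D0); rewrite mul0r.
  transitivity (a1 * (k1 * b2) - b1 * (k1 * a2))%R; first by ring.
  by rewrite -e1 -e2; ring.
transitivity (b2 * (k2 * a1) - a2 * (k2 * b1))%R; first by ring.
by rewrite e1 e2; ring.
Qed.

(** In the basis v1, v2 of translations, -k0 M is the companion matrix for (ga', de'), while M is
    the one for (ga, de); determinants and traces are then compared. *)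
Lemma conjugate_coefs (F : fieldType) (k0 a0 b0 k1 a1 b1 k2 a2 b2 ga de ga' de' : F) :
    (det3 k0 a0 b0 k1 a1 b1 k2 a2 b2 != 0 ->
    (k1 = 0 /\ k2 = 0) \/ (a0 = 0 /\ b0 = 0) ->
    k1 * (ga * b0) + -1 * (k0 * (ga * b1)) = a2 ->
    k1 * (a0 + de * b0) + -1 * (k0 * (a1 + de * b1)) = b2 ->
    k2 * (ga * b0) + -1 * (k0 * (ga * b2)) = a1 * ga' + a2 * de' ->
    k2 * (a0 + de * b0) + -1 * (k0 * (a2 + de * b2)) = b1 * ga' + b2 * de' ->
  ga' = (- k0) ^+ 2 * ga /\ de' = - k0 * de)%R.
Proof.
move=> d0 deg.
have [d1 e1 e2 e3 e4] : [/\ det3 k0 a0 b0 k1 a1 b1 k2 a2 b2 = k0 * (a1 * b2 - b1 * a2),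
    k1 * (ga * b0) = 0, k1 * (a0 + de * b0) = 0, k2 * (ga * b0) = 0 &
    k2 * (a0 + de * b0) = 0]%R.
  by case: deg => -[-> ->]; split; rewrite /det3; ring.
rewrite e1 e2 e3 e4 !add0r => g1 g2 g3 g4.
have D0 : (a1 * b2 - a2 * b1 != 0)%R.
  by move: d0; rewrite d1 mulf_eq0 negb_or => /andP[_]; rewrite [(b1 * a2)%R]mulrC.
have [] := @lin2_eq0 _ a1 a2 b1 b2 (ga' - (- k0) ^+ 2 * ga)%R (- (de' - - k0 * de))%R D0.
- transitivity (a1 * ga' + a2 * de' - a1 * (k0 ^+ 2 * ga) - a2 * de')%R; first by ring.
  by rewrite -g3 -g2 -g1; ring.
- transitivity (b1 * ga' + b2 * de' - b1 * (k0 ^+ 2 * ga) - b2 * de')%R; first by ring.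
  by rewrite -g4 -g1; ring.
by move=> /subr0_eq -> /eqP; rewrite oppr_eq0 => /eqP/subr0_eq ->.
Qed.

(** * An affine quotient that detects the coefficients *)

Section AffineModel.

Variables (p s : nat) (ga de : nat).
Hypotheses (p_pr : prime p) (p_odd : odd p) (s_gt0 : 0 < s).

Local Notation q := (p ^ s)%N.
Local Notation n := (p ^ s.+1)%N.

Let n_gt1 : 1 < n.
Proof. by rewrite -(exp1n s.+1) ltn_exp2r ?prime_gt1. Qed.

Let natZ_eq a b : ((a%:R == b%:R :> 'Z_n)%R) = (a == b %[mod n]).
Proof. by rewrite -val_eqE /= !val_Zp_nat. Qed.

(** Since s > 0, p^(2s) vanishes modulo p^(s+1), so (1 + p^s k M)(1 + p^s l M) = 1 + p^s (k + l) M: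
    linear parts compose additively. *)
Let q2 : ((q * q)%N%:R = 0 :> 'Z_n)%R.
Proof.
apply/eqP; rewrite -[0%R]/(0%:R)%R natZ_eq mod0n -expnD.
by apply/dvdn_exp2l; rewrite -addn1 leq_add2l.
Qed.

(* The affine map with linear part 1 + p^s k M, where M = [[0, ga], [1, de]], and
   translation (a, b).  The commutator of such a map with the translation by v is
   the translation by p^s k M v up to sign, which determines M up to a scalar and
   conjugacy. *)
Definition aff (k a b : nat) (v : 'Z_n * 'Z_n) : 'Z_n * 'Z_n :=
  (v.1 + (q * k * ga)%N%:R * v.2 + a%:R,
   v.2 + (q * k)%N%:R * (v.1 + de%:R * v.2) + b%:R)%R.

(** The difference d of two points with equal image satisfies d = -p^s k M d. Multiplying by p^s
    gives p^s d = 0, and then d = 0. *)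
Lemma aff_inj k a b : injective (aff k a b).
Proof.
move=> [v1 v2] [w1 w2] e.
have /= /addIr e1 := congr1 fst e; have /= /addIr e2 := congr1 snd e.
rewrite !natrM in e1 e2.
have Q : ((q%:R : 'Z_n) * q%:R = 0)%R by rewrite -natrM q2.
pose d1 := (v1 - w1)%R; pose d2 := (v2 - w2)%R.
have E1 : (d1 = - (q%:R * k%:R * ga%:R * d2))%R.
  apply/eqP; rewrite -addr_eq0; apply/eqP.
  transitivity ((v1 + q%:R * k%:R * ga%:R * v2) - (w1 + q%:R * k%:R * ga%:R * w2))%R.
    by rewrite /d1 /d2; ring.
  by rewrite e1 subrr.
have E2 : (d2 = - (q%:R * k%:R * (d1 + de%:R * d2)))%R.
  apply/eqP; rewrite -addr_eq0; apply/eqP.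
  transitivity ((v2 + q%:R * k%:R * (v1 + de%:R * v2)) - (w2 + q%:R * k%:R * (w1 + de%:R * w2)))%R.
    by rewrite /d1 /d2; ring.
  by rewrite e2 subrr.
have Q1 : (q%:R * d1 = 0)%R.
  rewrite E1; transitivity (- (q%:R * q%:R) * (k%:R * ga%:R * d2))%R; first by ring.
  by rewrite Q oppr0 mul0r.
have Q2 : (q%:R * d2 = 0)%R.
  rewrite E2; transitivity (- (q%:R * q%:R) * (k%:R * (d1 + de%:R * d2)))%R; first by ring.
  by rewrite Q oppr0 mul0r.
have D1 : d1 = 0%R.
  rewrite E1; transitivity (- (k%:R * ga%:R) * (q%:R * d2))%R; first by ring.
  by rewrite Q2 mulr0.
have D2 : d2 = 0%R.
  rewrite E2; transitivity (- k%:R * (q%:R * d1 + de%:R * (q%:R * d2)))%R; first by ring.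
  by rewrite Q1 Q2 !mulr0 addr0 mulr0.
by congr (_, _); apply/eqP; rewrite -subr_eq0; apply/eqP.
Qed.

Definition affp k a b : {perm ('Z_n * 'Z_n)} := perm (@aff_inj k a b).

Lemma affpM k a b l c d :
  affp k a b * affp l c d =
  affp (k + l) (a + c + q * (l * (ga * b))) (b + d + q * (l * (a + de * b))).
Proof.
apply/permP=> -[v1 v2]; rewrite permM !permE /aff /=.
have Q : ((q%:R : 'Z_n) * q%:R = 0)%R by rewrite -natrM q2.
rewrite !natrM !natrD !natrM ?natrD ?natrM; congr (_, _)%R.
  apply/eqP; rewrite -subr_eq0; apply/eqP.
  transitivity ((q%:R * q%:R) * (l%:R * ga%:R * k%:R * (v1 + de%:R * v2)))%R; first by ring.
  by rewrite Q mul0r.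
apply/eqP; rewrite -subr_eq0; apply/eqP.
transitivity ((q%:R * q%:R) * (l%:R * k%:R * (ga%:R * v2 + de%:R * (v1 + de%:R * v2))))%R; first by ring.
by rewrite Q mul0r.
Qed.

Lemma affp_eq k a b k' a' b' :
  affp k a b = affp k' a' b' <->
  [/\ k = k' %[mod p], a = a' %[mod n] & b = b' %[mod n]].
Proof.
split=> [/permP e | [ek ea eb]].
  have := e (0%R, 0%R); rewrite !permE /aff /= !(mulr0, addr0, add0r).
  move=> e0; have /= /eqP ea' := congr1 fst e0; have /= /eqP eb' := congr1 snd e0.
  have ea : a = a' %[mod n] by apply/eqP; rewrite -natZ_eq.
  have eb : b = b' %[mod n] by apply/eqP; rewrite -natZ_eq.
  split=> //.
  have := e (1%R, 0%R); rewrite !permE /aff /= !(mulr0, addr0, add0r, mulr1).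
  rewrite (eqP eb').
  move=> e1; have /= /addIr/eqP := congr1 snd e1; rewrite natZ_eq expnSr -!muln_modr eqn_pmul2l ?expn_gt0 ?prime_gt0 //.
  by move/eqP.
have ek' : ((q * k)%N%:R = (q * k')%N%:R :> 'Z_n)%R.
  by apply/eqP; rewrite natZ_eq expnSr -!muln_modr ek.
apply/permP=> -[v1 v2]; rewrite !permE /aff /= !natrM.
have -> : (a%:R = a'%:R :> 'Z_n)%R by apply/eqP; rewrite natZ_eq ea.
have -> : (b%:R = b'%:R :> 'Z_n)%R by apply/eqP; rewrite natZ_eq eb.
by rewrite !natrM in ek'; rewrite ek'.
Qed.

Lemma affp1 : affp 0 0 0 = 1.
Proof.
by apply/permP=> -[v1 v2]; rewrite permE perm1 /aff /= !muln0 mul0n !(mul0r, addr0).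
Qed.

Lemma affpX k a b m :
  affp k a b ^+ m = affp (k * m) (a * m + q * (k * (ga * b) * 'C(m, 2)))
                         (b * m + q * (k * (a + de * b) * 'C(m, 2))).
Proof.
have Q : ((q%:R : 'Z_n) * q%:R = 0)%R by rewrite -natrM q2.
elim: m => [|m IHm]; first by rewrite expg0 !muln0 affp1.
rewrite expgSr IHm affpM binS bin1; apply/affp_eq; split; first by congr (_ %% _); lia.
  apply/eqP; rewrite -natZ_eq !(natrD, natrM, mulrS) -subr_eq0; apply/eqP.
  transitivity ((q%:R * q%:R) * (k%:R * ga%:R * k%:R * (a%:R + de%:R * b%:R) * 'C(m, 2)%:R) : 'Z_n)%R.
    by ring.
  by rewrite Q mul0r.
apply/eqP; rewrite -natZ_eq !(natrD, natrM, mulrS) -subr_eq0; apply/eqP.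
transitivity ((q%:R * q%:R) * (k%:R * k%:R * (ga%:R * b%:R + de%:R * (a%:R + de%:R * b%:R)) * 'C(m, 2)%:R) : 'Z_n)%R.
  by ring.
by rewrite Q mul0r.
Qed.

Lemma affpXp k a b j : 0 < j ->
  affp k a b ^+ (p ^ j) = affp 0 (a * p ^ j) (b * p ^ j).
Proof.
move=> j0; rewrite affpX; apply/affp_eq.
have C0 z : q * (z * 'C(p ^ j, 2)) = 0 %[mod n].
  have /dvdnP[c ->] : p %| 'C(p ^ j, 2) by rewrite bin2_pX // p_odd.
  have -> : (q * (z * (c * p)) = n * (z * c))%N by rewrite expnSr; ring.
  by rewrite modnMr mod0n.
split.
- by apply/eqP; rewrite mod0n; apply: dvdn_mull; rewrite dvdn_exp.
- by rewrite -modnDmr C0 mod0n addn0.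
by rewrite -modnDmr C0 mod0n addn0.
Qed.

(** The factor [p.-1] stands for -1, parameters being natural numbers; behind p^s only residues
    modulo p count. *)
Lemma affp_comm k a b l c d :
  [~ affp k a b, affp l c d] =
  affp 0 (q * (l * (ga * b) + p.-1 * (k * (ga * d))))
         (q * (l * (a + de * b) + p.-1 * (k * (c + de * d)))).
Proof.
apply: (mulgI (affp l c d * affp k a b)); rewrite -commgC !affpM !mul0n !muln0 !addn0.
have p1 : p.-1 = p - 1 by rewrite subn1.
have P0 : ((q%:R : 'Z_n) * p%:R = 0)%R.
  by apply/eqP; rewrite -natrM -[0%R]/(0%:R)%R natZ_eq mod0n -expnSr modnn.
have hp : ((p.-1)%:R = p%:R - 1 :> 'Z_n)%R by rewrite p1 natrB ?prime_gt0.
apply/affp_eq; split; first by rewrite addnC.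
  apply/eqP; rewrite -natZ_eq !(natrD, natrM) hp -subr_eq0; apply/eqP.
  transitivity (- (q%:R * p%:R) * (k%:R * (ga%:R * d%:R)) : 'Z_n)%R; first by ring.
  by rewrite P0 oppr0 mul0r.
apply/eqP; rewrite -natZ_eq !(natrD, natrM) hp -subr_eq0; apply/eqP.
transitivity (- (q%:R * p%:R) * (k%:R * (c%:R + de%:R * d%:R)) : 'Z_n)%R; first by ring.
by rewrite P0 oppr0 mul0r.
Qed.

Lemma affp_comm3 k a b l c d k' a' b' :
  [~ affp k a b, affp l c d, affp k' a' b'] = 1.
Proof.
have E1 z : (q * (k' * (ga * (q * z))) = q * q * (k' * ga * z))%N by ring.
have E2 z z' : (q * (k' * (q * z + de * (q * z'))) = q * q * (k' * (z + de * z')))%N.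
  by ring.
rewrite affp_comm affp_comm -affp1 mul0n muln0 !addn0 E1 E2; apply/affp_eq; split=> //.
  by apply/eqP; rewrite -natZ_eq natrM q2 mul0r.
by apply/eqP; rewrite -natZ_eq natrM q2 mul0r.
Qed.

(** Modulo p the coordinates (k, a, b) are additive under composition, so a linear form that
    vanishes on generators vanishes throughout. *)
Lemma affp_gen_linear (f1 f2 f3 : 'F_p) (z1 z2 z3 z : {perm ('Z_n * 'Z_n)}) :
    (forall w, w \in [set z1; z2; z3] -> exists k a b,
       w = affp k a b /\ (f1 * k%:R + f2 * a%:R + f3 * b%:R = 0)%R) ->
    z \in <<[set z1; z2; z3]>> -> exists k a b,
       z = affp k a b /\ (f1 * k%:R + f2 * a%:R + f3 * b%:R = 0)%R.
Proof.
move=> hS /gen_prodgP[m [c Sc ->]].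
pose P z := exists k a b, z = affp k a b /\ (f1 * k%:R + f2 * a%:R + f3 * b%:R = 0)%R.
apply: (big_ind P) => [|u v|i _]; last exact: hS.
  by exists 0, 0, 0; rewrite affp1 !mulr0 !addr0.
move=> [k [a [b [-> e]]]] [l [c' [d [-> e']]]]; do 3!eexists; split; first exact: affpM.
have q0 : (q%:R = 0 :> 'F_p)%R by rewrite Fp_pX_eq0.
by rewrite !natrD !natrM q0 !mul0r !addr0 -[RHS](addr0 0%R) -{1}e -e'; ring.
Qed.

(** The first generator has k = -1 so that its commutator with the translation by v is the
    translation by +p^s M v, as [rel3] prescribes. *)
Definition aff_model := <<[set affp p.-1 0 0; affp 0 1 0; affp 0 0 1]>>%G.

Lemma aff_modelP z : z \in aff_model -> exists k a b, z = affp k a b.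
Proof.
move=> Ez; have [|k [a [b [-> _]]]] := @affp_gen_linear 0%R 0%R 0%R _ _ _ z _ Ez.
  move=> w; rewrite !inE -orbA => /or3P[]/eqP->; do 3!eexists; split=> //;
  by rewrite !mul0r !addr0.
by exists k, a, b.
Qed.

Lemma aff_model_rel3 r : 0 < r ->
  rel3 p r s 0 ga de (affp p.-1 0 0) (affp 0 1 0) (affp 0 0 1).
Proof.
move=> r0; have nn : n = 0 %[mod n] by rewrite modnn mod0n.
have pq : (p.-1 + 1 = p)%N by rewrite addn1 prednK ?prime_gt0.
split.
- by rewrite affpXp // !mul0n affp1.
- by rewrite affpXp // mul1n mul0n -affp1; apply/affp_eq.
- by rewrite affpXp // mul1n mul0n -affp1; apply/affp_eq.
- move=> u v w Su Sv Sw; have E h : h \in [set affp p.-1 0 0; affp 0 1 0; affp 0 0 1] ->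
    exists k a b, h = affp k a b by move=> Sh; apply: aff_modelP; apply: mem_gen.
  have [[k [a [b ->]]] [l [c [d ->]]]] := (E u Su, E v Sv).
  by have [k' [a' [b' ->]]] := E w Sw; apply: affp_comm3.
have P0 : ((q%:R : 'Z_n) * p%:R = 0)%R.
  by apply/eqP; rewrite -natrM -[0%R]/(0%:R)%R natZ_eq mod0n -expnSr modnn.
have hp : ((p.-1)%:R = p%:R - 1 :> 'Z_n)%R.
  by rewrite -subn1 natrB ?prime_gt0.
have sq z : q * (p.-1 * (p.-1 * z)) = q * z %[mod n].
  apply/eqP; rewrite -natZ_eq !natrM hp -subr_eq0; apply/eqP.
  transitivity ((q%:R * p%:R) * ((p%:R - 2%:R) * z%:R) : 'Z_n)%R; first by ring.
  by rewrite P0 mul0r.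
have simp := (mul0n, muln0, addn0, add0n, mul1n, muln1).
split.
- by rewrite affp_comm affpXp //; apply/affp_eq; rewrite !simp.
- rewrite affp_comm mul0n expg0 mul1g affpXp //; apply/affp_eq; rewrite !simp; split=> //.
  by have := sq 1%N; rewrite !muln1.
rewrite affp_comm !affpX affpM; apply/affp_eq; rewrite !simp; split=> //.
  by rewrite sq mulnC.
by rewrite sq mulnC.
Qed.

Lemma aff_frame_det (k0 a0 b0 k1 a1 b1 k2 a2 b2 : nat) :
    <<[set affp k0 a0 b0; affp k1 a1 b1; affp k2 a2 b2]>> = aff_model ->
  (det3 k0%:R a0%:R b0%:R k1%:R a1%:R b1%:R k2%:R a2%:R b2%:R != 0 :> 'F_p)%R.
Proof.
move=> gen; apply/eqP=> /det3_eq0[f1 [f2 [f3 [nz e0 e1 e2]]]].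
have sw (u v w u' v' w' : 'F_p) : (u * u' + v * v' + w * w' = u' * u + v' * v + w' * w)%R by ring.
have P z : z \in aff_model -> exists k a b,
    z = affp k a b /\ (f1 * k%:R + f2 * a%:R + f3 * b%:R = 0)%R.
  rewrite -gen; apply: affp_gen_linear => w; rewrite !inE -orbA.
  by case/or3P=> /eqP->; do 3!eexists; split; rewrite // sw.
have mg : affp p.-1 0 0 \in aff_model by rewrite mem_gen // !inE eqxx.
have mx : affp 0 1 0 \in aff_model by rewrite mem_gen // !inE eqxx orbT.
have my : affp 0 0 1 \in aff_model by rewrite mem_gen // !inE eqxx orbT.
have Fn u v : u = v %[mod n] -> (u%:R = v%:R :> 'F_p)%R.
  move=> uv; rewrite (divn_eq u n) (divn_eq v n) uv !natrD !natrM.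
  by rewrite [(p ^ s.+1)%:R%R]Fp_pX_eq0 // !mulr0.
have Fm u v : u = v %[mod p] -> (u%:R = v%:R :> 'F_p)%R.
  move=> uv; rewrite (divn_eq u p) (divn_eq v p) uv !natrD !natrM.
  have -> : (p%:R = 0 :> 'F_p)%R by apply/eqP; rewrite Fp_nat_eq0.
  by rewrite !mulr0.
have [k [a [b [/affp_eq[/Fm ek /Fn ea /Fn eb]]]]] := P _ mg.
rewrite -ek -ea -eb !mulr0 !addr0 => /eqP; rewrite mulf_eq0 Fp_nat_eq0 //.
rewrite gtnNdvd ?orbF; [|by rewrite -ltnS prednK ?prime_gt1 ?prime_gt0 | by rewrite prednK ?prime_gt0].
move=> /eqP f10.
have [k' [a' [b' [/affp_eq[/Fm ek' /Fn ea' /Fn eb']]]]] := P _ mx.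
rewrite -ek' -ea' -eb' !mulr0 !mulr1 add0r addr0 => f20.
have [k'' [a'' [b'' [/affp_eq[/Fm ek'' /Fn ea'' /Fn eb'']]]]] := P _ my.
rewrite -ek'' -ea'' -eb'' !mulr0 !mulr1 !add0r => f30.
by move: nz; rewrite f10 f20 f30 eqxx.
Qed.

Lemma aff_model_invariant r ga' de' : 0 < r -> r = s.+1 \/ s = r.+1 ->
    (ga%:R != 0 :> 'F_p)%R -> gen_rel (rel3 p r s 0 ga' de') aff_model ->
  exists l : 'F_p, (ga'%:R = l ^+ 2 * ga%:R /\ de'%:R = l * de%:R)%R.
Proof.
move=> r0 rs ga0 [z1 [z2 [z3 [gen [gp _ _ _ [rxy rgx rgy]]]]]].
have [k0 [a0 [b0 e1]]] : exists k a b, z1 = affp k a b.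
  by apply: aff_modelP; rewrite -gen mem_gen // !inE eqxx.
have [k1 [a1 [b1 e2]]] : exists k a b, z2 = affp k a b.
  by apply: aff_modelP; rewrite -gen mem_gen // !inE eqxx orbT.
have [k2 [a2 [b2 e3]]] : exists k a b, z3 = affp k a b.
  by apply: aff_modelP; rewrite -gen mem_gen // !inE eqxx orbT.
subst z1 z2 z3; have := aff_frame_det gen.
have Fm u v : u = v %[mod p] -> (u%:R = v%:R :> 'F_p)%R.
  move=> uv; rewrite (divn_eq u p) (divn_eq v p) uv !natrD !natrM.
  have -> : (p%:R = 0 :> 'F_p)%R by apply/eqP; rewrite Fp_nat_eq0.
  by rewrite !mulr0.
have Fq u v : q * u = v * q %[mod n] -> (u%:R = v%:R :> 'F_p)%R.
  rewrite [(v * _)%N]mulnC => /eqP; rewrite expnSr -!muln_modr eqn_pmul2l ?expn_gt0 ?prime_gt0 //.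
  by move/eqP/Fm.
have pm : ((p.-1)%:R = -1 :> 'F_p)%R.
  have p0 : (p%:R = 0 :> 'F_p)%R by apply/eqP; rewrite Fp_nat_eq0.
  by rewrite -subn1 natrB ?prime_gt0 // p0 sub0r.
have simp := (mul0n, muln0, addn0, add0n, mul1n, muln1).
rewrite affp_comm mul0n expg0 mul1g affpXp // in rgx.
have /affp_eq[_ /Fq gx1 /Fq gx2] := rgx.
rewrite affp_comm [(ga' * _)%N]mulnC expgM affpXp // affpX [(de' * _)%N]mulnC expgM affpXp // affpX affpM in rgy.
rewrite !simp in rgy; have /affp_eq[_ gy1 gy2] := rgy.
rewrite [(a1 * _)%N]mulnC [(a2 * _)%N]mulnC -!mulnA -mulnDr [(q * _)%N in RHS]mulnC in gy1.
rewrite [(b1 * _)%N]mulnC [(b2 * _)%N]mulnC -!mulnA -mulnDr [(q * _)%N in RHS]mulnC in gy2.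
move/Fq: gy1 => gy1; move/Fq: gy2 => gy2.
rewrite !(natrD, natrM) pm in gx1 gx2 gy1 gy2.
(* If s = r + 1, the order of the first generator makes its translation vanish modulo p. If r = s +
   1, its p^r-th power is trivial in the model, so the other two generators commute. *)
have rs_eq : (det3 k0%:R a0%:R b0%:R k1%:R a1%:R b1%:R k2%:R a2%:R b2%:R != 0 :> 'F_p)%R ->
    (k1%:R = 0 :> 'F_p /\ k2%:R = 0 :> 'F_p)%R \/ (a0%:R = 0 :> 'F_p /\ b0%:R = 0 :> 'F_p)%R.
  case: rs => rs; [move=> d0; left | move=> _; right]; last first.
    rewrite -rs affpXp // -affp1 in gp; have /affp_eq[_ g1 g2] := gp.
    by split; [rewrite -(Fq 0 a0) | rewrite -(Fq 0 b0)]; rewrite ?muln0 ?g1 ?g2.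
  have Fq0 u : (q * u) %% n = 0%N -> (u%:R = 0 :> 'F_p)%R.
    by move=> h; apply: (Fq u 0%N); rewrite h mul0n mod0n.
  rewrite affp_comm rs affpXp // in rxy; have /affp_eq[_] := rxy.
  rewrite !modnMl => /Fq0 h1 /Fq0 h2; rewrite !(natrD, natrM) pm in h1 h2.
  exact: commuting_pair_degenerate ga0 d0 h1 h2.
move=> d0; exists (- k0%:R)%R; exact: conjugate_coefs d0 (rs_eq d0) gx1 gx2 gy1 gy2.
Qed.

End AffineModel.

Lemma gen_rel_homg (R : forall gT : finGroupType, gT -> gT -> gT -> Prop) :
    (forall (gT rT : finGroupType) (K : {group gT}) (f : {morphism K >-> rT}) a b c,
      a \in K -> b \in K -> c \in K -> R gT a b c -> R rT (f a) (f b) (f c)) ->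
  forall (gT rT : finGroupType) (G : {group gT}) (H : {group rT}),
  gen_rel R G -> H \homg G -> gen_rel R H.
Proof.
move=> hR gT rT G H [a [b [c [defG rel]]]] /homgP[f defH].
exists (f a), (f b), (f c); split.
  by rewrite -morphim_gen3 ?defG // -defG subset_gen.
by apply: hR rel; [apply: gen3_memg defG | apply: gen3_memx defG | apply: gen3_memy defG].
Qed.

Lemma rel3_morph p r s al ga de (gT rT : finGroupType) (K : {group gT})
    (f : {morphism K >-> rT}) a b c : a \in K -> b \in K -> c \in K ->
  rel3 p r s al ga de a b c -> rel3 p r s al ga de (f a) (f b) (f c).
Proof.
move=> Ka Kb Kc [e1 e2 e3 e4 [e5 e6 e7]]; split.
- by rewrite -morphX // e1 morph1.
- by rewrite -morphX // e2 morph1.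
- by rewrite -morphX // e3 morph1.
- have P w : w \in [set f a; f b; f c] -> exists2 w0, w0 \in [set a; b; c] & w = f w0.
    by rewrite !inE -orbA => /or3P[]/eqP->; [exists a | exists b | exists c]; rewrite // !inE eqxx ?orbT.
  have sK w : w \in [set a; b; c] -> w \in K by rewrite !inE -orbA => /or3P[]/eqP->.
  move=> _ _ _ /P[u Su ->] /P[v Sv ->] /P[w Sw ->].
  by rewrite -!morphR ?groupR ?sK // e4 // morph1.
by rewrite -!morphR // -!morphX // e5 e6 e7 !morphM ?groupX.
Qed.

Lemma rel7_morph (gT rT : finGroupType) (K : {group gT})
    (f : {morphism K >-> rT}) a b c : a \in K -> b \in K -> c \in K ->
  rel7 a b c -> rel7 (f a) (f b) (f c).
Proof.
move=> Ka Kb Kc [e1 e2 e3 [e4 e5] [e6 e7 e8]].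
split; try split; rewrite -?morphX // -?morphR ?groupX // ?e1 ?e2 ?e3 ?e4 ?e5 ?morph1 //.
- by rewrite e6 morphM ?groupX.
- by rewrite e7 morphM ?groupX.
by rewrite e8.
Qed.

(** * Largest abelian quotients *)

Lemma cyclic_product n1 n2 n3 : 1 < n1 -> 1 < n2 -> 1 < n3 ->
  exists (gT : finGroupType) (C : {group gT}) (a b c : gT),
    [/\ abelian C, <<[set a; b; c]>> = C, #|C| = (n1 * n2 * n3)%N &
        [/\ a ^+ n1 = 1, b ^+ n2 = 1 & c ^+ n3 = 1]].
Proof.
move=> h1 h2 h3.
pose gT : finGroupType := (('Z_n1 * 'Z_n2) * 'Z_n3)%type.
have Zexp n (z : 'Z_n) : 1 < n -> z ^+ n = 1.
  move=> n1'; rewrite (@Zp_expg (Zp_trunc n).+1); apply: val_inj => /=.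
  by move: (nat_of_ord z) => k; rewrite Zp_cast // modnMl.
have Zgen n (z : 'Z_n) : 1 < n -> exists i, z = (Zp1 : 'Z_n) ^+ i.
  by move=> n1'; exists (z : nat); rewrite (@Zp1_expgz (Zp_trunc n).+1).
pose a : gT := (Zp1, 1, 1); pose b : gT := (1, Zp1, 1); pose c : gT := (1, 1, Zp1).
exists gT, [set: gT]%G, a, b, c.
have cT : abelian [set: gT].
  apply/centsP=> -[[u1 u2] u3] _ [[v1 v2] v3] _; rewrite /commute !mulg_pair.
  by congr (_, _, _); apply: Zp_mulgC.
split=> //.
- apply/eqP; rewrite eqEsubset subsetT; apply/subsetP=> -[[u1 u2] u3] _.
  have [[i ->] [j ->] [k ->]] := And3 (Zgen _ u1 h1) (Zgen _ u2 h2) (Zgen _ u3 h3).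
  have -> : (Zp1 ^+ i, Zp1 ^+ j, Zp1 ^+ k) = a ^+ i * b ^+ j * c ^+ k :> gT.
    by rewrite /a /b /c !expg_pair !expg1n !mulg_pair !mulg1 !mul1g.
  by rewrite !groupM // groupX // mem_gen // !inE eqxx ?orbT.
- by rewrite cardsT !card_prod !card_ord !Zp_cast.
by rewrite !expg_pair !expg1n !Zexp.
Qed.

Lemma good_coefs_det p (eta e al ga de : 'F_p) : prime p ->
    (odd p -> ~~ is_square eta) -> (e ^+ 2 = 1)%R -> good_coefs eta e al ga de ->
  (al * de - ga != 0)%R.
Proof.
move=> p_pr eta_ns e2 good.
have := good_coefs_anisotropic (u := al) (v := 1%R) p_pr eta_ns e2 good.
rewrite oner_neq0 orbT => /(_ isT).
by congr (is_true (_ != _)); ring.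
Qed.

Lemma abelian_comm1 (gT : finGroupType) (C : {group gT}) (u v : gT) :
  abelian C -> u \in C -> v \in C -> [~ u, v] = 1.
Proof. by move=> /centsP cC Cu Cv; apply/eqP/commgP; apply: cC. Qed.

(** With trivial commutators the relations give g^(p^r) = 1, and elimination gives X^(al de - ga) =
    1 besides X^p = 1, so X and Y are trivial. *)
Lemma card_abelian_rel3 p r s (al ga de : 'F_p) (gT : finGroupType) (C : {group gT}) :
    prime p -> (al * de - ga != 0)%R -> abelian C ->
    gen_rel (rel3 p r s al ga de) C ->
  #|C| <= p ^ (r + s + s).
Proof.
move=> p_pr d0 cC [g [x [y [defC [_ xp yp _ [rxy rgx rgy]]]]]].
have [Cg Cx Cy] := And3 (gen3_memg defC) (gen3_memx defC) (gen3_memy defC).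
have p0 : 0 < p := prime_gt0 p_pr.
rewrite !(abelian_comm1 cC) // in rxy rgx rgy.
rewrite [(al * _)%N]mulnC expgM in rgx; rewrite ![(_ * p ^ s)%N]mulnC !expgM in rgy.
move: rgx rgy; set X := x ^+ (p ^ s); set Y := y ^+ (p ^ s) => rgx rgy.
have Xp : X ^+ p = 1 by rewrite -expgM -expnSr.
have eY : Y = X ^- al by apply/eqP; rewrite eq_sym eq_invg_mul -rgx.
have X1 : X = 1.
  have Xq : X ^+ (al * de - ga)%R = 1.
    move: rgy; rewrite eY expgVn => /esym/eqP; rewrite -eq_mulgV1 => /eqP.
    rewrite Fp_expX // Fp_natK => e.
    by rewrite Fp_expD // Fp_expN // e mulrC mulgV.
  rewrite -(Fp_exp1 p_pr Xp) -(mulVf d0) -{1}[(_^-1)%R]Fp_natK -(Fp_expX p_pr _ _ Xp).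
  by rewrite Xq expg1n.
have Y1 : Y = 1 by rewrite eY X1 expg1n invg1.
rewrite -defC !expnD; apply: card_abelian_gen3; rewrite ?expn_gt0 ?p0 ?defC //.
Qed.

Lemma card_abelian_rel7 (gT : finGroupType) (C : {group gT}) :
  abelian C -> gen_rel rel7 C -> #|C| <= 2 ^ 3.
Proof.
move=> cC [a [b [c [defC [_ _ _ _ [rbc rca rab]]]]]].
have [Ca Cb Cc] := And3 (gen3_memg defC) (gen3_memx defC) (gen3_memy defC).
rewrite !(abelian_comm1 cC) // in rbc rca rab.
move: rbc rca; rewrite -rab mulg1 => rbc rb; move: rbc; rewrite -rb mulg1 => ra.
by rewrite -defC -[(2 ^ 3)%N]/(2 * 2 * 2)%N; apply: card_abelian_gen3; rewrite ?defC.
Qed.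

Lemma abelian_gen_rel3 p r s al ga de : prime p -> 0 < r -> 0 < s ->
  exists (gT : finGroupType) (C : {group gT}),
    [/\ abelian C, #|C| = (p ^ (r + s + s))%N & gen_rel (rel3 p r s al ga de) C].
Proof.
move=> p_pr r0 s0; have pX m : 0 < m -> 1 < p ^ m.
  by move=> m0; rewrite -(exp1n m) ltn_exp2r ?prime_gt1.
have [gT [C [a [b [c [cC defC oC [e1 e2 e3]]]]]]] := cyclic_product (pX r r0) (pX s s0) (pX s s0).
have [Ca Cb Cc] := And3 (gen3_memg defC) (gen3_memx defC) (gen3_memy defC).
exists gT, C; split=> //; first by rewrite oC !expnD.
exists a, b, c; split=> //; split.
- by rewrite expnSr expgM e1 expg1n.
- by rewrite expnSr expgM e2 expg1n.
- by rewrite expnSr expgM e3 expg1n.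
- have sC w : w \in [set a; b; c] -> w \in C by rewrite -defC => /mem_gen.
  by move=> u v w Su Sv Sw; rewrite (abelian_comm1 cC) ?groupR ?sC.
by rewrite !(abelian_comm1 cC) // ![(_ * p ^ s)%N]mulnC !expgM e1 e2 e3 !expg1n mulg1.
Qed.

Lemma abelian_gen_rel7 :
  exists (gT : finGroupType) (C : {group gT}),
    [/\ abelian C, #|C| = (2 ^ 3)%N & gen_rel rel7 C].
Proof.
have [gT [C [a [b [c [cC defC oC [e1 e2 e3]]]]]]] := cyclic_product (ltnSn 1) (ltnSn 1) (ltnSn 1).
have [Ca Cb Cc] := And3 (gen3_memg defC) (gen3_memx defC) (gen3_memy defC).
exists gT, C; split; rewrite ?oC //; exists a, b, c; split=> //.
split; rewrite ?(expgM _ 2 2) ?e1 ?e2 ?e3 ?expg1n ?comm1g //.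
by rewrite !(abelian_comm1 cC) // mulg1.
Qed.

(* The exponents of a label are read off the order of the abelianization of the
   group it presents. *)
Lemma presented_abelian_bound (R R' : forall gT : finGroupType, gT -> gT -> gT -> Prop)
    (N N' : nat) (gT : finGroupType) (G : {group gT}) :
    (exists (rT : finGroupType) (C : {group rT}), [/\ abelian C, #|C| = N & gen_rel R C]) ->
    (forall (rT : finGroupType) (C : {group rT}), abelian C -> gen_rel R' C -> #|C| <= N') ->
    (forall (aT rT : finGroupType) (K : {group aT}) (H : {group rT}),
       gen_rel R' K -> H \homg K -> gen_rel R' H) ->
  presented R G -> presented R' G -> N <= N'.
Proof.
move=> [rT [C [cC <- RC]]] bound hR' [_ univ] [R'G _].
by apply: bound => //; apply: hR' R'G (univ _ _ RC).
Qed.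

Definition rel3_homg p r s al ga de :=
  gen_rel_homg (@rel3_morph p r s al ga de).
Definition rel7_homg := gen_rel_homg rel7_morph.

Lemma presented_by_isog p (eta : 'F_p) (t : label p) (gT rT : finGroupType)
    (G : {group gT}) (H : {group rT}) :
  G \isog H -> presented_by eta t H -> presented_by eta t G.
Proof.
by case: t => *; match goal with h : is_true (_ \isog _) |- _ => apply: isoGrp_trans h _ end.
Qed.

Section NonIsomorphic.

Variables (p : nat) (eta : 'F_p).
Hypotheses (p_pr : prime p) (eta_ns : odd p -> ~~ is_square eta).

(** The first presentation maps G onto the affine model for (ga, de), which therefore satisfies the
    second relations; hence ga' = l^2 ga and de' = l de. As de and de' are 0 or e, a non-zero de
    forces l = 1. *)
Lemma rel3_coefs_invariant r s (e e' al ga de al' ga' de' : 'F_p)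
    (gT : finGroupType) (G : {group gT}) :
    odd p -> 0 < r -> 0 < s -> r = s.+1 \/ s = r.+1 -> e = e' -> (e ^+ 2 = 1)%R ->
    good_coefs eta e al ga de -> good_coefs eta e' al' ga' de' ->
    presented (rel3 p r s al ga de) G -> presented (rel3 p r s al' ga' de') G ->
  [/\ al = al', (de == 0)%R = (de' == 0)%R & (de != 0)%R -> ga = ga'].
Proof.
move=> p_odd r0 s0 rs <- e2 good good' pr pr'.
have not2 (q : nat) : p = 2 -> False by move=> p2; rewrite p2 in p_odd.
have al0 : al = 0%R by case: good => [[]|[]|[/not2]].
have al0' : al' = 0%R by case: good' => [[]|[]|[/not2]].
have := good_coefs_det p_pr eta_ns e2 good; rewrite al0 mul0r sub0r oppr_eq0 => ga0.
move: pr pr'; rewrite al0 al0' => -[_ univ] [gen' _].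
have homE : aff_model ga de p_pr s0 \homg G.
  by apply: univ; do 3!eexists; split; last exact: aff_model_rel3.
have [|l] := aff_model_invariant p_odd r0 rs _ (rel3_homg gen' homE).
  by rewrite Fp_natK.
rewrite !Fp_natK => -[ega ede].
have := good_coefs_det p_pr eta_ns e2 good'; rewrite al0' mul0r sub0r oppr_eq0 => ga0'.
have l0 : l != 0%R.
  by apply: contraNneq ga0' => l0; rewrite ega l0 expr0n mul0r.
split=> // [|de0]; first by rewrite ede mulf_eq0 (negPf l0).
have de0' : de' != 0%R by rewrite ede mulf_neq0.
have ee : de = e.
  by case: good de0 => [[_ _ _ ->] | [] | [/not2]]; rewrite ?eqxx.
have ee' : de' = e.
  by case: good' de0' => [[_ _ _ ->] | [] | [/not2]]; rewrite ?eqxx.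
have l1 : l = 1%R.
  by apply: (mulIf de0); rewrite mul1r -ede ee' ee.
by rewrite ega l1 expr1n mul1r.
Qed.

Lemma good_coefs_al_inj (e e' al ga de al' ga' de' : 'F_p) :
  good_coefs eta e al ga de -> good_coefs eta e' al' ga' de' -> al = al'.
Proof.
have odd2 : p = 2 -> odd p -> False by move=> ->.
by case=> -[h -> _ _]; case=> -[h' -> _ _] //; case: odd2.
Qed.

Lemma good_coefs_even (e al ga de : 'F_p) :
  ~~ odd p -> good_coefs eta e al ga de -> al = 1%R.
Proof. by move=> /negPf p2 [[]|[]|[]]; rewrite ?p2. Qed.

(** The abelianization has order p^n with n = 3 for (7), 3 m + 1 for (1)-(3) and 3 m + 2 for
    (4)-(6), so n modulo 3 separates the three kinds and n gives m. *)
Lemma presented_by_inj (t t' : label p) (gT : finGroupType) (G : {group gT}) :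
  admissible t -> admissible t' ->
  presented_by eta t G -> presented_by eta t' G -> t = t'.
Proof.
pose abelianized (R : forall gT : finGroupType, gT -> gT -> gT -> Prop) n :=
  [/\ exists (rT : finGroupType) (C : {group rT}),
        [/\ abelian C, #|C| = (p ^ n)%N & gen_rel R C],
      forall (rT : finGroupType) (C : {group rT}),
        abelian C -> gen_rel R C -> #|C| <= p ^ n
    & forall (aT rT : finGroupType) (K : {group aT}) (H : {group rT}),
        gen_rel R K -> H \homg K -> gen_rel R H].
have le_ab R R' n n' : abelianized R n -> abelianized R' n' ->
    presented R G -> presented R' G -> n <= n'.
  move=> [ex _ _] [_ bound hR'] pr pr'.
  by rewrite -(leq_exp2l _ _ (prime_gt1 p_pr)); apply: presented_abelian_bound ex bound hR' pr pr'.
have eq_ab R R' n n' : abelianized R n -> abelianized R' n' ->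
    presented R G -> presented R' G -> n = n'.
  by move=> ab ab' pr pr'; apply/eqP; rewrite eqn_leq (le_ab _ _ _ _ ab ab') ?(le_ab _ _ _ _ ab' ab).
have ab7 : p = 2 -> abelianized rel7 3.
  rewrite /abelianized => ->; split; [exact: abelian_gen_rel7 | exact: card_abelian_rel7 | exact: rel7_homg].
have ab3 r s (e al ga de : 'F_p) : 0 < r -> 0 < s -> (e ^+ 2 = 1)%R ->
    good_coefs eta e al ga de -> abelianized (@rel3 p r s al ga de) (r + s + s).
  move=> r0 s0 e2 good; split; [exact: abelian_gen_rel3 | | exact: rel3_homg].
  by move=> rT C; apply: card_abelian_rel3 p_pr (good_coefs_det p_pr eta_ns e2 good).
have N2 : ((-1) ^+ 2 = 1 :> 'F_p)%R by rewrite sqrrN expr1n.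
have P2 : (1 ^+ 2 = 1 :> 'F_p)%R by rewrite expr1n.
move=> adm adm' /(label_spec p_pr adm) sp /(label_spec p_pr adm') sp'.
case: sp => [[p2 -> pr] | [m [al [ga [de [m0 good -> pr]]]]] | [m [al [ga [de [m0 good -> pr]]]]]];
case: sp' => [[p2' -> pr'] | [m' [al' [ga' [de' [m0' good' -> pr']]]]] | [m' [al' [ga' [de' [m0' good' -> pr']]]]]] //.
- by exfalso; have := eq_ab _ _ _ _ (ab7 p2) (ab3 _ _ _ _ _ _ (ltn0Sn _) m0' N2 good') pr pr'; lia.
- by exfalso; have := eq_ab _ _ _ _ (ab7 p2) (ab3 _ _ _ _ _ _ m0' (ltn0Sn _) P2 good') pr pr'; lia.
- by exfalso; have := eq_ab _ _ _ _ (ab3 _ _ _ _ _ _ (ltn0Sn _) m0 N2 good) (ab7 p2') pr pr'; lia.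
- have mm : m = m'.
    have := eq_ab _ _ _ _ (ab3 _ _ _ _ _ _ (ltn0Sn _) m0 N2 good) (ab3 _ _ _ _ _ _ (ltn0Sn _) m0' N2 good') pr pr'; lia.
  subst m'; rewrite /labelA (good_coefs_al_inj good good').
  case: (boolP (odd p)) => [p_odd | p_even]; last by rewrite (good_coefs_even p_even good') eqxx.
  have [_ <- eq_ga] := rel3_coefs_invariant p_odd (ltn0Sn m) m0 (or_introl erefl) erefl N2 good good' pr pr'.
  by case: eqVneq => // _; case: eqVneq => // de0; rewrite eq_ga.
- by exfalso; have := eq_ab _ _ _ _ (ab3 _ _ _ _ _ _ (ltn0Sn _) m0 N2 good) (ab3 _ _ _ _ _ _ m0' (ltn0Sn _) P2 good') pr pr'; lia.
- by exfalso; have := eq_ab _ _ _ _ (ab3 _ _ _ _ _ _ m0 (ltn0Sn _) P2 good) (ab7 p2') pr pr'; lia.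
- by exfalso; have := eq_ab _ _ _ _ (ab3 _ _ _ _ _ _ m0 (ltn0Sn _) P2 good) (ab3 _ _ _ _ _ _ (ltn0Sn _) m0' N2 good') pr pr'; lia.
have mm : m = m'.
  have := eq_ab _ _ _ _ (ab3 _ _ _ _ _ _ m0 (ltn0Sn _) P2 good) (ab3 _ _ _ _ _ _ m0' (ltn0Sn _) P2 good') pr pr'; lia.
subst m'; rewrite /labelB (good_coefs_al_inj good good').
case: (boolP (odd p)) => [p_odd | p_even]; last by rewrite (good_coefs_even p_even good') eqxx.
have [_ <- eq_ga] := rel3_coefs_invariant p_odd m0 (ltn0Sn m) (or_intror erefl) erefl P2 good good' pr pr'.
by case: eqVneq => // _; case: eqVneq => // de0; rewrite eq_ga.
Qed.

End NonIsomorphic.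

Local Close Scope group_scope.

Theorem theorem8p1 (p : nat) (eta : 'F_p) :
  prime p ->
  (odd p -> ~~ is_square eta) ->
  (forall (gT : finGroupType) (G : {group gT}),
      (p.-group G)%g ->
      ('m(G))%g = 3 ->
      ('Phi(G) \subset 'Z(G))%g ->
      (p.-abelem G^`(1))%g ->
      #|(G^`(1))%g| = p ^ 3 ->
      (metahamiltonian G <->
       exists t : label p, admissible t /\ presented_by eta t G)) /\
  (forall (t t' : label p) (gT gT' : finGroupType)
          (G : {group gT}) (G' : {group gT'}),
      admissible t -> admissible t' ->
      presented_by eta t G -> presented_by eta t' G' ->
      (G \isog G')%g -> t = t').
Proof.
move=> p_pr eta_ns; split.
  move=> gT G pG mG3 sPZ abG' oG'; split; first exact: metahamiltonian_presented.
  by case=> t [adm pr]; apply: presented_metahamiltonian pr.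
move=> t t' gT gT' G G' adm adm' pr pr' iso.
exact: presented_by_inj adm adm' pr (presented_by_isog iso pr').
Qed.
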